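(* Let $D\subset\mathbb{R}^n$ belong to $\mathcal{S}_R$, let $r>0$ be such that $D\in\mathcal{C}^{1,1}_r(\mathbb{R}^n)$, and let $T>0$. Then there exist constants $c_1,c_2>0$, depending only on $n$, $r$, $T$ and $R_D$, such that for all $x,y\in D$, all $0<t<T$ and any half-spaces $H_x,H_y$ with $D\subset H_x$, $D\subset H_y$, $\delta_D(x)=\delta_{H_x}(x)$ and $\delta_D(y)=\delta_{H_y}(y)$, $$c_1\,g(t,x,y)\,p(t,x,y)\leq p_D(t,x,y)\leq c_2\,g(t,x,y)\,p(t,x,y),$$ where $$g(t,x,y)=\left(1\wedge \frac{\delta_D(x)\delta_D(y)}{t}\right)+\left(1\wedge \frac{\delta_{H_x}(x)\delta_{H_x}(y)}{t}\right)\left(1\wedge \frac{\delta_{H_y}(y)\delta_{H_y}(x)}{t}\right).$$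
   Context: A domain is an open connected subset of $\mathbb{R}^n$. $a\wedge b=\min\{a,b\}$. $p(t,x,y)=(4\pi t)^{-n/2}e^{-|x-y|^2/(4t)}$ is the global heat kernel of the Laplacian $\Delta$ on $\mathbb{R}^n$. $p_D(t,x,y)$ is the Dirichlet heat kernel of $D$: the fundamental solution of the heat equation $\partial_t u=\Delta u$ in $D$ with Dirichlet condition on $\partial D$; equivalently, the transition density of Brownian motion (normalized to have transition density $p(t,x,y)$) killed upon leaving $D$. For an open set $E$ and $x\in E$, $\delta_E(x)$ is the distance from $x$ to $\partial E$. Half-spaces are open. A $\mathcal{C}^{1,1}$ set is one whose boundary is locally the graph of a $\mathcal{C}^{1,1}$ function; $\mathcal{C}^{1,1}_r(\mathbb{R}^n)$ denotes the class of $\mathcal{C}^{1,1}$ sets such that for every boundary point $z\in\partial D$ there are two balls of radius at least $r$ tangent to $D$ at $z$, one contained in $D$ and the other in $D^c$. For a convex $\mathcal{C}^{1,1}$ domain $D$ and $w\in\partial D$, $H_w$ is the open half-space containing $D$ whose boundary is the tangent hyperplane to $D$ at $w$. $\overline{wz}$ denotes the line segment joining $w$ and $z$. For a strictly convex $\mathcal{C}^{1,1}$ domain $D$ (with at least two boundary points) put $$R_{D}:=\min\left\{\inf_{\substack{w,z\in\partial D,\ w\neq z\\ \delta_D\left(\frac{w+z}2\right)\leq1}}\frac{\delta_D\left(\frac{w+z}{2}\right)}{\delta_{H_{w}}\left(\frac{w+z}2\right)},\ \inf_{\substack{w,z\in\partial D,\ w\neq z\\ \delta_D\left(\frac{w+z}2\right)>1}}\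 \sup_{\substack{m\in\overline{wz}\\ \delta_D(m)>1}}\frac{\delta_D(m)}{\delta_{H_{w}}(m)}\right\}\in[0,1]$$ (with $\inf\emptyset=+\infty$). $\mathcal{S}_R$ is the class of strictly convex domains $D$ that belong to $\mathcal{C}^{1,1}_r(\mathbb{R}^n)$ for some $r>0$ and satisfy $R_D>0$. *)

(* Defs.v *)
(* MathComp-Analysis *)
From HB Require Import structures.
From mathcomp Require Import all_boot all_order all_algebra.
From mathcomp Require Import all_classical all_reals all_analysis.

Set Implicit Arguments.
Unset Strict Implicit.
Unset Printing Implicit Defensive.

Import Order.TTheory GRing.Theory Num.Theory.
Import numFieldNormedType.Exports.

Local Open Scope classical_set_scope.
Local Open Scope ring_scope.

Section Euclidean.
Context {R : realType} {n : nat}.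
Implicit Types (D E H : set 'rV[R]_n) (a w x y z : 'rV[R]_n) (r : R).

Definition dot x y : R := \sum_(i < n) x 0 i * y 0 i.

(* `|x| is the sup norm on 'rV[R]_n: same topology, different distance. *)
Definition enorm x : R := Num.sqrt (dot x x).

Definition eball x r : set 'rV[R]_n := [set y | enorm (y - x) < r].

Definition segment w z : set 'rV[R]_n :=
  [set (1 - s) *: w + s *: z | s in [set s : R | 0 <= s <= 1]].

Definition midpoint w z : 'rV[R]_n := 2^-1 *: (w + z).

Definition boundary E : set 'rV[R]_n := closure E `\` E°.

Definition delta E x : R := inf [set enorm (x - z) | z in boundary E].

Definition is_domain D : Prop := [/\ D !=set0, open D & connected D].

Definition strictly_convex D : Prop :=
  forall w z (s : R), closure D w -> closure D z -> w <> z -> 0 < s < 1 ->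
    D° ((1 - s) *: w + s *: z).

Definition is_halfspace H : Prop :=
  exists a (c : R), a <> 0 /\ H = [set x | c < dot a x].

End Euclidean.

Definition C11_fun (R : realType) (m : nat) (f : 'rV[R]_m -> R) : Prop :=
  (forall x, differentiable f x) /\
  exists L : R, forall (i : 'I_m) x y,
    `|'D_(delta_mx 0 i) f x - 'D_(delta_mx 0 i) f y| <= L * enorm (x - y).

Section SmoothConvex.
Context {R : realType} {n : nat}.
Implicit Types (D H : set 'rV[R]_n) (w x z : 'rV[R]_n) (r : R).

(* In the orthonormal coordinates x *m Q, the i-th coordinate is a function f
   of the other ones, which are collected in col' i (x *m Q). *)
Definition C11_set D : Prop :=
  forall w, boundary D w ->
  exists (Q : 'M[R]_n) (i : 'I_n) (f : 'rV[R]_n.-1 -> R),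
    [/\ Q *m Q^T = 1%:M, C11_fun f &
      \forall x \near w,
        boundary D x <-> (x *m Q) 0 i = f (col' i (x *m Q))].

Definition C11r r D : Prop :=
  C11_set D /\
  forall z, boundary D z ->
    (exists (a : 'rV[R]_n) (s : R), [/\ r <= s, enorm (z - a) = s & eball a s `<=` D]) /\
    (exists (b : 'rV[R]_n) (s : R), [/\ r <= s, enorm (z - b) = s & eball b s `<=` ~` D]).

(* H is an open half-space containing D, and its boundary is the hyperplane
   tangent to boundary D at w: the distance from z in boundary D to that
   hyperplane is o(|z - w|) as z tends to w. *)
Definition is_tangent_halfspace D w H : Prop :=
  exists a : 'rV[R]_n,
    [/\ a <> 0, H = [set x | dot a w < dot a x], D `<=` H &
      dot a (z - w) / enorm (z - w)
        @[z --> within (boundary D `\ w) (nbhs w)] --> 0].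

(* The default set0 is irrelevant: for a convex C^{1,1} domain D and w in
   boundary D there is exactly one such half-space. *)
Definition tangent_halfspace D w : set 'rV[R]_n :=
  xget set0 [set H | is_tangent_halfspace D w H].

Definition distance_ratio D w (m : 'rV[R]_n) : R :=
  delta D m / delta (tangent_halfspace D w) m.

Definition RD D : \bar R :=
  Order.min
    (ereal_inf [set e | exists w z,
      [/\ boundary D w, boundary D z, w <> z,
          delta D (midpoint w z) <= 1 &
          e = (distance_ratio D w (midpoint w z))%:E]])
    (ereal_inf [set e | exists w z,
      [/\ boundary D w, boundary D z, w <> z,
          1 < delta D (midpoint w z) &
          e = ereal_sup [set (distance_ratio D w m)%:E |
                         m in [set m | segment w z m /\ 1 < delta D m]]]]).

Definition SR D : Prop :=
  [/\ is_domain D, strictly_convex D,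
      (exists w z, [/\ boundary D w, boundary D z & w <> z]),
      (exists2 r : R, 0 < r & C11r r D) & (0 < RD D)%E].

End SmoothConvex.

(* Iterated Lebesgue integral, coordinate by coordinate; it is only applied to
   continuous functions with compact support. *)
Fixpoint integral_Rn (R : realType) (n : nat) : ('rV[R]_n -> R) -> R :=
  match n with
  | 0%N => fun f => f 0
  | m.+1 => fun f =>
      \int[@lebesgue_measure R]_(s in [set: R])
        integral_Rn (fun v : 'rV[R]_m => f (row_mx s%:M v : 'rV[R]_m.+1))
  end.

Section HeatKernel.
Context {R : realType} {n : nat}.
Implicit Types (D : set 'rV[R]_n) (x y z : 'rV[R]_n) (t : R).
Implicit Types (u v : R -> 'rV[R]_n -> R).

Definition heat_kernel t x y : R :=
  (4 * pi * t) `^ (- (n%:R / 2)) * expR (- (enorm (x - y) ^+ 2 / (4 * t))).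

Definition Dt u t x : R := 'D_1 (fun s : R => u s x) t.
Definition Dx (i : 'I_n) u t x : R := 'D_(delta_mx 0 i) (u t) x.

Definition jointly_continuous_at u t x : Prop :=
  {for (t, x), continuous (fun q : R * 'rV[R]_n => u q.1 q.2)}.

(* u is a C^{1,2} solution of the heat equation in (0, +oo) x D. *)
Definition heat_solution D u : Prop :=
  forall t x, 0 < t -> D x ->
  [/\ jointly_continuous_at u t x,
      derivable (fun s : R => u s x) t 1 /\ jointly_continuous_at (Dt u) t x,
      forall i : 'I_n,
        derivable (u t) x (delta_mx 0 i) /\
        jointly_continuous_at (Dx i u) t x,
      forall i j : 'I_n,
        derivable (Dx i u t) x (delta_mx 0 j) /\
        jointly_continuous_at (Dx j (Dx i u)) t x &
      Dt u t x = \sum_(i < n) Dx i (Dx i u) t x].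

Definition test_function D (phi : 'rV[R]_n -> R) : Prop :=
  continuous phi /\
  exists K : set 'rV[R]_n,
    [/\ compact K, K `<=` D & forall x, ~ K x -> phi x = 0].

Definition fundamental_solution D y u : Prop :=
  [/\ forall t x, 0 < t -> D x -> 0 <= u t x,
      heat_solution D u &
      forall phi, test_function D phi ->
        integral_Rn (fun x => u t x * phi x) @[t --> 0^'+] --> phi y].

Definition dirichlet_condition D u : Prop :=
  forall t z, 0 < t -> boundary D z ->
    u q.1 q.2 @[q --> within [set q : R * 'rV[R]_n | D q.2] (nbhs (t, z))] --> 0.

(* Minimality among the nonnegative fundamental solutions singles out one
   kernel: without it, solutions whose initial data live on the boundary of D
   (e.g. x t^{-3/2} e^{-x^2/(4t)} on the half-line) could be added. *)
Definition dirichlet_heat_kernel D (pD : R -> 'rV[R]_n -> 'rV[R]_n -> R)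
    : Prop :=
  forall y, D y ->
  [/\ fundamental_solution D y (fun t x => pD t x y),
      dirichlet_condition D (fun t x => pD t x y) &
      forall v, fundamental_solution D y v ->
        forall t x, 0 < t -> D x -> pD t x y <= v t x].

Definition g_factor D (Hx Hy : set 'rV[R]_n) t x y : R :=
  Num.min 1 (delta D x * delta D y / t)
  + Num.min 1 (delta Hx x * delta Hx y / t)
    * Num.min 1 (delta Hy y * delta Hy x / t).

End HeatKernel.

(* Main.v *)
(* Everything rests on explicit sub- and supersolutions and the maximum
   principle. By minimality p_D is at most the kernel of each half-space
   H containing D, that is p (1 - exp (- xi(x) xi(y) / t)) with xi the distance
   to the boundary of H. For the upper bound these bounds for H_x and H_y are
   multiplied: the bound for H_y is made affine in x, and the exponent of the
   other one is enlarged by a term that blows up at the starting time and pays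
   for the interaction of the two gradients.

   For the lower bound, p times 1 - exp (- phi) with phi comparable to
   depth(x) depth(y) / t is a subsolution on a ball moving at constant speed.
   A single such ball joins x and y when both are close to the boundary on the
   scale kappa ~ sqrt t. In general one uses three: from y to a point m1 of the
   segment [y, x], to a point m2, and to x, where D contains the balls of radius
   kappa around m1 and m2. If m1 is at fraction lambda of the way, the first leg
   costs 1 /\ delta(y) kappa / (lambda t), and the condition R_D > 0 provides m1
   with kappa / lambda at least of the order of the distance from the projection
   of x to the boundary of H_y. The two end legs thus give the product of the
   half-space factors. *)
Require Import Defs.
From mathcomp Require Import all_boot all_order all_algebra.
From mathcomp Require Import all_classical all_reals all_analysis measurable_realfun.
From mathcomp Require Import ring lra.
Import Order.TTheory GRing.Theory Num.Theory.
Import numFieldNormedType.Exports.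
Local Open Scope ring_scope.
Local Open Scope classical_set_scope.
Set Implicit Arguments.
Unset Strict Implicit.
Unset Printing Implicit Defensive.

(** * Euclidean geometry *)

(** Three obstacles shape the proof. A fundamental solution takes its initial value only weakly,
    whereas comparison from time 0 needs pointwise control of [p - p_D] near the pole;
    [initial_trace] provides it by dominating the difference by a finite sum of kernels. The upper
    bound starts its comparison at a positive time, where the blow-up does the work.

    In the lower bound speed must cost nothing, since x and y may be far apart compared with sqrt t.
    After division by the kernel the equation becomes that of a Brownian bridge, and in its drift
    the velocity of the ball cancels, so no constant depends on it.

    The condition on R_D concerns chords between boundary points, here the projections w and z of y
    and x, while the path runs from y to x. A ball of radius h at fraction s of the chord yields a
    ball of radius kappa at fraction lambda = 2 s kappa / h of the segment, so kappa / lambda = h /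
    (2 s). Since h is at least R_D / 2 times s times the depth of z in H_y, the factor s cancels:
    this is why the ratio of distances is the right quantity. *)

Ltac lrac := clear; intros; lra.
Ltac vring := apply/rowP => ?; rewrite !mxE; ring.

Lemma cvg_bigsum (R : realType) (T I : Type) (F : set_system T) {FF : Filter F}
    (s : seq I) (f : I -> T -> R) (l : I -> R) :
  (forall i, f i x @[x --> F] --> l i) ->
  \sum_(i <- s) f i x @[x --> F] --> \sum_(i <- s) l i.
Proof.
move=> fl; elim: s => [|i s IH].
  by rewrite big_nil; under eq_fun do rewrite big_nil; exact: cvg_cst.
by rewrite big_cons; under eq_fun do rewrite big_cons; apply: cvgD.
Qed.

Section Euclid.
Context {R : realType} {n : nat}.
Implicit Types (x y z a : 'rV[R]_n).

Lemma dotC x y : dot x y = dot y x.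
Proof. by apply: eq_bigr => i _; rewrite mulrC. Qed.

Lemma dotDl x y z : dot (x + y) z = dot x z + dot y z.
Proof. by rewrite -big_split; apply: eq_bigr => i _ /=; rewrite mxE mulrDl. Qed.

Lemma dotZl (k : R) x y : dot (k *: x) y = k * dot x y.
Proof. by rewrite big_distrr; apply: eq_bigr => i _ /=; rewrite mxE mulrA. Qed.

Lemma dotNl x y : dot (- x) y = - dot x y.
Proof. by rewrite -scaleN1r dotZl mulN1r. Qed.

Lemma dotBl x y z : dot (x - y) z = dot x z - dot y z.
Proof. by rewrite dotDl dotNl. Qed.

Lemma dotDr x y z : dot z (x + y) = dot z x + dot z y.
Proof. by rewrite dotC dotDl !(dotC _ z). Qed.

Lemma dotZr (k : R) x y : dot y (k *: x) = k * dot y x.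
Proof. by rewrite dotC dotZl dotC. Qed.

Lemma dotNr x y : dot y (- x) = - dot y x.
Proof. by rewrite dotC dotNl dotC. Qed.

Lemma dotBr x y z : dot z (x - y) = dot z x - dot z y.
Proof. by rewrite dotDr dotNr. Qed.

Lemma dotBB x y : dot (x - y) (x - y) = dot x x - 2 * dot x y + dot y y.
Proof. by rewrite dotBr !dotBl (dotC y x); ring. Qed.

Definition dotE := (dotDl, dotDr, dotNl, dotNr, dotZl, dotZr).

Lemma dotxx_ge0 x : 0 <= dot x x.
Proof. by apply: sumr_ge0 => i _; rewrite -expr2 sqr_ge0. Qed.

Lemma dotxx_eq0 x : dot x x = 0 -> x = 0.
Proof.
move=> /eqP; rewrite psumr_eq0; last by move=> i _; rewrite -expr2 sqr_ge0.
move=> /allP x0; apply/rowP => i; rewrite mxE; apply/eqP.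
by have := x0 i; rewrite mem_index_enum -expr2 sqrf_eq0 => /(_ isT).
Qed.

Lemma dotxx_gt0 x : x <> 0 -> 0 < dot x x.
Proof.
move=> x0; rewrite lt_neqAle dotxx_ge0 andbT eq_sym.
by apply/negP => /eqP /dotxx_eq0.
Qed.

Lemma enorm_ge0 x : 0 <= enorm x. Proof. exact: sqrtr_ge0. Qed.

Lemma enorm_sqr x : enorm x ^+ 2 = dot x x.
Proof. by rewrite sqr_sqrtr// dotxx_ge0. Qed.

Lemma enorm0 : enorm (0 : 'rV[R]_n) = 0.
Proof. by rewrite /enorm -(scale0r 0) dotZl mul0r sqrtr0. Qed.

Lemma enorm_gt0 x : x <> 0 -> 0 < enorm x.
Proof. by move=> x0; rewrite sqrtr_gt0 dotxx_gt0. Qed.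

Lemma enormZ (k : R) x : enorm (k *: x) = `|k| * enorm x.
Proof.
by rewrite /enorm dotZl dotZr mulrA -expr2 sqrtrM ?sqr_ge0// sqrtr_sqr.
Qed.

Lemma enormN x : enorm (- x) = enorm x.
Proof. by rewrite -scaleN1r enormZ normrN1 mul1r. Qed.

Lemma enormBC x y : enorm (x - y) = enorm (y - x).
Proof. by rewrite -enormN opprB. Qed.

Lemma le_enorm (x : 'rV[R]_n) (r : R) : 0 <= r ->
  (enorm x <= r) = (dot x x <= r ^+ 2).
Proof. by move=> r0; rewrite -enorm_sqr ler_sqr ?nnegrE ?enorm_ge0. Qed.

Lemma lt_enorm (x : 'rV[R]_n) (r : R) : 0 <= r ->
  (enorm x < r) = (dot x x < r ^+ 2).
Proof. by move=> r0; rewrite -enorm_sqr ltr_sqr ?nnegrE ?enorm_ge0. Qed.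

Lemma dot_le_enorm x y : dot x y <= enorm x * enorm y.
Proof.
have [->|/eqP y0] := eqVneq y 0.
  by rewrite -(scale0r (0 : 'rV[R]_n)) dotZr mul0r mulr_ge0// enorm_ge0.
have py : 0 < dot y y by exact: dotxx_gt0.
have [xy0|xy0] := leP (dot x y) 0.
  by rewrite (le_trans xy0)// mulr_ge0// enorm_ge0.
rewrite -ler_sqr ?nnegrE ?mulr_ge0 ?enorm_ge0 ?(ltW xy0)// exprMn !enorm_sqr.
have := dotxx_ge0 (dot y y *: x - dot x y *: y).
rewrite !dotE (dotC y x) => h.
have : 0 <= dot y y * (dot x x * dot y y - dot x y ^+ 2).
  by apply: le_trans h _; rewrite le_eqVlt; apply/orP; left; apply/eqP; ring.
by rewrite pmulr_rge0// subr_ge0.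
Qed.

Lemma enormD x y : enorm (x + y) <= enorm x + enorm y.
Proof.
rewrite le_enorm ?addr_ge0 ?enorm_ge0// !dotE (dotC y x) sqrrD !enorm_sqr.
by have := dot_le_enorm x y; lra.
Qed.

Lemma enorm_triangle z x y : enorm (x - y) <= enorm (x - z) + enorm (z - y).
Proof. by rewrite -(subrKA z); exact: enormD. Qed.

Lemma enorm_dist x y : `|enorm x - enorm y| <= enorm (x - y).
Proof.
have h1 := enormD (x - y) y; have h2 := enormD (y - x) x.
rewrite !subrK (enormBC y) in h1 h2.
by rewrite ler_norml; apply/andP; split; lra.
Qed.

Lemma ler_coord_enorm x i : `|x 0 i| <= enorm x.
Proof.
rewrite -ler_sqr ?nnegrE ?normr_ge0 ?enorm_ge0// enorm_sqr real_normK ?num_real// /dot.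
rewrite (bigD1 i)//= -expr2 lerDl; apply: sumr_ge0 => j _.
by rewrite -expr2 sqr_ge0.
Qed.

Lemma norm_le_enorm x : `|x| <= enorm x.
Proof.
rewrite [leLHS]mx_normrE; apply/bigmax_leP; split; first exact: enorm_ge0.
by case=> i j _ /=; rewrite ord1; exact: ler_coord_enorm.
Qed.

Lemma enorm_le_norm x : enorm x <= n%:R * `|x|.
Proof.
have h i : `|x 0 i| <= `|x|.
  by rewrite [leRHS]mx_normrE; apply: (le_trans _ (le_bigmax _ _ (0, i))).
rewrite le_enorm ?mulr_ge0//.
apply: (@le_trans _ _ (\sum_(i < n) `|x| ^+ 2)).
  by apply: ler_sum => i _; rewrite -expr2 -real_normK ?num_real// ler_sqr ?nnegrE// h.
rewrite sumr_const card_ord -[leLHS]mulr_natl exprMn; apply: ler_wpM2r; first exact: sqr_ge0.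
by rewrite -natrX ler_nat -mulnn; case: (n) => // m; rewrite leq_pmulr.
Qed.

Lemma continuous_dot a : continuous (dot a).
Proof.
move=> x; apply: (@cvg_bigsum _ _ _ _ (nbhs_filter x)) => i.
by apply: cvgM; [exact: cvg_cst|exact: coord_continuous].
Qed.

Lemma continuous_enorm : continuous (@enorm R n).
Proof.
move=> x; apply/(@cvgrPdist_lt _ _ _ _ (nbhs_filter x)) => e e0.
have n1 : 0 < n%:R + 1 :> R by rewrite ltr_wpDl.
have xe : \forall y \near x, `|x - y| < e / (n%:R + 1).
  by apply/nbhs_normP; exists (e / (n%:R + 1)) => //=; rewrite divr_gt0.
apply: filterS xe => y xe.
rewrite (le_lt_trans (enorm_dist _ _))// (le_lt_trans (enorm_le_norm _))//.
rewrite (@le_lt_trans _ _ ((n%:R + 1) * `|x - y|))// ?ler_wpM2r ?lerDl//.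
by rewrite mulrC -ltr_pdivlMr.
Qed.

(** The topology of ['rV[R]_n] comes from the sup norm; the equivalence of the two norms allows
    Euclidean balls to be used instead. *)
Lemma nbhs_eballP x (A : set 'rV[R]_n) :
  nbhs x A <-> exists2 e, 0 < e & eball x e `<=` A.
Proof.
split.
  move=> /nbhs_ballP[e e0 eA]; exists e => // y xy; apply: eA.
  rewrite -ball_normE /= distrC (le_lt_trans _ xy)//.
  exact: norm_le_enorm.
move=> [e e0 eA]; apply: filterS eA _.
have : \forall y \near x, enorm (y - x) < e.
  have cx : (enorm (y - x)) @[y --> x] --> enorm (x - x).
    apply: (@continuous_comp _ _ _ (fun y => y - x) (@enorm R n) x).
      by apply: (@cvgB _ _ _ _ (nbhs_filter x)); [exact: cvg_id|exact: cvg_cst].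
    exact: continuous_enorm.
  have := cvgr_lt _ cx; apply.
  by rewrite subrr enorm0.
exact.
Qed.

Lemma nbhs_eball x (e : R) : 0 < e -> nbhs x (eball x e).
Proof. by move=> e0; apply/nbhs_eballP; exists e. Qed.

Lemma open_eball x (e : R) : open (eball x e).
Proof.
rewrite openE => y xy; apply/nbhs_eballP; exists (e - enorm (y - x)).
  by rewrite subr_gt0.
move=> z yz; rewrite /eball /= in yz xy *.
by have := enorm_triangle y z x; lra.
Qed.

End Euclid.

(** * Distance to the boundary and convexity *)

Section Distance.
Context {R : realType} {n : nat}.
Implicit Types (D : set 'rV[R]_n) (x y z w a : 'rV[R]_n).

Lemma boundary_openE D z : open D -> boundary D z <-> closure D z /\ ~ D z.
Proof. by move=> oD; rewrite /boundary (interior_id D).1. Qed.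

Lemma closure_eball D z (e : R) : 0 < e -> closure D z ->
  exists2 p, D p & enorm (p - z) < e.
Proof. by move=> e0 /(_ _ (nbhs_eball z e0)) [p [Dp pz]]; exists p. Qed.

Lemma eball_closure D z : (forall e : R, 0 < e -> exists2 p, D p & enorm (p - z) < e) ->
  closure D z.
Proof.
move=> h A /nbhs_eballP[e e0 eA]; have [p Dp pz] := h e e0.
by exists p; split => //; apply: eA.
Qed.

Lemma open_eballP D x : open D -> D x -> exists2 e : R, 0 < e & eball x e `<=` D.
Proof. by move=> oD Dx; apply/nbhs_eballP; exact: open_nbhs_nbhs. Qed.

Lemma eball_center x (e : R) : 0 < e -> eball x e x.
Proof. by move=> e0; rewrite /eball /= subrr enorm0. Qed.

Lemma eball_sub x y (d e : R) : enorm (x - y) <= e - d -> eball x d `<=` eball y e.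
Proof. by move=> h p; rewrite /eball /= => px; have := enorm_triangle x p y; lra. Qed.

Lemma eball_le x (d e : R) : d <= e -> eball x d `<=` eball x e.
Proof. by move=> de; apply: eball_sub; rewrite subrr enorm0 subr_ge0. Qed.

Lemma delta_lb D x z : boundary D z -> delta D x <= enorm (x - z).
Proof.
move=> bz; apply: ge_inf; last by exists z.
by exists 0 => _ [p _ <-]; exact: enorm_ge0.
Qed.

(** The infimum of an empty set of reals is 0 by convention, so a positive lower bound requires a
    boundary point. *)
Lemma le_delta D x (e : R) : boundary D !=set0 ->
  (forall z, boundary D z -> e <= enorm (x - z)) -> e <= delta D x.
Proof.
move=> [z bz] h; apply: lb_le_inf; first by exists (enorm (x - z)), z.
by move=> _ [p bp <-]; exact: h.
Qed.

Lemma delta_boundary D w : boundary D w -> delta D w <= 0.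
Proof. by move=> /(delta_lb w); rewrite subrr enorm0. Qed.

Lemma eball_delta D x : open D -> D x -> eball x (delta D x) `<=` D.
Proof.
move=> oD Dx p xp; apply: contrapT => Dp.
pose f (s : R) : 'rV[R]_n := x + s *: (p - x).
have cf : continuous f.
  by move=> s; apply: cvgD; [exact: cvg_cst|apply: cvgZr_tmp].
pose A := f @` `[0, 1].
have cA : connected A.
  apply: connected_continuous_connected; first exact: segment_connected.
  exact: continuous_subspaceT.
(* A boundary point on the segment would be at distance at least [delta D x] from [x], farther than
   [p]. So [D] is both open and closed relative to the segment [A], and connectedness puts [p] in
   [D]. *)
have AD : A `&` D = A `&` closure D.
  apply/seteqP; split => q [Aq Dq]; split => //; first exact: subset_closure.
  apply: contrapT => nDq.
  have /(delta_lb x) : boundary D q by apply/boundary_openE.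
  case: Aq => s; rewrite /= in_itv /= => /andP[s0 s1] <-.
  rewrite /f opprD addNKr enormN enormZ ger0_norm// leNgt => /negP; apply.
  by rewrite (le_lt_trans _ xp)// ler_piMl// enorm_ge0.
have /seteqP[_ /(_ p)] : A `&` D = A.
  apply: cA.
  - by exists x; split => //; exists 0; rewrite /= ?in_itv /= ?lexx ?ler01//; rewrite /f scale0r addr0.
  - by exists D.
  - by exists (closure D) => //; exact: closed_closure.
move=> /(_ _)[]; last by [].
by exists 1; rewrite /= ?in_itv /= ?lexx ?ler01//; rewrite /f scale1r addrC subrK.
Qed.

Definition convex D :=
  forall x y (s : R), D x -> D y -> 0 <= s <= 1 -> D ((1 - s) *: x + s *: y).

Lemma strictly_convexW D : open D -> strictly_convex D -> convex D.
Proof.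
move=> oD sD x y s Dx Dy /andP[s0 s1].
have [->|/eqP xy] := eqVneq x y; first by rewrite -scalerDl subrK scale1r.
move: s0 s1; rewrite le_eqVlt => /predU1P[<- _|s0].
  by rewrite subr0 scale1r scale0r addr0.
rewrite le_eqVlt => /predU1P[->|s1].
  by rewrite subrr scale0r scale1r add0r.
rewrite -(interior_id D).1//; apply: sD => //; try exact: subset_closure.
by rewrite s0.
Qed.

(** Concavity of the distance to the complement, in terms of balls: a point of the new ball is the
    combination of two points displaced from [x] and [y] along the same vector [q]. The hypotheses
    [D x] and [D y] cover radius 0, where the open ball is empty. *)
Lemma convex_eball D x y (d e s : R) : convex D -> D x -> D y ->
  0 <= d -> 0 <= e -> 0 <= s <= 1 ->
  eball x d `<=` D -> eball y e `<=` D ->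
  eball ((1 - s) *: x + s *: y) ((1 - s) * d + s * e) `<=` D.
Proof.
move=> cD Dx Dy d0 e0 s01 xD yD p; rewrite /eball /=.
set m : 'rV[R]_n := (1 - s) *: x + s *: y; set l := _ * d + _ => pm.
have l0 : 0 < l by rewrite (le_lt_trans _ pm)// enorm_ge0.
pose q := l^-1 *: (p - m).
have q1 : enorm q < 1.
  by rewrite /q enormZ gtr0_norm ?invr_gt0// mulrC ltr_pdivrMr// mul1r.
have aux u (k : R) : D u -> 0 <= k -> eball u k `<=` D -> D (u + k *: q).
  move=> Du; rewrite le_eqVlt => /predU1P[<- _|k0 uD].
    by rewrite scale0r addr0.
  apply: uD; rewrite /eball /= addrC addKr enormZ gtr0_norm//.
  by rewrite -[ltRHS]mulr1 ltr_pM2l.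
suff -> : p = (1 - s) *: (x + d *: q) + s *: (y + e *: q) by apply: cD; auto.
have -> : (1 - s) *: (x + d *: q) + s *: (y + e *: q) = m + l *: q.
  by rewrite /m /l; vring.
by rewrite /q scalerA mulfV ?gt_eqF// scale1r addrC subrK.
Qed.

End Distance.

(** * Half-spaces and tangency *)

Section Halfspace.
Context {R : realType} {n : nat}.
Implicit Types (D H : set 'rV[R]_n) (x y z w a b : 'rV[R]_n) (c r : R).

(** For a unit normal [a], [dot a x - c] is the signed distance to the hyperplane; [is_halfspaceP]
    brings every half-space to this form. *)
Definition halfspace a c : set 'rV[R]_n := [set x | c < dot a x].

Lemma dotaa a : enorm a = 1 -> dot a a = 1.
Proof. by move=> a1; rewrite -enorm_sqr a1 expr1n. Qed.

Lemma dot_le_unit a x : enorm a = 1 -> dot a x <= enorm x.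
Proof. by move=> a1; have := dot_le_enorm a x; rewrite a1 mul1r. Qed.

Lemma open_halfspace a c : enorm a = 1 -> open (halfspace a c).
Proof.
move=> a1; rewrite openE => x; rewrite /halfspace /= => cx.
apply/nbhs_eballP; exists (dot a x - c); first by rewrite subr_gt0.
move=> y; rewrite /eball /= enormBC => yx; have := dot_le_unit (x - y) a1.
by rewrite dotBr; lra.
Qed.

Lemma closure_halfspace D a c z : enorm a = 1 -> D `<=` halfspace a c ->
  closure D z -> c <= dot a z.
Proof.
move=> a1 DH Dz; rewrite leNgt; apply/negP => zc.
have [|p /DH Dp pz] := @closure_eball _ _ D z (c - dot a z) _ Dz.
  by rewrite subr_gt0.
have := dot_le_unit (p - z) a1; rewrite dotBr; rewrite /halfspace /= in Dp.
by lra.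
Qed.

Lemma delta_halfspace a c x : enorm a = 1 -> c < dot a x ->
  delta (halfspace a c) x = dot a x - c.
Proof.
move=> a1 cx; have oH := open_halfspace (c := c) a1; set d := dot a x - c.
have d0 : 0 < d by rewrite subr_gt0.
have bw : boundary (halfspace a c) (x - d *: a).
  apply/boundary_openE => //; split.
    apply: eball_closure => e e0; exists (x - d *: a + (e / 2) *: a).
      rewrite /halfspace /= dotDr dotBr !dotZr dotaa// /d !mulr1.
      by rewrite subKr ltrDl divr_gt0.
    rewrite addrC addKr enormZ a1 mulr1 gtr0_norm ?divr_gt0//.
    by rewrite ltr_pdivrMr// ltr_pMr// ltr1n.
  by rewrite /halfspace /= dotBr dotZr dotaa// mulr1 /d subKr ltxx.
apply/eqP; rewrite eq_le; apply/andP; split.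
  have := delta_lb x bw; rewrite opprB addrC subrK enormZ a1 mulr1.
  by rewrite gtr0_norm.
apply: le_delta; first by exists (x - d *: a).
move=> z /boundary_openE -/(_ oH)[_ /negP]; rewrite -leNgt => zc.
by have := dot_le_unit (x - z) a1; rewrite dotBr /d; lra.
Qed.

Lemma is_halfspaceP H : is_halfspace H ->
  exists a c, enorm a = 1 /\ H = halfspace a c.
Proof.
move=> [a [c [a0 ->]]]; have na := enorm_gt0 a0.
exists ((enorm a)^-1 *: a), ((enorm a)^-1 * c); split.
  by rewrite enormZ gtr0_norm ?invr_gt0// mulVf// gt_eqF.
by apply/seteqP; split => x; rewrite /halfspace /= dotZl ltr_pM2l// invr_gt0.
Qed.

(** The foot of the perpendicular from [y] is a limit of points of the ball of radius [delta D y],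
    hence in the closure of [D]; it lies on the hyperplane, hence outside [D]. *)
Lemma boundary_proj D a c y : open D -> D y -> enorm a = 1 ->
  D `<=` halfspace a c -> delta D y = dot a y - c ->
  boundary D (y - delta D y *: a).
Proof.
move=> oD Dy a1 DH dy; have := DH _ Dy; rewrite /halfspace /= -subr_gt0 -dy => d0.
set d := delta D y in dy d0 *.
apply/boundary_openE => //; split; last first.
  by move/DH; rewrite /halfspace /= dotBr dotZr dotaa// mulr1 dy subKr ltxx.
apply: eball_closure => e e0; pose s := Num.min (e / 2) d.
have s0 : 0 < s by rewrite lt_min d0 divr_gt0.
have sd : s <= d by rewrite ge_min lexx orbT.
have se : s <= e / 2 by rewrite ge_min lexx.
exists (y - d *: a + s *: a).
  apply: (eball_delta oD Dy); rewrite -/d /eball /=.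
  have -> : y - d *: a + s *: a - y = (s - d) *: a.
    by vring.
  rewrite enormZ a1 mulr1 ler0_norm ?subr_le0//.
  by rewrite opprB ltrBlDr ltrDl.
by rewrite addrC addKr enormZ a1 mulr1 gtr0_norm//; lra.
Qed.

(** The centre of a ball inside the half-space has depth at least [r]; expanding [|b - w - r a|^2]
    with [|b - w| = r] then leaves at most 0. *)
Lemma interior_ball_normal a c w b r : enorm a = 1 -> dot a w = c ->
  0 < r -> eball b r `<=` halfspace a c -> enorm (w - b) = r -> b = w + r *: a.
Proof.
move=> a1 wc r0 bH wb.
have rb : r <= dot a b - c.
  (* If the depth of [b] were below [r], a value [s < r] above that depth would make [b - s *: a] a
     point of the ball outside the half-space. *)
  rewrite leNgt; apply/negP => h; pose s := Num.max 0 ((dot a b - c + r) / 2).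
  have : eball b r (b - s *: a).
    rewrite /eball /= addrC addKr enormN enormZ a1 mulr1 ger0_norm ?le_max ?lexx//.
    by rewrite gt_max r0 /=; lra.
  move/bH; rewrite /halfspace /= dotBr dotZr dotaa// mulr1 /s.
  by have : (dot a b - c + r) / 2 <= Num.max 0 ((dot a b - c + r) / 2);
    [rewrite le_max lexx orbT|lra].
apply/eqP; rewrite -subr_eq0 opprD addrA; apply/eqP/dotxx_eq0/eqP.
rewrite eq_le dotxx_ge0 andbT.
have e2 : dot (b - w) (b - w) = r ^+ 2 by rewrite -enorm_sqr enormBC wb.
have e1 : dot a (b - w) = dot a b - c by rewrite dotBr wc.
rewrite dotBl (dotBr _ _ (b - w)) (dotBr _ _ (r *: a)) e2 !dotZr !dotZl dotaa//.
by rewrite (dotC _ a) e1; nra.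
Qed.

(** Existence and uniqueness both come from the interior ball. A boundary point [z] lies outside it,
    so [2 r dot a (z - w) <= |z - w|^2], which is tangency. Any other candidate contains the ball
    and has [w] on its boundary, so [interior_ball_normal] forces the same normal. *)
Lemma tangent_halfspaceE D a c w r : open D -> enorm a = 1 -> boundary D w ->
  dot a w = c -> D `<=` halfspace a c ->
  0 < r -> eball (w + r *: a) r `<=` D ->
  tangent_halfspace D w = halfspace a c.
Proof.
move=> oD a1 bw wc DH r0 bD.
have tH : is_tangent_halfspace D w (halfspace a c).
  exists a; split => //; first by move=> a0; move: a1; rewrite a0 enorm0 => /esym/eqP; rewrite oner_eq0.
    by rewrite wc.
  apply/cvgrPdist_le => e e0; rewrite /within /=.
  apply/nbhs_eballP; exists (2 * r * e); first by rewrite !mulr_gt0.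
  move=> z; rewrite /eball /= => zw [bz /eqP zw0].
  have [Dz nDz] := (boundary_openE z oD).1 bz.
  have zc := closure_halfspace a1 DH Dz.
  have nz : 0 < enorm (z - w) by apply: enorm_gt0; apply/eqP; rewrite subr_eq0.
  have h : r ^+ 2 <= dot (z - w - r *: a) (z - w - r *: a).
    rewrite -enorm_sqr ler_sqr ?nnegrE ?(ltW r0) ?enorm_ge0// leNgt.
    apply/negP => h; apply: nDz; apply: bD; rewrite /eball /= opprD addrA//.
  have {}h : 2 * r * dot a (z - w) <= enorm (z - w) ^+ 2.
    move: h; rewrite dotBB !dotZr !dotZl (dotaa a1) (dotC _ a) enorm_sqr; lra.
  have q0 : 0 <= dot a (z - w) by rewrite dotBr wc subr_ge0.
  rewrite sub0r normrN ger0_norm ?divr_ge0 ?enorm_ge0//.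
  rewrite ler_pdivrMr// -(@ler_pM2l _ (2 * r)) ?mulr_gt0//.
  have : enorm (z - w) ^+ 2 <= (2 * r * e) * enorm (z - w).
    by rewrite expr2 ler_wpM2r ?enorm_ge0// ltW.
  by nra.
apply: xget_unique => // H' [a' [a'0 -> DH' _]].
have na := enorm_gt0 a'0; pose a'' := (enorm a')^-1 *: a'.
have a''1 : enorm a'' = 1.
  by rewrite enormZ gtr0_norm ?invr_gt0// mulVf// gt_eqF.
have HE : [set x | dot a' w < dot a' x] = halfspace a'' (dot a'' w).
  by apply/seteqP; split => x; rewrite /halfspace /= !dotZl ltr_pM2l// invr_gt0.
have /(interior_ball_normal a''1 erefl r0) : eball (w + r *: a) r `<=` halfspace a'' (dot a'' w).
  by rewrite -HE; apply: subset_trans DH'.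
rewrite opprD addNKr enormN enormZ a1 mulr1 gtr0_norm// => /(_ erefl).
move=> /addrI /(scalerI (lt0r_neq0 r0)) aE.
by rewrite HE -aE wc.
Qed.

End Halfspace.

(** * Maximum principle *)

Section RealDerivative.
Context {R : realType}.

Lemma is_derive_epsP (V : normedModType R) (f : V -> R) (x v : V) (l : R) :
  is_derive x v f l -> forall e : R, 0 < e -> exists2 d : R, 0 < d &
  forall h : R, h != 0 -> `|h| < d -> `|(f (h *: v + x) - f x) / h - l| < e.
Proof.
move=> [df dE] e e0; have : h^-1 *: ((f \o shift x) (h *: v) - f x) @[h --> 0^'] --> l.
  by rewrite -dE; exact: df.
move=> /cvgrPdist_lt /(_ e e0) /nbhs_ballP[d d0 dP]; exists d => // h h0 hd.
have := dP h; rewrite /ball /= sub0r normrN => /(_ hd h0).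
by rewrite distrC [_^-1 *: _]mulrC.
Qed.

Lemma is_derive_line (V : normedModType R) (f : V -> R) (x v : V) (s l : R) :
  is_derive (s *: v + x) v f l -> is_derive s 1 (fun u : R => f (u *: v + x)) l.
Proof.
move=> [df dE].
have E : (fun h : R => h^-1 *: ((f \o shift (s *: v + x)) (h *: v) - f (s *: v + x))) =
    (fun h => h^-1 *: (((fun u : R => f (u *: v + x)) \o shift s) (h *: (1 : R)) - f (s *: v + x))).
  apply/funext => h /=; congr (_ *: (f _ - _)).
  by rewrite scalerDl -addrA [h *: 1]mulr1.
by apply: DeriveDef; rewrite /derivable /derive -?E.
Qed.

Lemma derive_left_max (f : R -> R) (t l : R) : is_derive t 1 f l ->
  (exists2 d : R, 0 < d & forall s, t - d < s < t -> f s <= f t) -> 0 <= l.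
Proof.
move=> df [d d0 fd]; rewrite leNgt; apply/negP => l0.
have [|d' d'0 dP] := is_derive_epsP df (e := - l); first by rewrite oppr_gt0.
pose h := Num.min d d' / 2.
have h0 : 0 < h by rewrite divr_gt0// lt_min d0.
have hd : h < d by rewrite ltr_pdivrMr// (le_lt_trans (y := d)) ?ge_min ?lexx// ltr_pMr// ltr1n.
have hd' : h < d' by rewrite ltr_pdivrMr// (le_lt_trans (y := d')) ?ge_min ?lexx ?orbT// ltr_pMr// ltr1n.
have := dP (- h); rewrite oppr_eq0 gt_eqF// normrN gtr0_norm// => /(_ isT hd').
rewrite [_ *: _]mulr1 (addrC _ t) ltr_norml => /andP[_].
rewrite ltrBlDr addNr ltr_ndivrMr ?oppr_lt0// mul0r subr_gt0.
by apply/negP; rewrite -leNgt; apply: fd; apply/andP; split; lra.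
Qed.

Lemma derive_right_max (f : R -> R) (t l : R) : is_derive t 1 f l ->
  (exists2 d : R, 0 < d & forall s, t < s < t + d -> f s <= f t) -> l <= 0.
Proof.
move=> df [d d0 fd]; rewrite leNgt; apply/negP => l0.
have [d' d'0 dP] := is_derive_epsP df l0.
pose h := Num.min d d' / 2.
have h0 : 0 < h by rewrite divr_gt0// lt_min d0.
have hd : h < d by rewrite ltr_pdivrMr// (le_lt_trans (y := d)) ?ge_min ?lexx// ltr_pMr// ltr1n.
have hd' : h < d' by rewrite ltr_pdivrMr// (le_lt_trans (y := d')) ?ge_min ?lexx ?orbT// ltr_pMr// ltr1n.
have := dP h; rewrite gt_eqF// gtr0_norm// => /(_ isT hd').
rewrite [_ *: _]mulr1 (addrC _ t) ltr_norml => /andP[+ _].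
rewrite ltrBrDr addNr ltr_pdivlMr// mul0r subr_gt0.
by apply/negP; rewrite -leNgt; apply: fd; apply/andP; split; lra.
Qed.

(** If [l > 0], then [g 0 = 0] makes [g] positive just to the right of 0, and the mean value theorem
    lifts [f] above [f 0] there. *)
Lemma second_derivative_max (f g : R -> R) (l d : R) : 0 < d ->
  (forall s : R, `|s| < d -> is_derive s 1 f (g s)) ->
  is_derive (0 : R) 1 g l -> (forall s, `|s| < d -> f s <= f 0) -> l <= 0.
Proof.
move=> d0 df dg fm; rewrite leNgt; apply/negP => l0.
have f0 : is_derive (0 : R) 1 f (g 0) by apply: df; rewrite normr0.
have g0 : g 0 = 0.
  apply/eqP; rewrite eq_le; apply/andP; split.
    apply: (derive_right_max f0); exists d => // s /andP[s1 s2]; apply: fm.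
    by rewrite ger0_norm; lra.
  apply: (derive_left_max f0); exists d => // s /andP[s1 s2]; apply: fm.
  by rewrite ltr0_norm; lra.
have [d' d'0 dP] := is_derive_epsP dg l0.
pose h := Num.min d d' / 2.
have h0 : 0 < h by rewrite divr_gt0// lt_min d0.
have hd : h < d by rewrite ltr_pdivrMr// (le_lt_trans (y := d)) ?ge_min ?lexx// ltr_pMr// ltr1n.
have hd' : h < d' by rewrite ltr_pdivrMr// (le_lt_trans (y := d')) ?ge_min ?lexx ?orbT// ltr_pMr// ltr1n.
have gpos s : 0 < s < d' -> 0 < g s.
  move=> /andP[s0 sd]; have := dP s; rewrite gt_eqF// gtr0_norm// => /(_ isT sd).
  rewrite [_ *: _]mulr1 addr0 g0 subr0 ltr_norml => /andP[+ _].
  by rewrite ltrBrDr addNr ltr_pdivlMr// mul0r.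
have dfh (s : R) : 0 <= s <= h -> is_derive s 1 f (g s).
  by move=> /andP[s0 sh]; apply: df; rewrite ger0_norm//; lra.
have cf : {within `[0, h], continuous f}.
  apply: derivable_within_continuous => s; rewrite in_itv /= => sh.
  by case: (dfh s sh).
have [|c] := MVT h0 _ cf (df := g).
  by move=> s; rewrite in_itv /= => /andP[/ltW s0 /ltW sh]; apply: dfh; rewrite s0.
rewrite in_itv /= subr0 => /andP[c0 ch] E.
have : f h <= f 0 by apply: fm; rewrite gtr0_norm.
by rewrite -subr_le0 E; apply/negP; rewrite -ltNge mulr_gt0// gpos// c0 (lt_trans ch).
Qed.

End RealDerivative.

Section Jet.
Context {R : realType} {n : nat}.
Implicit Types (x z : 'rV[R]_n) (t s : R) (f u w : R -> 'rV[R]_n -> R).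

Definition ei (i : 'I_n) : 'rV[R]_n := delta_mx 0 i.

(** The gradient [g] is prescribed near [x] because it is differentiated again; of the Hessian only
    the diagonal [h] is recorded, since the Laplacian is its sum. *)
Definition jet f t x (ft : R) (g : 'I_n -> 'rV[R]_n -> R) (h : 'I_n -> R) :=
  [/\ is_derive t 1 (fun s => f s x) ft,
      forall i, \forall z \near x, is_derive z (ei i) (f t) (g i z) &
      forall i, is_derive x (ei i) (g i) (h i)].

Lemma jet_max w t x ft g h (d : R) : jet w t x ft g h -> 0 < d ->
  (forall y, enorm (y - x) < d -> w t y <= w t x) -> \sum_i h i <= 0.
Proof.
move=> [_ wg gh] d0 wm; apply: sumr_le0 => i _.
have /nbhs_eballP[d' d'0 dP] := wg i.
have ne : enorm (ei i) = 1.
  rewrite /enorm /dot (bigD1 i)//= big1 ?addr0; last first.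
    by move=> j ji; rewrite !mxE eqxx (negbTE ji) /= mulr0.
  by rewrite !mxE !eqxx /= mulr1 sqrtr1.
pose f1 (s : R) := w t (s *: ei i + x); pose g1 (s : R) := g i (s *: ei i + x).
have ns s : enorm (s *: ei i + x - x) = `|s| by rewrite addrK enormZ ne mulr1.
apply: (@second_derivative_max R f1 g1 _ (Num.min d d')).
- by rewrite lt_min d0.
- move=> s; rewrite lt_min => /andP[_ sd]; apply: is_derive_line.
  by apply: dP; rewrite /eball /= ns.
- by apply: is_derive_line; rewrite scale0r add0r; exact: gh.
- move=> s; rewrite lt_min => /andP[sd _]; rewrite /f1 scale0r add0r.
  by apply: wm; rewrite ns.
Qed.

Lemma nbhs_pairP (A : set (R * 'rV[R]_n)) t x :
  nbhs (t, x) A <-> exists2 e, 0 < e &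
    forall s y, `|s - t| < e -> enorm (y - x) < e -> A (s, y).
Proof.
split.
  move=> [[B C]] /= [/nbhs_ballP[b b0 bB] /nbhs_eballP[c c0 cC]] BCA.
  exists (Num.min b c); first by rewrite lt_min b0.
  move=> s y; rewrite !lt_min => /andP[sb _] /andP[_ yc]; apply: BCA; split => /=.
    by apply: bB; rewrite /ball /= distrC.
  exact: cC.
move=> [e e0 eA]; exists (ball t e, eball x e); rewrite /=.
  by split; [exact: nbhsx_ballx|exact: nbhs_eball].
by move=> [s y] /= [ts xy]; apply: eA => //; move: ts; rewrite /ball /= distrC.
Qed.

Lemma closed_box (a b N : R) :
  closed [set q : R * 'rV[R]_n | a <= q.1 <= b /\ enorm q.2 <= N].
Proof.
apply: closedI.
  apply: (@closed_comp _ _ (fun q : R * 'rV[R]_n => q.1) [set t : R | a <= t <= b]) => [q _|].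
    exact: cvg_fst.
  have -> : [set t : R | a <= t <= b] = `[a, b]%classic.
    by apply/seteqP; split => t /=; rewrite in_itv.
  exact: itv_closed.
apply: (@closed_comp _ _ (fun q : R * 'rV[R]_n => enorm q.2) [set t : R | t <= N]) => [q _|].
  apply: (@continuous_comp _ _ _ snd (@enorm R n)); first exact: cvg_snd.
  exact: continuous_enorm.
exact: closed_le.
Qed.

Lemma compact_box (a b N : R) :
  compact [set q : R * 'rV[R]_n | a <= q.1 <= b /\ enorm q.2 <= N].
Proof.
have cl := @closed_box a b N.
apply: (subclosed_compact cl (compact_setX (@segment_compact R a b)
    (rV_compact (fun=> @segment_compact R (- N) N)))) => -[t x] /= [tab xN].
split; first by rewrite /= in_itv.
move=> i /=; rewrite in_itv /= -ler_norml.
by rewrite (le_trans (ler_coord_enorm _ _)).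
Qed.

(** The space-time domain may move, for the sliding balls. The differential inequality is asked only
    where [w > 0], so that a barrier can be used on the region where it is one. Boundary and initial
    values enter as upper limits because kernels are singular at time 0 and the upper barrier blows
    up at its starting time. *)
Theorem max_principle (Om : set (R * 'rV[R]_n)) w s t1 :
  open Om ->
  (forall t x, s < t <= t1 -> Om (t, x) ->
    {for (t, x), continuous (fun q : R * 'rV[R]_n => w q.1 q.2)}) ->
  (forall t x, s < t <= t1 -> Om (t, x) -> 0 < w t x ->
    exists ft g h, jet w t x ft g h /\ ft <= \sum_i h i) ->
  (forall t x e, 0 < e -> s <= t <= t1 -> ~ (s < t /\ Om (t, x)) ->
    \forall q \near (t, x), s < q.1 <= t1 -> Om q -> w q.1 q.2 <= e) ->
  (forall e, 0 < e -> exists N, forall t x, s < t <= t1 -> Om (t, x) ->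
    N < enorm x -> w t x <= e) ->
  forall t x, s < t <= t1 -> Om (t, x) -> w t x <= 0.
Proof.
move=> oO cw hw bw iw t0 x0 st0 Ox0; rewrite leNgt; apply/negP => M0.
(* The factor [expR (- t)] makes the inequality at the maximum strict. *)
pose v (q : R * 'rV[R]_n) := expR (- q.1) * w q.1 q.2.
have v0 : 0 < v (t0, x0) by rewrite mulr_gt0// expR_gt0.
pose dom := [set q : R * 'rV[R]_n | s < q.1 <= t1 /\ Om q].
(* Where [w <= e], the function [v] is at most [expR (- s) * e], half of [v (t0, x0)]: such points
   cannot compete for the maximum. *)
pose e := expR s * v (t0, x0) / 2.
have e0 : 0 < e by rewrite divr_gt0// mulr_gt0// expR_gt0.
have small q : dom q -> w q.1 q.2 <= e -> v q < v (t0, x0).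
  move=> [/andP[sq _] _] we; rewrite /v -(@ltr_pM2l _ (expR q.1)) ?expR_gt0//.
  rewrite mulrA -expRD subrr expR0 mul1r (le_lt_trans we)// /e mulrAC.
  rewrite ltr_pM2r// (@lt_le_trans _ _ (expR s)) ?ler_expR ?(ltW sq)//.
  by rewrite ltr_pdivrMr// ltr_pMr ?expR_gt0// ltr1n.
have [N NP] := iw _ e0.
pose K := [set q | dom q /\ v (t0, x0) <= v q].
have cv q : dom q -> {for q, continuous v}.
  case: q => t x [st Ox]; apply: continuousM; last exact: cw.
  apply: continuous_comp; last exact: continuous_expR.
  by apply: continuousN; exact: cvg_fst.
have Kbox : K `<=` [set q | s <= q.1 <= t1 /\ enorm q.2 <= N].
  move=> [t x] [[/= /andP[st tt] Ox] vK]; rewrite (ltW st) tt; split => //.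
  rewrite leNgt; apply/negP => Nx; move: vK; apply/negP; rewrite -ltNge.
  by apply: small => //=; [split => //=; rewrite st tt|apply: NP; rewrite ?st ?tt].
(* The upper limits keep [K] away from the parabolic boundary and the box keeps it bounded; so [K]
   is compact and the maximum is attained. *)
have clK : closed K.
  move=> [t x] clq.
  have [st xN] : s <= t <= t1 /\ enorm x <= N.
    by apply: (@closed_box s t1 N (t, x)); apply: closure_subset clq.
  have [dq|ndq] := pselect (s < t /\ Om (t, x)); last first.
    have [q [[dq vq] wq]] := clq _ (bw t x e e0 st ndq).
    by move: vq; rewrite leNgt small//; apply: wq; case: dq.
  have Dq : dom (t, x) by split; [case: dq => /= -> _; case/andP: st|case: dq].
  split => //; rewrite leNgt; apply/negP => vlt.
  have /cvgr_lt /(_ _ vlt) near_lt := cv _ Dq.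
  have [q [[_ vq] /=]] := clq _ near_lt.
  by rewrite ltNge vq.
have cK := subclosed_compact clK (@compact_box s t1 N) Kbox.
have K0 : K (t0, x0) by split => //; split.
have [|q /set_mem[dq vq] qmax] := @compact_EVT_max _ _ v K (ex_intro _ _ K0) cK.
  by apply/continuous_in_subspaceT => q /set_mem[dq _]; exact: cv.
have gmax p : dom p -> v p <= v q.
  move=> dp; have [vp|vp] := leP (v (t0, x0)) (v p).
    by apply: qmax; rewrite inE.
  by rewrite (le_trans (ltW vp)).
case: q dq vq qmax gmax => t x dq vq qmax gmax; have [/= st Ox] := dq.
have wpos : 0 < w t x.
  by rewrite -(@pmulr_rgt0 _ (expR (- t))) ?expR_gt0// (lt_le_trans v0).
have [ft [g [h [jw le_ft]]]] := hw t x st Ox wpos.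
have [r r0 rO] : exists2 r, 0 < r &
    forall t' y, `|t' - t| < r -> enorm (y - x) < r -> Om (t', y).
  by apply/nbhs_pairP; exact: open_nbhs_nbhs.
have h0 : \sum_i h i <= 0.
  apply: (jet_max jw r0) => y yx.
  have := gmax (t, y) _; rewrite /v /= ler_pM2l ?expR_gt0//; apply.
  by split => //=; apply: rO => //; rewrite subrr normr0.
(* Only earlier times are compared, as [t] may equal [t1]. The resulting [w t x <= ft] contradicts
   [ft <= \sum_i h i <= 0 < w t x]. *)
have : 0 <= expR (- t) * (ft - w t x).
  have [jt _ _] := jw.
  apply: (@derive_left_max R (fun t => expR (- t) * w t x) t).
    apply: is_derive_eq; rewrite /GRing.scale /=; ring.
  exists (Num.min r (t - s)); first by rewrite lt_min r0 subr_gt0; case/andP: st.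
  move=> t' /andP[t'1 t'2].
  have [h1 h2] : Num.min r (t - s) <= r /\ Num.min r (t - s) <= t - s.
    by rewrite !ge_min !lexx orbT.
  apply: (gmax (t', x)); split => /=; first by case/andP: st => ? ?; apply/andP; split; lra.
  by apply: rO; rewrite ?subrr ?enorm0// ltr0_norm; lra.
by rewrite pmulr_rge0 ?expR_gt0//; lra.
Qed.

End Jet.

(** * Heat kernel calculus *)

Lemma near_gt0 (R : realType) (t : R) : 0 < t -> \forall s \near t, 0 < s.
Proof.
move=> t0; apply/nbhs_ballP; exists t => // s.
by rewrite /ball /= ltr_norml => /andP[_]; rewrite ltrBlDr ltrDl.
Qed.

Section JetAlgebra.
Context {R : realType} {n : nat}.
Implicit Types (x y z a b : 'rV[R]_n) (t s : R) (f u w : R -> 'rV[R]_n -> R).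

Lemma nearWx x (P : 'rV[R]_n -> Prop) : (forall z, P z) -> \forall z \near x, P z.
Proof. exact: (@nearW _ _ _ (nbhs_filter x)). Qed.

Lemma is_derive_lineP (V : normedModType R) (f : V -> R) (x v : V) (l : R) :
  is_derive (0 : R) 1 (fun s : R => f (s *: v + x)) l -> is_derive x v f l.
Proof.
move=> [df dE].
have E : (fun h : R => h^-1 *: ((f \o shift x) (h *: v) - f x)) =
    (fun h => h^-1 *: (((fun u : R => f (u *: v + x)) \o shift 0) (h *: (1 : R)) - f (0 *: v + x))).
  by apply/funext => h /=; rewrite addr0 [h *: 1]mulr1 scale0r add0r.
by apply: DeriveDef; rewrite /derivable /derive E.
Qed.

Lemma is_derive_comp1 (V : normedModType R) (F : R -> R) (f : V -> R) (p v : V) (k l : R) :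
  is_derive p v f k -> is_derive (f p) 1 F l ->
  is_derive p v (fun q => F (f q)) (l * k).
Proof.
move=> df dF; apply: is_derive_lineP.
apply: (@is_derive1_comp R F (fun s : R => f (s *: v + p))).
  by rewrite scale0r add0r.
by apply: is_derive_line; rewrite scale0r add0r.
Qed.

Lemma is_derive_dot x v a : is_derive x v (dot a) (dot a v).
Proof.
apply: is_derive_lineP.
have -> : (fun s : R => dot a (s *: v + x)) = (fun s : R => s * dot a v + dot a x).
  by apply/funext => s; rewrite dotDr dotZr.
by apply: is_derive_eq; rewrite /GRing.scale /=; ring.
Qed.

Lemma is_derive_dist2 x v b :
  is_derive x v (fun z => dot (z - b) (z - b)) (2 * dot (x - b) v).
Proof.
apply: is_derive_lineP.
have -> : (fun s : R => dot (s *: v + x - b) (s *: v + x - b)) =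
    (fun s : R => s * s * dot v v + s * (2 * dot (x - b) v) + dot (x - b) (x - b)).
  apply/funext => s; rewrite -addrA !(dotDl _ (x - b)) !(dotDr _ (x - b)) !dotZl !dotZr (dotC v); ring.
by apply: is_derive_eq; rewrite /GRing.scale /=; ring.
Qed.

Lemma dot_ei x i : dot x (ei i) = x 0 i.
Proof.
rewrite /dot (bigD1 i)//= big1 ?addr0; last first.
  by move=> j ji; rewrite !mxE (negbTE ji) andbF mulr0.
by rewrite !mxE !eqxx mulr1.
Qed.

Lemma is_derive_coord x i j :
  is_derive x (ei j : 'rV[R]_n) (fun z : 'rV[R]_n => z 0 i) ((i == j)%:R).
Proof.
have -> : (fun z : 'rV[R]_n => z 0 i) = dot (ei i).
  by apply/funext => z; rewrite dotC dot_ei.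
by apply: is_derive_eq; [exact: is_derive_dot|rewrite dot_ei mxE eqxx eq_sym].
Qed.

Lemma jetB f u t x ft gf hf ut gu hu : jet f t x ft gf hf -> jet u t x ut gu hu ->
  jet (fun t x => f t x - u t x) t x (ft - ut) (fun i z => gf i z - gu i z)
    (fun i => hf i - hu i).
Proof.
move=> [f1 f2 f3] [u1 u2 u3]; split.
- exact: is_deriveB.
- by move=> i; apply: filterS2 (f2 i) (u2 i) => z; exact: is_deriveB.
- by move=> i; exact: is_deriveB.
Qed.

Lemma jetM f u t x ft gf hf ut gu hu : jet f t x ft gf hf -> jet u t x ut gu hu ->
  jet (fun t x => f t x * u t x) t x (f t x * ut + u t x * ft)
    (fun i z => f t z * gu i z + u t z * gf i z)
    (fun i => f t x * hu i + 2 * gf i x * gu i x + u t x * hf i).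
Proof.
move=> [f1 f2 f3] [u1 u2 u3]; split.
- exact: is_deriveM.
- by move=> i; apply: filterS2 (f2 i) (u2 i) => z; exact: is_deriveM.
- move=> i; have f2x := nbhs_singleton (f2 i); have u2x := nbhs_singleton (u2 i).
  have d := is_deriveD (is_deriveM f2x (u3 i)) (is_deriveM u2x (f3 i)).
  by apply: (is_derive_eq d); rewrite /GRing.scale /=; ring.
Qed.

Lemma jet_cst (c t : R) x :
  jet (fun _ _ => c) t x 0 (fun _ _ => 0) (fun _ => 0).
Proof.
by split => *; [exact: is_derive_cst|apply: nearWx => z; exact: is_derive_cst|exact: is_derive_cst].
Qed.

Lemma jetZ (c : R) f t x ft g h : jet f t x ft g h ->
  jet (fun t x => c * f t x) t x (c * ft) (fun i z => c * g i z) (fun i => c * h i).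
Proof.
move=> jf; have := jetM (jet_cst c t x) jf.
move=> [j1 j2 j3]; split.
- by apply: (is_derive_eq j1); rewrite mulr0 addr0.
- by move=> i; apply: filterS (j2 i) => z jz; apply: (is_derive_eq jz); rewrite mulr0 addr0.
- move=> i; have := j3 i.
  under eq_fun do rewrite mulr0 addr0.
  by move=> jz; apply: (is_derive_eq jz); rewrite !mulr0 mul0r !addr0.
Qed.

Lemma jet_expR f t x ft g h : jet f t x ft g h ->
  jet (fun t x => expR (f t x)) t x (expR (f t x) * ft)
    (fun i z => expR (f t z) * g i z)
    (fun i => expR (f t x) * (h i + g i x ^+ 2)).
Proof.
move=> [f1 f2 f3]; split.
- exact: (is_derive_comp1 f1).
- by move=> i; apply: filterS (f2 i) => z dz; exact: (is_derive_comp1 dz).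
- move=> i; have d1 := is_derive_comp1 (nbhs_singleton (f2 i)) (is_derive_expR _).
  apply: (is_derive_eq (is_deriveM d1 (f3 i))).
  by rewrite /GRing.scale /=; ring.
Qed.

Lemma jet_shift f t x (t0 ft : R) g h : jet f (t - t0) x ft g h ->
  jet (fun s => f (s - t0)) t x ft g h.
Proof.
move=> [f1 f2 f3]; split => //.
have d : is_derive t 1 (fun s : R => s - t0) 1.
  by apply: is_derive_eq; rewrite subr0.
by have := @is_derive1_comp R (f^~ x) (fun s : R => s - t0) t _ _ f1 d; rewrite mulr1.
Qed.

End JetAlgebra.

Section HeatKernelCalculus.
Context {R : realType} {n : nat}.
Implicit Types (x y z a b : 'rV[R]_n) (t s : R).

(** Logarithm of the kernel at positive times: a kernel times an exponential becomes a single
    exponential, whose jet follows from [jet_expR]. *)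
Definition logp y t x : R := - (n%:R / 2) * ln (4 * pi * t) - dot (x - y) (x - y) / (4 * t).

Lemma heat_kernelE t x y : 0 < t -> heat_kernel t x y = expR (logp y t x).
Proof.
move=> t0; have h0 : 0 < 4 * pi * t :> R by rewrite !mulr_gt0// pi_gt0.
by rewrite /heat_kernel /powR gt_eqF// -expRD enorm_sqr.
Qed.

Lemma heat_kernel_ge0 t x y : 0 <= heat_kernel t x y.
Proof. by rewrite mulr_ge0 ?powR_ge0 ?expR_ge0. Qed.

Lemma is_derive_logp_t y t x : 0 < t ->
  is_derive t 1 (fun s => logp y s x)
   (- (n%:R / (2 * t)) + dot (x - y) (x - y) / (4 * t ^+ 2)).
Proof.
move=> t0; have h0 : 0 < 4 * pi * t :> R by rewrite !mulr_gt0// pi_gt0.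
have d1 : is_derive t 1 (fun s : R => 4 * pi * s) (4 * pi).
  by apply: is_derive_eq; rewrite /GRing.scale /=; ring.
have d2 := is_derive_comp1 d1 (is_derive1_ln h0).
have d3 : is_derive t 1 (fun s : R => (4 * s)^-1) (- (4 * t) ^- 2 *: 4).
  apply: is_deriveV; first by rewrite mulf_neq0// gt_eqF.
  by apply: is_derive_eq; rewrite /GRing.scale /=; ring.
have -> : (fun s => logp y s x) = (cst (- (n%:R / 2)) * (fun s => ln (4 * pi * s))
   - cst (dot (x - y) (x - y)) * (fun s : R => (4 * s)^-1)).
  by apply/funext => s; rewrite /logp.
apply: is_derive_eq; rewrite /GRing.scale /=.
have -> : (4 * pi * t)^-1 * (4 * pi) = t^-1 :> R.
  by rewrite invfM mulrAC mulVf ?mul1r// gt_eqF// mulr_gt0// pi_gt0.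
by field; rewrite gt_eqF.
Qed.

Lemma is_derive_logp_x y t x v :
  is_derive x v (logp y t) (- (dot (x - y) v / (2 * t))).
Proof.
have d := is_derive_dist2 x v y.
have -> : logp y t = (cst (- (n%:R / 2) * ln (4 * pi * t))
   - cst (4 * t)^-1 * (fun z => dot (z - y) (z - y))).
  by apply/funext => z; rewrite /logp [dot _ _ / _]mulrC.
have [->|t0] := eqVneq t 0.
  by apply: is_derive_eq; rewrite /GRing.scale /= !(mulr0, mul0r, invr0, subr0, oppr0, addr0).
by apply: is_derive_eq; rewrite /GRing.scale /=; field.
Qed.

Lemma jet_logp y t x : 0 < t ->
  jet (logp y) t x (- (n%:R / (2 * t)) + dot (x - y) (x - y) / (4 * t ^+ 2))
    (fun i z => - ((z - y) 0 i / (2 * t))) (fun i => - (2 * t)^-1).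
Proof.
move=> t0; split; first exact: is_derive_logp_t.
- move=> i; apply: nearWx => z; apply: (is_derive_eq (is_derive_logp_x y t z (ei i))).
  by rewrite dot_ei.
- move=> i.
  have -> : (fun z => - ((z - y) 0 i / (2 * t))) =
    cst (- (2 * t)^-1) * ((fun z : 'rV[R]_n => z 0 i) - cst (y 0 i)).
    by apply/funext => z; rewrite !mxE [_ / (2 * t)]mulrC -mulNr.
  have := is_derive_coord x i i; rewrite eqxx => d.
  apply: is_derive_eq; rewrite /GRing.scale /=; ring.
Qed.

Definition kder y t x i : R := - (heat_kernel t x y * ((x - y) 0 i / (2 * t))).

Definition kder2 y t x (i j : 'I_n) : R :=
  heat_kernel t x y * ((x - y) 0 i * (x - y) 0 j / (4 * t ^+ 2) - (i == j)%:R / (2 * t)).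

Lemma is_derive_kernel_t y t x : 0 < t ->
  is_derive t 1 (fun s => heat_kernel s x y) (\sum_i kder2 y t x i i).
Proof.
move=> t0; have [+ _ _] := jet_expR (jet_logp y x t0) => d.
apply: (near_eq_is_derive (f := fun s => expR (logp y s x))).
  by apply: filterS (near_gt0 t0) => s s0; rewrite heat_kernelE.
apply: (is_derive_eq d); rewrite -big_distrr /= heat_kernelE//; congr (_ * _).
rewrite sumrB addrC; congr (_ - _).
  by rewrite -mulr_suml.
under eq_bigr do rewrite eqxx.
by rewrite sumr_const card_ord -[RHS]mulr_natl mul1r.
Qed.

Lemma is_derive_kernel y t x i : 0 < t ->
  is_derive x (ei i) (fun z => heat_kernel t z y) (kder y t x i).
Proof.
move=> t0; have [_ + _] := jet_expR (jet_logp y x t0) => /(_ i) d.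
have -> : (fun z => heat_kernel t z y) = (fun z => expR (logp y t z)).
  by apply/funext => z; rewrite heat_kernelE.
apply: (is_derive_eq (nbhs_singleton d)).
by rewrite /kder heat_kernelE// mulrN.
Qed.

Lemma is_derive_kder y t x i j : 0 < t ->
  is_derive x (ei j) (kder y t ^~ i) (kder2 y t x i j).
Proof.
move=> t0; have dk := is_derive_kernel y x j t0; have dc := is_derive_coord x i j.
have -> : (kder y t ^~ i) = cst (- (2 * t)^-1) *
    ((fun z => heat_kernel t z y) * ((fun z : 'rV[R]_n => z 0 i) - cst (y 0 i))).
  apply/funext => z; rewrite /kder !fctE /= !mxE; ring.
apply: is_derive_eq; rewrite /GRing.scale /= /kder2 /kder !fctE /= !mxE.
by field; rewrite gt_eqF.
Qed.

Lemma jet_kernel y t x : 0 < t ->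
  jet (fun t x => heat_kernel t x y) t x (\sum_i kder2 y t x i i)
    (fun i z => kder y t z i) (fun i => kder2 y t x i i).
Proof.
move=> t0; split; first exact: is_derive_kernel_t.
  by move=> i; apply: nearWx => z; exact: is_derive_kernel.
by move=> i; exact: is_derive_kder.
Qed.

End HeatKernelCalculus.

(** * Classical solutions and the method of images *)

Section HeatSolutions.
Context {R : realType} {n : nat}.
Implicit Types (D : set 'rV[R]_n) (x y z a b : 'rV[R]_n) (t s c : R).
Implicit Types (u v : R -> 'rV[R]_n -> R).

Lemma continuous_dist2 y : continuous (fun z => dot (z - y) (z - y)).
Proof.
move=> x; under eq_fun do rewrite -enorm_sqr expr2.
have ce : (enorm (z - y)) @[z --> x] --> enorm (x - y).
  apply: (@continuous_comp _ _ _ (fun z => z - y) (@enorm R n) x).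
    by apply: (@cvgB _ _ _ _ (nbhs_filter x)); [exact: cvg_id|exact: cvg_cst].
  exact: continuous_enorm.
by apply: (@cvgM _ _ _ (nbhs_filter x)).
Qed.

Lemma eq_jointly_continuous u v t x :
  (\forall q \near (t, x), u q.1 q.2 = v q.1 q.2) ->
  jointly_continuous_at u t x -> jointly_continuous_at v t x.
Proof.
move=> uv cu; have /= E := nbhs_singleton uv.
have cv : v q.1 q.2 @[q --> (t, x)] --> u t x.
  by apply: cvg_trans cu; apply: near_eq_cvg; apply: filterS uv => q.
by rewrite E in cv.
Qed.

Lemma near_pos_open D t x : open D -> 0 < t -> D x ->
  \forall q \near (t, x), 0 < q.1 /\ D q.2.
Proof.
move=> oD t0 Dx; exists ([set s : R | 0 < s], D) => //=.
by split; [exact: near_gt0|exact: open_nbhs_nbhs].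
Qed.

(** The derivatives are explicit functions instead of the operators [Dt] and [Dx], so that they can
    be combined by algebra; [classical_heat_solution] converts. *)
Definition classical_solution D u (F0 : R -> 'rV[R]_n -> R)
    (F1 : 'I_n -> R -> 'rV[R]_n -> R) (F2 : 'I_n -> 'I_n -> R -> 'rV[R]_n -> R) :=
  forall t x, 0 < t -> D x ->
  [/\ jointly_continuous_at u t x,
      is_derive t 1 (u^~ x) (F0 t x) /\ jointly_continuous_at F0 t x,
      forall i, is_derive x (ei i) (u t) (F1 i t x) /\ jointly_continuous_at (F1 i) t x,
      forall i j, is_derive x (ei j) (F1 i t) (F2 i j t x) /\
        jointly_continuous_at (F2 i j) t x &
      F0 t x = \sum_(i < n) F2 i i t x].

Lemma classical_heat_solution D u F0 F1 F2 : open D ->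
  classical_solution D u F0 F1 F2 -> heat_solution D u.
Proof.
move=> oD cu.
have E1 i t x : 0 < t -> D x -> Dx i u t x = F1 i t x.
  by move=> t0 Dx; have [_ _ /(_ i)[[_ <-] _] _ _] := cu t x t0 Dx.
have N1 i t x : 0 < t -> D x -> \forall z \near x, F1 i t z = Dx i u t z.
  move=> t0 Dx; have /nbhs_eballP[e e0 eD] := open_nbhs_nbhs (conj oD Dx).
  by apply/nbhs_eballP; exists e => // z /eD Dz; rewrite E1.
have E2 i j t x : 0 < t -> D x -> is_derive x (ei j) (Dx i u t) (F2 i j t x).
  move=> t0 Dx; have [_ _ _ /(_ i j)[d _] _] := cu t x t0 Dx.
  exact: near_eq_is_derive (N1 i t x t0 Dx) d.
move=> t x t0 Dx; have [c0 [d1 c1] d2 d3 E] := cu t x t0 Dx.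
have nq := near_pos_open oD t0 Dx.
have EE : Dt u t x = F0 t x by case: d1.
have E22 i j : Defs.Dx j (Defs.Dx i u) t x = F2 i j t x by case: (E2 i j t x t0 Dx).
split => //.
- split; first by case: d1.
  apply: eq_jointly_continuous c1; apply: filterS nq => -[s z] /= [s0 Dz].
  by have [_ [[_ <-] _] _ _ _] := cu s z s0 Dz.
- move=> i; have [d2i c2i] := d2 i; split; first by case: d2i.
  apply: eq_jointly_continuous c2i; apply: filterS nq => -[s z] /= [s0 Dz].
  by rewrite E1.
- move=> i j; have [d3i c3i] := d3 i j; split; first by case: (E2 i j t x t0 Dx).
  apply: eq_jointly_continuous c3i; apply: filterS nq => -[s z] /= [s0 Dz].
  by case: (E2 i j s z s0 Dz).
by rewrite EE E; apply: eq_bigr => i _; rewrite E22.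
Qed.

Lemma classical_solutionB D u v F0 F1 F2 G0 G1 G2 :
  classical_solution D u F0 F1 F2 -> classical_solution D v G0 G1 G2 ->
  classical_solution D (fun t x => u t x - v t x) (fun t x => F0 t x - G0 t x)
    (fun i t x => F1 i t x - G1 i t x) (fun i j t x => F2 i j t x - G2 i j t x).
Proof.
move=> cu cv t x t0 Dx; have [c0 [d1 c1] d2 d3 E] := cu t x t0 Dx.
have [c0' [d1' c1'] d2' d3' E'] := cv t x t0 Dx.
split.
- exact: continuousB.
- by split; [exact: is_deriveB|exact: continuousB].
- move=> i; have [? ?] := d2 i; have [? ?] := d2' i.
  by split; [exact: is_deriveB|exact: continuousB].
- move=> i j; have [? ?] := d3 i j; have [? ?] := d3' i j.
  by split; [exact: is_deriveB|exact: continuousB].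
by rewrite E E' sumrB.
Qed.

Lemma jointly_continuous_dist2 y t x :
  jointly_continuous_at (fun _ z => dot (z - y) (z - y)) t x.
Proof.
apply: (@continuous_comp _ _ _ snd (fun z => dot (z - y) (z - y))).
  exact: cvg_snd.
exact: continuous_dist2.
Qed.

Lemma jointly_continuous_coord y i t x :
  jointly_continuous_at (fun _ z => (z - y) 0 i) t x.
Proof.
apply: (@continuous_comp _ _ _ snd (fun z : 'rV[R]_n => (z - y) 0 i)).
  exact: cvg_snd.
apply: (@continuous_comp _ _ _ (fun z => z - y) (fun z : 'rV[R]_n => z 0 i)).
  by apply: (@cvgB _ _ _ _ (nbhs_filter x)); [exact: cvg_id|exact: cvg_cst].
exact: coord_continuous.
Qed.

Lemma jointly_continuous_time (f : R -> R) t x : {for t, continuous f} ->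
  jointly_continuous_at (fun s _ => f s) t x.
Proof.
by move=> cf; apply: (@continuous_comp _ _ _ fst f); first exact: cvg_fst.
Qed.

Lemma jointly_continuous_kernel y t x : 0 < t ->
  jointly_continuous_at (fun t x => heat_kernel t x y) t x.
Proof.
move=> t0; have h0 : 0 < 4 * pi * t :> R by rewrite !mulr_gt0// pi_gt0.
apply: (@eq_jointly_continuous (fun t x => expR (logp y t x))).
  by apply: filterS (near_pos_open openT t0 (I : setT x)) => q [q0 _]; rewrite heat_kernelE.
apply: (@continuous_comp _ _ _ (fun q : R * 'rV[R]_n => logp y q.1 q.2) expR); last exact: continuous_expR.
apply: continuousB.
  apply: (@jointly_continuous_time (fun s => - (n%:R / 2) * ln (4 * pi * s))).
  apply: continuousM; first exact: cst_continuous.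
  apply: (@continuous_comp R R R (fun s : R => 4 * pi * s) (@ln R)); last exact: continuous_ln.
  by apply: continuousM; [exact: cst_continuous|exact: cvg_id].
apply: continuousM; first exact: jointly_continuous_dist2.
apply: (@jointly_continuous_time (fun s => (4 * s)^-1)).
apply: continuousV; first by rewrite mulf_neq0// gt_eqF.
by apply: continuousM; [exact: cst_continuous|exact: cvg_id].
Qed.

Lemma jointly_continuous_invM (k : R) (m : nat) t x : 0 < t -> 0 < k ->
  jointly_continuous_at (fun s _ => (k * s ^+ m)^-1) t x.
Proof.
move=> t0 k0; apply: (@jointly_continuous_time (fun s => (k * s ^+ m)^-1)).
apply: continuousV; first by rewrite gt_eqF// mulr_gt0// exprn_gt0.
apply: continuousM; [exact: cst_continuous|exact: exprn_continuous].
Qed.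

Lemma jointly_continuous_kder y i t x : 0 < t ->
  jointly_continuous_at (fun t x => kder y t x i) t x.
Proof.
move=> t0; apply: continuousN; apply: continuousM; first exact: jointly_continuous_kernel.
apply: continuousM; first exact: jointly_continuous_coord.
exact: (@jointly_continuous_invM 2 1).
Qed.

Lemma jointly_continuous_kder2 y i j t x : 0 < t ->
  jointly_continuous_at (fun t x => kder2 y t x i j) t x.
Proof.
move=> t0; apply: continuousM; first exact: jointly_continuous_kernel.
apply: continuousB.
  apply: continuousM; last exact: (@jointly_continuous_invM 4 2).
  by apply: continuousM; exact: jointly_continuous_coord.
apply: continuousM; first exact: cst_continuous.
exact: (@jointly_continuous_invM 2 1).
Qed.

Lemma classical_kernel D y :
  classical_solution D (fun t x => heat_kernel t x y)
    (fun t x => \sum_i kder2 y t x i i) (fun i t x => kder y t x i)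
    (fun i j t x => kder2 y t x i j).
Proof.
move=> t x t0 _; split => //.
- exact: jointly_continuous_kernel.
- split; first exact: is_derive_kernel_t.
  apply: cvg_bigsum => i; exact: jointly_continuous_kder2.
- by move=> i; split; [exact: is_derive_kernel|exact: jointly_continuous_kder].
- by move=> i j; split; [exact: is_derive_kder|exact: jointly_continuous_kder2].
Qed.

Lemma heat_solution_jet D u t x : open D -> heat_solution D u -> 0 < t -> D x ->
  exists ft g h, jet u t x ft g h /\ ft = \sum_i h i.
Proof.
move=> oD hu t0 Dx; have [_ [d1 _] _ d3 E] := hu t x t0 Dx.
exists (Dt u t x), (fun i => Defs.Dx i u t), (fun i => Defs.Dx i (Defs.Dx i u) t x).
split => //; split.
- exact/derivableP.
- move=> i; have /nbhs_eballP[e e0 eD] := open_nbhs_nbhs (conj oD Dx).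
  apply/nbhs_eballP; exists e => // z /eD Dz.
  by have [_ _ /(_ i)[d2 _] _ _] := hu t z t0 Dz; exact/derivableP.
- by move=> i; have [d3i _] := d3 i i; exact/derivableP.
Qed.

Definition reflection a c y := y - (2 * (dot a y - c)) *: a.

Definition halfspace_kernel a c t x y : R :=
  heat_kernel t x y - heat_kernel t x (reflection a c y).

Lemma dist2_reflection a c x y : enorm a = 1 ->
  dot (x - reflection a c y) (x - reflection a c y) =
  dot (x - y) (x - y) + 4 * (dot a x - c) * (dot a y - c).
Proof.
move=> a1; rewrite /reflection opprB addrA (addrAC x).
have : dot a (x - y) = dot a x - dot a y by rewrite dotBr.
move: (x - y) => u E.
by rewrite dotDl !dotDr !dotZr !dotZl (dotaa a1) (dotC u a) E; ring.
Qed.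

Lemma halfspace_kernelE a c t x y : enorm a = 1 -> 0 < t ->
  halfspace_kernel a c t x y =
  heat_kernel t x y * (1 - expR (- ((dot a x - c) * (dot a y - c) / t))).
Proof.
move=> a1 t0; rewrite /halfspace_kernel !heat_kernelE// mulrBr mulr1 -expRD.
congr (_ - expR _); rewrite /logp dist2_reflection//.
by field; rewrite gt_eqF.
Qed.

Lemma heat_solution_halfspace_kernel D a c y : open D ->
  heat_solution D (fun t x => halfspace_kernel a c t x y).
Proof.
move=> oD; apply: (classical_heat_solution oD).
by apply: classical_solutionB; exact: classical_kernel.
Qed.

Lemma heat_solution_kernel D y : open D -> heat_solution D (fun t x => heat_kernel t x y).
Proof. by move=> oD; apply: (classical_heat_solution oD); exact: classical_kernel. Qed.

End HeatSolutions.

(** * Gaussian-dominated integrals *)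

Section GaussianDecay.
Context {R : realType}.
Local Notation mu := (@lebesgue_measure R).

(** This class is stable under slices, linear combinations and products with bounded continuous
    functions, as an induction over the iterated integral requires. *)
Definition gauss_dominated {n} (F : 'rV[R]_n -> R) :=
  continuous F /\ exists C k : R, [/\ 0 <= C, 0 < k & forall x, `|F x| <= C * expR (- (k * dot x x))].

(** The normal law of variance [1 / (2 k)] has mass 1, which yields the one-dimensional Gaussian
    integral. *)
Lemma normal_pdf_gauss (k m x : R) : 0 < k ->
  normal_pdf m (Num.sqrt (2 * k)^-1) x = (Num.sqrt (pi / k))^-1 * expR (- (k * (x - m) ^+ 2)).
Proof.
move=> k0; have s0 : 0 < Num.sqrt (2 * k)^-1 by rewrite sqrtr_gt0 invr_gt0 mulr_gt0.
rewrite normal_pdfE ?gt_eqF//= /normal_peak /normal_fun sqr_sqrtr ?invr_ge0 ?mulr_ge0 ?ltW//.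
congr (_^-1 * expR _); last by field; rewrite gt_eqF.
by congr Num.sqrt; field; rewrite gt_eqF.
Qed.

Lemma gauss_integrable1 (k m : R) : 0 < k ->
  mu.-integrable [set: R] (fun x => (expR (- (k * (x - m) ^+ 2)))%:E).
Proof.
move=> k0; have p0 : 0 < Num.sqrt (pi / k) by rewrite sqrtr_gt0 divr_gt0// pi_gt0.
have := integrable_normal_pdf m (Num.sqrt (2 * k)^-1).
move=> /(integrableZl measurableT (Num.sqrt (pi / k))).
apply: eq_integrable => // x _.
by rewrite /= normal_pdf_gauss// -EFinM mulrA mulfV ?gt_eqF// mul1r.
Qed.

Lemma gauss_integral1 (k m : R) : 0 < k ->
  \int[mu]_(x in [set: R]) expR (- (k * (x - m) ^+ 2)) = Num.sqrt (pi / k).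
Proof.
move=> k0; have p0 : 0 < Num.sqrt (pi / k) by rewrite sqrtr_gt0 divr_gt0// pi_gt0.
have : fine (\int[mu]_x (normal_pdf m (Num.sqrt (2 * k)^-1) x)%:E) = 1.
  by rewrite integral_normal_pdf.
rewrite (_ : fine _ = \int[mu]_(x in [set: R])
   ((Num.sqrt (pi / k))^-1 * expR (- (k * (x - m) ^+ 2)))); last first.
  by apply: eq_Rintegral => x _; rewrite normal_pdf_gauss.
rewrite RintegralZl//; last exact: gauss_integrable1.
move=> h; apply: (mulfI (x := (Num.sqrt (pi / k))^-1)); first by rewrite invr_eq0 gt_eqF.
by rewrite h mulVf// gt_eqF.
Qed.

Lemma dominated_integrable1 (g : R -> R) (C k : R) : 0 < k -> continuous g ->
  (forall x, `|g x| <= C * expR (- (k * x ^+ 2))) ->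
  mu.-integrable [set: R] (EFin \o g).
Proof.
move=> k0 cg gC.
have gi : mu.-integrable [set: R] (fun x => (C * expR (- (k * (x - 0) ^+ 2)))%:E).
  have := integrableZl measurableT C (gauss_integrable1 0 k0).
  by apply: eq_integrable => // x _; rewrite EFinM.
apply: le_integrable gi => //.
  by apply/measurable_EFinP; exact: continuous_measurable_fun.
move=> x _ /=; rewrite lee_fin subr0.
by rewrite (le_trans (gC x))// ler_norm.
Qed.

Definition rw {n} (s : R) (v : 'rV[R]_n) : 'rV[R]_n.+1 := row_mx s%:M v.

Lemma rw_ord0 n s (v : 'rV[R]_n) : rw s v 0 ord0 = s.
Proof.
by rewrite /rw mxE; case: splitP => j /= e; [rewrite ord1 mxE eqxx|].
Qed.

Lemma rw_lift n s (v : 'rV[R]_n) i : rw s v 0 (lift ord0 i) = v 0 i.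
Proof.
rewrite /rw mxE; case: splitP => j /=; first by rewrite ord1.
by move=> /eqP; rewrite eqSS => /eqP/val_inj ->.
Qed.

Lemma dot_rw n s s' (v v' : 'rV[R]_n) : dot (rw s v) (rw s' v') = s * s' + dot v v'.
Proof.
rewrite /dot big_ord_recl !rw_ord0; congr (_ + _).
by apply: eq_bigr => i _; rewrite !rw_lift.
Qed.

Lemma rwB n s s' (v v' : 'rV[R]_n) : rw s v - rw s' v' = rw (s - s') (v - v').
Proof.
have E k : (rw s v - rw s' v') 0 k = rw s v 0 k - rw s' v' 0 k.
  by rewrite mxE; congr (_ + _); rewrite [LHS]mxE.
apply/rowP => j; rewrite E; case: (unliftP ord0 j) => [i|] ->.
  by rewrite !rw_lift [RHS]mxE; congr (_ + _); rewrite [RHS]mxE.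
by rewrite !rw_ord0.
Qed.

Lemma rwK n (x : 'rV[R]_n.+1) : x = rw (x 0 ord0) (\row_i x 0 (lift ord0 i)).
Proof.
apply/rowP => j; case: (unliftP ord0 j) => [i|] ->.
  by rewrite rw_lift mxE.
by rewrite rw_ord0.
Qed.

Lemma enorm_rw_le n s (v : 'rV[R]_n) : enorm (rw s v) <= `|s| + enorm v.
Proof.
rewrite le_enorm ?addr_ge0 ?enorm_ge0// dot_rw sqrrD real_normK ?num_real// enorm_sqr.
by rewrite -expr2 -addrA lerD2l lerDr mulrn_wge0// mulr_ge0// enorm_ge0.
Qed.

Lemma continuous_rw_swap n : continuous (fun q : 'rV[R]_n * R => rw q.2 q.1).
Proof.
move=> [v s] A /nbhs_eballP[e e0 eA]; have e2 : 0 < e / 2 by rewrite divr_gt0.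
exists (eball v (e / 2), ball s (e / 2)); rewrite /=.
  by split; [exact: nbhs_eball|exact: nbhsx_ballx].
move=> [v' s'] [/= vv ss]; apply: eA; rewrite /eball /= rwB.
rewrite (le_lt_trans (enorm_rw_le _ _))// [ltRHS]splitr ltrD//.
by move: ss; rewrite /ball /= distrC.
Qed.

Lemma continuous_rw2 n s : continuous (@rw n s).
Proof.
move=> v A /nbhs_eballP[e e0 eA]; apply/nbhs_eballP; exists e => // v' vv.
apply: eA; rewrite /eball /= rwB subrr (le_lt_trans (enorm_rw_le _ _))//.
by rewrite normr0 add0r.
Qed.

Lemma gauss_dominated_slice n (F : 'rV[R]_n.+1 -> R) s : gauss_dominated F ->
  gauss_dominated (fun v => F (rw s v)).
Proof.
move=> [cF [C [k [C0 k0 FC]]]]; split.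
  by move=> v; apply: (@continuous_comp _ _ _ (@rw n s) F); [exact: continuous_rw2|exact: cF].
exists C, k; split => // v; rewrite (le_trans (FC _))// ler_wpM2l// ler_expR.
by rewrite lerN2 ler_wpM2l ?(ltW k0)// dot_rw lerDr -expr2 sqr_ge0.
Qed.

Lemma gauss_dominated_lin n (F G : 'rV[R]_n -> R) (a b : R) : gauss_dominated F ->
  gauss_dominated G -> gauss_dominated (fun x => a * F x + b * G x).
Proof.
move=> [cF [C [k [C0 k0 FC]]]] [cG [C' [k' [C'0 k'0 GC]]]]; split.
  move=> x; apply: (@cvgD _ _ _ _ (nbhs_filter x)).
    by apply: (@cvgM _ _ _ (nbhs_filter x)); [exact: cvg_cst|exact: cF].
  by apply: (@cvgM _ _ _ (nbhs_filter x)); [exact: cvg_cst|exact: cG].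
exists (`|a| * C + `|b| * C'), (Num.min k k'); split.
- by rewrite addr_ge0// mulr_ge0.
- by rewrite lt_min k0.
move=> x; rewrite (le_trans (ler_normD _ _))// mulrDl !normrM -!mulrA.
have d0 := dotxx_ge0 x.
apply: lerD; apply: ler_wpM2l => //; [apply: (le_trans (FC x))|apply: (le_trans (GC x))];
  apply: ler_wpM2l => //; rewrite ler_expR lerN2 ler_wpM2r// ge_min lexx ?orbT//.
Qed.

Lemma gauss_dominated_gauss n (k : R) (y : 'rV[R]_n) : 0 < k ->
  gauss_dominated (fun x => expR (- (k * dot (x - y) (x - y)))).
Proof.
move=> k0; split.
  move=> x; apply: (@continuous_comp 'rV[R]_n R R (fun x => - (k * dot (x - y) (x - y))) (@expR R)); last exact: continuous_expR.
  apply: (@cvgN _ _ _ _ (nbhs_filter x)); apply: (@cvgM _ _ _ (nbhs_filter x)); first exact: cvg_cst.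
  exact: continuous_dist2.
exists (expR (k * dot y y)), (k / 2); split; rewrite ?expR_ge0 ?divr_gt0// => x.
rewrite ger0_norm ?expR_ge0// -expRD ler_expR dotBB.
have : 0 <= k * dot (x - 2 *: y) (x - 2 *: y) by rewrite mulr_ge0 ?dotxx_ge0// ltW.
by rewrite dotBB !dotZr !dotZl; lra.
Qed.

Lemma gauss_dominatedM n (F G : 'rV[R]_n -> R) (M : R) : gauss_dominated F ->
  continuous G -> (forall x, `|G x| <= M) -> gauss_dominated (fun x => F x * G x).
Proof.
move=> [cF [C [k [C0 k0 FC]]]] cG GM; split.
  by move=> x; apply: (@cvgM _ _ _ (nbhs_filter x)); [exact: cF|exact: cG].
have M0 : 0 <= M by rewrite (le_trans _ (GM 0)).
exists (M * C), k; split => //; first by rewrite mulr_ge0.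
by move=> x; rewrite normrM mulrC -mulrA ler_pM.
Qed.

Lemma compact_eball n (N : R) : compact [set v : 'rV[R]_n | enorm v <= N].
Proof.
have cl : closed [set v : 'rV[R]_n | enorm v <= N].
  apply: (@closed_comp _ _ (@enorm R n) [set t : R | t <= N]) => [q _|].
    exact: continuous_enorm.
  exact: closed_le.
apply: (subclosed_compact cl (rV_compact (fun=> @segment_compact R (- N) N))) => x xN i /=.
by rewrite in_itv /= -ler_norml (le_trans (ler_coord_enorm _ _)).
Qed.

(** Half of the Gaussian exponent is kept as an integrable weight, the other half makes both slices
    small for [|v| > N]; for [|v| <= N] compactness gives uniformity. It makes the inner integral
    continuous in [s]. *)
Lemma slice_uniform n (F : 'rV[R]_n.+1 -> R) (C k s0 e : R) : continuous F ->
  0 <= C -> 0 < k -> (forall x, `|F x| <= C * expR (- (k * dot x x))) -> 0 < e ->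
  \forall s \near s0, forall v, `|F (rw s v) - F (rw s0 v)| <= e * expR (- (k / 2 * dot v v)).
Proof.
move=> cF C0 k0 FC e0.
have [N N0 NP] : exists2 N : R, 0 <= N & 2 * C * expR (- (k / 2 * N ^+ 2)) <= e.
  pose M := 2 * C / e + 1; have M0 : 0 < M by rewrite ltr_wpDl// divr_ge0 ?mulr_ge0// (ltW e0).
  have q0 : 0 <= 2 / k * ln M.
    apply: mulr_ge0; first by rewrite divr_ge0// ltW.
    by apply: ln_ge0; rewrite lerDr divr_ge0 ?mulr_ge0// ltW.
  (* With this [N] the exponential equals [M^-1], and [2 * C <= e * M]. *)
  exists (Num.sqrt (2 / k * ln M)); first exact: sqrtr_ge0.
  rewrite sqr_sqrtr// mulrA [k / 2 * _](_ : _ = 1) ?mul1r; last by field; rewrite gt_eqF.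
  rewrite expRN lnK ?posrE// ler_pdivrMr// /M mulrDr mulr1 mulrCA mulfV ?gt_eqF// mulr1.
  by rewrite lerDl ltW.
pose e' := e * expR (- (k / 2 * N ^+ 2)).
have e'0 : 0 < e' by rewrite mulr_gt0// expR_gt0.
have /compact_near_coveringP cK := @compact_eball n N.
have := cK R (nbhs s0) (fun s v => `|F (rw s v) - F (rw s0 v)| < e') _.
move=> /(_ _)[].
  move=> v0 _.
  have cd : {for (v0, s0), continuous (fun q : 'rV[R]_n * R => F (rw q.2 q.1) - F (rw s0 q.1))}.
    apply: continuousB.
      apply: (@continuous_comp _ _ _ (fun q : 'rV[R]_n * R => rw q.2 q.1) F); last exact: cF.
      exact: continuous_rw_swap.
    apply: (@continuous_comp _ _ _ (fun q : 'rV[R]_n * R => rw s0 q.1) F); last exact: cF.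
    by apply: (@continuous_comp _ _ _ fst (@rw n s0)); [exact: cvg_fst|exact: continuous_rw2].
  have /cvgr_norm_lt /(_ e') := cd.
  by rewrite /= subrr normr0 => /(_ e'0).
move=> d /= d0 dP; apply/nbhs_ballP; exists d => // s /dP sP v.
have [vN|vN] := leP (enorm v) N.
  apply: (le_trans (ltW (sP v vN))); rewrite ler_wpM2l ?(ltW e0)// ler_expR lerN2.
  by rewrite ler_wpM2l ?divr_ge0 ?(ltW k0)// -enorm_sqr ler_sqr ?nnegrE ?enorm_ge0.
have aux s' : `|F (rw s' v)| <= C * expR (- (k * dot v v)).
  rewrite (le_trans (FC _))// ler_wpM2l// ler_expR lerN2 ler_wpM2l ?(ltW k0)//.
  by rewrite dot_rw lerDr -expr2 sqr_ge0.
apply: (le_trans (ler_normB _ _)); apply: (le_trans (lerD (aux _) (aux _))).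
have -> : k * dot v v = k / 2 * dot v v + k / 2 * dot v v by field.
rewrite opprD expRD; set E := expR _.
have -> : C * (E * E) + C * (E * E) = 2 * C * E * E by ring.
rewrite ler_wpM2r ?expR_ge0// (le_trans _ NP)// ler_wpM2l ?mulr_ge0//.
rewrite ler_expR lerN2 ler_wpM2l ?divr_ge0 ?(ltW k0)//.
by rewrite -enorm_sqr ler_sqr ?nnegrE ?enorm_ge0// ltW.
Qed.

(* The part of integration theory that is needed, stated dimension by dimension
   so that it can be proved by induction on [n] without product measures. *)
Record integral_theory n : Prop := {
  it_mono : forall F G : 'rV[R]_n -> R, gauss_dominated F -> gauss_dominated G ->
    (forall x, F x <= G x) -> integral_Rn F <= integral_Rn G;
  it_lin : forall (F G : 'rV[R]_n -> R) (a b : R), gauss_dominated F -> gauss_dominated G ->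
    integral_Rn (fun x => a * F x + b * G x) = a * integral_Rn F + b * integral_Rn G;
  it_gauss : forall (k : R) (y : 'rV[R]_n), 0 < k ->
    integral_Rn (fun x => expR (- (k * dot (x - y) (x - y)))) = Num.sqrt (pi / k) ^+ n }.

Lemma eq_integral_Rn n (F G : 'rV[R]_n -> R) : F =1 G -> integral_Rn F = integral_Rn G.
Proof. by move=> /funext ->. Qed.

Lemma integral_RnZ n (F : 'rV[R]_n -> R) (a : R) : integral_theory n -> gauss_dominated F ->
  integral_Rn (fun x => a * F x) = a * integral_Rn F.
Proof.
move=> IT gF; rewrite -[RHS]addr0 -(mul0r (integral_Rn F)) -(it_lin IT)//.
by apply: eq_integral_Rn => x; rewrite mul0r addr0.
Qed.

Lemma integral_Rn_bound n (F : 'rV[R]_n -> R) (C k : R) : integral_theory n ->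
  gauss_dominated F -> 0 < k -> (forall x, `|F x| <= C * expR (- (k * dot x x))) ->
  `|integral_Rn F| <= C * Num.sqrt (pi / k) ^+ n.
Proof.
move=> IT gF k0 FC; have := gauss_dominated_gauss (0 : 'rV[R]_n) k0.
have gE : (fun x : 'rV[R]_n => expR (- (k * dot (x - 0) (x - 0)))) =
   (fun x : 'rV[R]_n => expR (- (k * dot x x))).
  by apply/funext => x; rewrite subr0.
have := it_gauss IT 0 k0; rewrite gE => Eg gg.
have hC (c : R) : integral_Rn (fun x : 'rV[R]_n => c * expR (- (k * dot x x))) =
    c * Num.sqrt (pi / k) ^+ n.
  by rewrite integral_RnZ// Eg.
have gC (c : R) : gauss_dominated (fun x : 'rV[R]_n => c * expR (- (k * dot x x))).
  have := gauss_dominated_lin c 0 gg gg.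
  by congr gauss_dominated; apply/funext => x; rewrite mul0r addr0.
rewrite ler_norml -mulNr -!hC; apply/andP; split; apply: (it_mono IT) => // x.
  by have := FC x; rewrite ler_norml mulNr => /andP[].
by have := FC x; rewrite ler_norml => /andP[].
Qed.

Lemma slice_integral n (F : 'rV[R]_n.+1 -> R) (C k : R) : integral_theory n ->
  continuous F -> 0 <= C -> 0 < k -> (forall x, `|F x| <= C * expR (- (k * dot x x))) ->
  mu.-integrable [set: R] (EFin \o (fun s => integral_Rn (fun v => F (rw s v)))).
Proof.
move=> IT cF C0 k0 FC; have gF : gauss_dominated F by split => //; exists C, k.
apply: (@dominated_integrable1 _ (C * Num.sqrt (pi / k) ^+ n) k) => //; last first.
  move=> s; rewrite mulrAC; apply: integral_Rn_bound => //; first exact: gauss_dominated_slice.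
  by move=> v; rewrite -mulrA -expRD -opprD -mulrDr expr2 -dot_rw; exact: FC.
move=> s0; apply/cvgrPdist_le => e e0.
have S0 : 0 < Num.sqrt (pi / (k / 2)) ^+ n.
  by rewrite exprn_gt0// sqrtr_gt0 !divr_gt0// pi_gt0.
pose e' := e / Num.sqrt (pi / (k / 2)) ^+ n.
have e'0 : 0 < e' by rewrite divr_gt0.
apply: filterS (slice_uniform s0 cF C0 k0 FC e'0) => s sP.
have gs u := gauss_dominated_slice u gF.
rewrite distrC -[X in `|X - _|]mul1r -mulN1r -(it_lin IT)//.
apply: (le_trans (@integral_Rn_bound _ _ e' (k / 2) IT _ _ _)).
- exact: gauss_dominated_lin.
- by rewrite divr_gt0.
- by move=> v; rewrite mul1r mulN1r; exact: sP.
by rewrite /e' divfK// gt_eqF.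
Qed.

Theorem integral_theoryP n : integral_theory n.
Proof.
elim: n => [|n IT].
  split => //.
  - by move=> F G _ _ h; exact: h.
  - by move=> k y k0; rewrite /= expr0 /dot big_ord0 mulr0 oppr0 expR0.
have int (F : 'rV[R]_n.+1 -> R) : gauss_dominated F ->
    mu.-integrable [set: R] (EFin \o (fun s => integral_Rn (fun v => F (rw s v)))).
  by move=> [cF [C [k [C0 k0 FC]]]]; exact: slice_integral IT cF C0 k0 FC.
split.
- move=> F G gF gG FG; apply: le_Rintegral => //; try exact: int.
  by move=> s _; apply: (it_mono IT) => //; exact: gauss_dominated_slice.
- move=> F G a b gF gG /=.
  transitivity (\int[mu]_(s in [set: R]) (a * integral_Rn (fun v => F (rw s v)) +
      b * integral_Rn (fun v => G (rw s v)))).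
    apply: eq_Rintegral => s _; rewrite -(it_lin IT)//; exact: gauss_dominated_slice.
  rewrite RintegralD//; first by rewrite !RintegralZl//; exact: int.
    have := integrableZl measurableT a (int _ gF).
    by apply: eq_integrable => // s _; rewrite /= EFinM.
  have := integrableZl measurableT b (int _ gG).
  by apply: eq_integrable => // s _; rewrite /= EFinM.
move=> k y k0; rewrite (rwK y); set y0 := y 0 ord0; set y' := \row_i _.
transitivity (\int[mu]_(s in [set: R]) (expR (- (k * (s - y0) ^+ 2)) * Num.sqrt (pi / k) ^+ n)).
  apply: eq_Rintegral => s _.
  rewrite -(it_gauss IT y' k0) -integral_RnZ//; last exact: gauss_dominated_gauss.
  apply: eq_integral_Rn => v; rewrite -/(rw s v) rwB dot_rw mulrDr opprD expRD.
  by rewrite expr2.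
rewrite RintegralZr//; last exact: gauss_integrable1.
by rewrite gauss_integral1// exprS.
Qed.

End GaussianDecay.

(** * Comparison with the free and half-space kernels *)

Section FundamentalSolution.
Context {R : realType} {n : nat}.
Implicit Types (D : set 'rV[R]_n) (x y z a : 'rV[R]_n) (t c : R).

Lemma heat_kernelC t x y : heat_kernel t x y = heat_kernel t y x.
Proof. by rewrite /heat_kernel enormBC. Qed.

Lemma heat_kernel_gauss t x y : 0 < t ->
  heat_kernel t x y = (Num.sqrt (4 * pi * t))^-1 ^+ n *
    expR (- ((4 * t)^-1 * dot (x - y) (x - y))).
Proof.
move=> t0; have h0 : 0 < 4 * pi * t :> R by rewrite !mulr_gt0// pi_gt0.
rewrite /heat_kernel enorm_sqr [_ / (4 * t)]mulrC; congr (_ * _).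
rewrite exprVn -powR12_sqrt ?(ltW h0)// powRN; congr (_^-1).
by rewrite -powR_mulrn ?powR_ge0// -powRrM [n%:R * _]mulrC.
Qed.

Lemma heat_kernel_le t x y : 0 < t -> heat_kernel t x y <= (Num.sqrt (4 * pi * t))^-1 ^+ n.
Proof.
move=> t0; rewrite heat_kernel_gauss// ler_piMr ?exprn_ge0 ?invr_ge0 ?sqrtr_ge0//.
by rewrite -expR0 ler_expR oppr_le0 mulr_ge0 ?dotxx_ge0// invr_ge0 mulr_ge0// ltW.
Qed.

Lemma sqrt_inv_le (s t : R) : 0 < s -> s <= t ->
  (Num.sqrt (4 * pi * t))^-1 ^+ n <= (Num.sqrt (4 * pi * s))^-1 ^+ n.
Proof.
move=> s0 st; have t0 : 0 < t by exact: lt_le_trans st.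
have pi4 : 0 < 4 * pi :> R by rewrite mulr_gt0// pi_gt0.
rewrite lerXn2r// ?nnegrE ?invr_ge0 ?sqrtr_ge0//.
have sq (u : R) : 0 < u -> 0 < Num.sqrt (4 * pi * u) by move=> u0; rewrite sqrtr_gt0 mulr_gt0.
by rewrite lef_pV2 ?posrE; [|exact: sq|exact: sq]; rewrite ler_wsqrtr// ler_pM2l.
Qed.

Lemma gauss_dominated_kernel t y : 0 < t ->
  gauss_dominated (fun x => heat_kernel t x y).
Proof.
move=> t0; have k0 : 0 < (4 * t)^-1 by rewrite invr_gt0 mulr_gt0.
have g := gauss_dominated_gauss y k0.
have := gauss_dominated_lin ((Num.sqrt (4 * pi * t))^-1 ^+ n) 0 g g.
congr gauss_dominated; apply/funext => x.
by rewrite mul0r addr0 heat_kernel_gauss.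
Qed.

(** The exponents [1 / (4 t)] and [k] add up to another Gaussian; [k = 0] gives the total mass 1 of
    the kernel. *)
Lemma integral_kernel_gauss t k y : 0 < t -> 0 <= k ->
  integral_Rn (fun x => heat_kernel t x y * expR (- (k * dot (x - y) (x - y)))) =
  (Num.sqrt (1 + 4 * k * t))^-1 ^+ n.
Proof.
move=> t0 k0; have IT := @integral_theoryP R n.
have kt0 : 0 < (4 * t)^-1 + k by rewrite ltr_wpDr// invr_gt0 mulr_gt0.
transitivity ((Num.sqrt (4 * pi * t))^-1 ^+ n * Num.sqrt (pi / ((4 * t)^-1 + k)) ^+ n).
  rewrite -(it_gauss IT y kt0) -(integral_RnZ _ IT); last exact: gauss_dominated_gauss.
  apply: eq_integral_Rn => x; rewrite heat_kernel_gauss// -[LHS]mulrA -expRD.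
  by rewrite -opprD -mulrDl.
rewrite -exprMn; congr (_ ^+ _).
have h0 : 0 < 4 * pi * t :> R by rewrite !mulr_gt0// pi_gt0.
have l0 : 0 < 1 + 4 * k * t by rewrite ltr_pwDl// !mulr_ge0// ltW.
rewrite -!sqrtrV ?(ltW h0) ?(ltW l0)// -sqrtrM ?invr_ge0 ?(ltW h0)//.
congr Num.sqrt; have tn0 : t != 0 by rewrite gt_eqF.
have -> : (4 * t)^-1 + k = (1 + 4 * k * t) / (4 * t) by field.
have pn0 : (pi : R) != 0 by rewrite gt_eqF// pi_gt0.
clear h0 IT kt0; move: (pi : R) pn0 (1 + 4 * k * t) l0 => P P0 l l0.
by field; rewrite P0 tn0 gt_eqF.
Qed.

Lemma integral_kernel t y : 0 < t -> integral_Rn (fun x => heat_kernel t x y) = 1.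
Proof.
move=> t0; have := integral_kernel_gauss y t0 (lexx 0).
rewrite mulr0 mul0r addr0 sqrtr1 invr1 expr1n => <-.
by apply: eq_integral_Rn => x; rewrite mul0r oppr0 expR0 mulr1.
Qed.

(* [|f z - f y| <= e + 4 M (1 - exp (- |z - y|^2 / d^2))] everywhere, and the
   right-hand side integrates explicitly against the kernel. *)
Lemma kernel_approx (f : 'rV[R]_n -> R) (M e d t : R) y : 0 < t -> continuous f ->
  (forall z, `|f z| <= M) -> 0 <= e -> 0 < d ->
  (forall z, enorm (z - y) < d -> `|f z - f y| <= e) ->
  `|integral_Rn (fun z => heat_kernel t z y * f z) - f y| <=
    e + 4 * M * (1 - (Num.sqrt (1 + 4 * d ^- 2 * t))^-1 ^+ n).
Proof.
move=> t0 cf fM e0 d0 fe; have IT := @integral_theoryP R n.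
have M0 : 0 <= M by exact: le_trans (fM 0).
pose k := d ^- 2; have k0 : 0 < k by rewrite invr_gt0 exprn_gt0.
pose E z := expR (- (k * dot (z - y) (z - y))).
have cE : continuous E by have [] := gauss_dominated_gauss y k0.
have E1 z : E z <= 1.
  by rewrite -expR0 ler_expR oppr_le0 mulr_ge0 ?dotxx_ge0// ltW.
have fE z : `|f z - f y| <= e + 4 * M * (1 - E z).
  have [zy|zy] := ltP (enorm (z - y)) d.
    rewrite (le_trans (fe _ zy))// lerDl mulr_ge0 ?subr_ge0// mulr_ge0//.
  apply: (@le_trans _ _ (2 * M)).
    by rewrite (le_trans (ler_normB _ _))// mulr2n mulrDl mul1r lerD.
  apply: (@le_trans _ _ (4 * M * (1 - E z))); last by rewrite lerDr.
  (* Here the exponent is at least 1, and [1 + u <= expR u]; so [4 * M * (1 - E z)] reaches [2 * M],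
     the trivial bound for the oscillation of [f]. *)
  have : E z <= 2^-1.
    rewrite /E expRN lef_pV2 ?posrE ?expR_gt0//.
    rewrite (le_trans _ (expR_ge1Dx _))// mulr2n lerD2l.
    rewrite /k mulrC ler_pdivlMr ?exprn_gt0// mul1r -enorm_sqr.
    by rewrite ler_sqr ?nnegrE ?enorm_ge0// ltW.
  by nra.
have gk := gauss_dominated_kernel y t0.
have gkE : gauss_dominated (fun z => heat_kernel t z y * E z).
  apply: (gauss_dominatedM (M := 1) gk cE) => z.
  by rewrite ger0_norm ?expR_ge0.
have gkf : gauss_dominated (fun z => heat_kernel t z y * f z).
  exact: (gauss_dominatedM gk cf fM).
have IE (a b : R) : integral_Rn (fun z => a * heat_kernel t z y + b * (heat_kernel t z y * E z)) =
   a + b * (Num.sqrt (1 + 4 * k * t))^-1 ^+ n.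
  by rewrite (it_lin IT)// integral_kernel// integral_kernel_gauss ?mulr1// ltW.
rewrite ler_norml; apply/andP; split.
  rewrite lerBrDr -[leLHS](_ : (f y - e - 4 * M) + 4 * M * (Num.sqrt (1 + 4 * k * t))^-1 ^+ n = _).
    rewrite -IE; apply: (it_mono IT) => //; first exact: gauss_dominated_lin.
    move=> z; have := fE z; rewrite ler_norml => /andP[h _].
    have := heat_kernel_ge0 t z y; nra.
  by rewrite -/k; ring.
rewrite lerBlDr -[leRHS](_ : (f y + e + 4 * M) + (- (4 * M)) * (Num.sqrt (1 + 4 * k * t))^-1 ^+ n = _).
  rewrite -IE; apply: (it_mono IT) => //; first exact: gauss_dominated_lin.
  move=> z; have := fE z; rewrite ler_norml => /andP[_ h].
  have := heat_kernel_ge0 t z y; nra.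
by rewrite -/k; ring.
Qed.

Lemma kernel_approx_rate (d e : R) : 0 < d -> 0 < e -> exists2 t0, 0 < t0 &
  forall t, 0 < t < t0 -> 1 - (Num.sqrt (1 + 4 * d ^- 2 * t))^-1 ^+ n <= e.
Proof.
move=> d0 e0; pose F t := (Num.sqrt (1 + 4 * d ^- 2 * t))^-1 ^+ n.
have cF : {for (0 : R), continuous F}.
  apply: (@continuous_comp R R R (fun t => (Num.sqrt (1 + 4 * d ^- 2 * t))^-1) (fun s => s ^+ n)); last exact: exprn_continuous.
  apply: continuousV; first by rewrite mulr0 addr0 sqrtr1 oner_neq0.
  apply: (@continuous_comp R R R (fun t => 1 + 4 * d ^- 2 * t) Num.sqrt); last exact: sqrt_continuous.
  apply: continuousD; first exact: cst_continuous.
  by apply: continuousM; [exact: cst_continuous|exact: cvg_id].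
have F0 : F 0 = 1 by rewrite /F mulr0 addr0 sqrtr1 invr1 expr1n.
have /cvgrPdist_le /(_ e e0) /nbhs_ballP[t0 /= t00 tP] := cF.
exists t0 => // t /andP[tt0 tt]; have := tP t.
rewrite /ball /= sub0r normrN gtr0_norm// => /(_ tt).
by rewrite F0; apply: le_trans; rewrite ler_norm.
Qed.

Lemma compact_support_bound (phi : 'rV[R]_n -> R) (K : set 'rV[R]_n) : continuous phi ->
  compact K -> (forall x, ~ K x -> phi x = 0) ->
  exists M N : R, [/\ 0 <= M, 0 <= N, forall x, `|phi x| <= M &
    forall x, phi x != 0 -> enorm x <= N].
Proof.
move=> cphi cK phi0.
have bd (f : 'rV[R]_n -> R) : continuous f -> exists2 M : R, 0 <= M & forall x, K x -> `|f x| <= M.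
  move=> cf; have [K0|/set0P K0] := eqVneq K set0.
    by exists 0 => // x; rewrite K0.
  have [|c _ cP] := @compact_EVT_max _ _ (fun x => `|f x|) K K0 cK.
    apply: continuous_subspaceT => x.
    by apply: (@cvg_norm _ _ _ _ (nbhs_filter x)); exact: cf.
  by exists `|f c| => // x Kx; apply: cP; rewrite inE.
have [M M0 MP] := bd _ cphi; have [N N0 NP] := bd _ (@continuous_enorm R n).
exists M, N; split => // x.
  by have [/MP//|/phi0->] := pselect (K x); rewrite normr0.
have [Kx _|/phi0->] := pselect (K x); last by rewrite eqxx.
by rewrite (le_trans _ (NP _ Kx))// ler_norm.
Qed.

Lemma gauss_dominated_support (f : 'rV[R]_n -> R) (M N : R) : 0 <= M -> 0 <= N ->
  continuous f -> (forall x, `|f x| <= M) -> (forall x, f x != 0 -> enorm x <= N) ->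
  gauss_dominated f.
Proof.
move=> M0 N0 cf fM fN; split => //; exists (M * expR (N ^+ 2)), 1.
split; rewrite ?mulr_ge0 ?expR_ge0// => x; rewrite mul1r.
have [->|fx] := eqVneq (f x) 0; first by rewrite normr0 !mulr_ge0 ?expR_ge0.
rewrite (le_trans (fM x))// -mulrA -expRD ler_peMr// -expR0 ler_expR subr_ge0.
by rewrite -enorm_sqr ler_sqr ?nnegrE ?enorm_ge0// fN.
Qed.

Lemma test_function_bound D phi : test_function D phi ->
  exists M N : R, [/\ 0 <= M, 0 <= N, forall x, `|phi x| <= M &
    forall x, phi x != 0 -> enorm x <= N].
Proof. by move=> [cphi [K [cK _ phi0]]]; exact: compact_support_bound phi0. Qed.

Lemma kernel_initial (phi : 'rV[R]_n -> R) (M : R) y : continuous phi ->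
  (forall x, `|phi x| <= M) ->
  integral_Rn (fun x => heat_kernel t x y * phi x) @[t --> 0^'+] --> phi y.
Proof.
move=> cphi phiM; apply/cvgrPdist_le => e e0.
have M0 : 0 <= M by exact: le_trans (phiM 0).
have e2 : 0 < e / 2 by rewrite divr_gt0.
have /nbhs_eballP[d d0 dP] : \forall z \near y, `|phi z - phi y| <= e / 2.
  have /cvgrPdist_le /(_ _ e2) := cphi y.
  by apply: filterS => z; rewrite distrC.
have M1 : 0 < 4 * M + 1 by rewrite ltr_wpDl// mulr_ge0.
have [t0 t00 tP] := kernel_approx_rate d0 (divr_gt0 e2 M1).
apply/nbhs_ballP; exists t0 => // t.
rewrite /ball /= sub0r normrN => tt t_gt0; rewrite gtr0_norm// in tt.
have /tP h : 0 < t < t0 by rewrite t_gt0.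
rewrite distrC (le_trans (kernel_approx t_gt0 cphi phiM (ltW e2) d0 dP))//.
rewrite [leRHS]splitr lerD2l (le_trans (ler_wpM2l _ h)) ?mulr_ge0//.
by rewrite mulrA ler_pdivrMr// mulrC ler_wpM2l ?(ltW e2)// lerDl.
Qed.

Lemma fundamental_kernel D y : open D ->
  fundamental_solution D y (fun t x => heat_kernel t x y).
Proof.
move=> oD; split; first by move=> *; exact: heat_kernel_ge0.
  exact: heat_solution_kernel.
move=> phi tphi; have [M [N [_ _ phiM _]]] := test_function_bound tphi.
by case: tphi => cphi _; exact: kernel_initial phiM.
Qed.

Lemma halfspace_kernel_ge0 a c t x y : enorm a = 1 -> 0 < t ->
  c <= dot a x -> c <= dot a y -> 0 <= halfspace_kernel a c t x y.
Proof.
move=> a1 t0 cx cy; rewrite halfspace_kernelE// mulr_ge0 ?heat_kernel_ge0//.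
rewrite subr_ge0 -expR0 ler_expR oppr_le0 divr_ge0 ?(ltW t0)//.
by rewrite mulr_ge0// subr_ge0.
Qed.

Lemma fundamental_halfspace_kernel D a c y : open D -> D y -> enorm a = 1 ->
  D `<=` halfspace a c ->
  fundamental_solution D y (fun t x => halfspace_kernel a c t x y).
Proof.
move=> oD Dy a1 DH; split.
- move=> t x t0 Dx; apply: halfspace_kernel_ge0 => //; exact/ltW/DH.
- exact: heat_solution_halfspace_kernel.
move=> phi tphi; have [M [N [M0 N0 phiM phiN]]] := test_function_bound tphi.
have [cphi [K [_ KD phi0]]] := tphi.
have gphi := gauss_dominated_support M0 N0 cphi phiM phiN.
have IT := @integral_theoryP R n.
(* The mirror image of the pole lies outside the half-space, hence outside the support of [phi]: the
   second kernel contributes 0 in the limit. *)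
have -> : phi y = phi y - phi (reflection a c y).
  rewrite (phi0 (reflection a c y)) ?subr0// => /KD /DH.
  have := DH _ Dy; rewrite /halfspace /reflection /= dotBr dotZr (dotaa a1); lra.
apply: (cvg_trans _ (cvgB (kernel_initial (y := y) cphi phiM)
  (kernel_initial (y := reflection a c y) cphi phiM))).
apply: near_eq_cvg.
apply: filterS (nbhs_right_gt 0) => t t0 /=.
have g z : gauss_dominated (fun x => heat_kernel t x z * phi x).
  by apply: gauss_dominatedM phiM => //; exact: gauss_dominated_kernel.
transitivity (1 * integral_Rn (fun x => heat_kernel t x y * phi x) +
  (-1) * integral_Rn (fun x => heat_kernel t x (reflection a c y) * phi x)).
  by rewrite mul1r mulN1r.
rewrite -(it_lin IT)//.
by apply: eq_integral_Rn => x; rewrite /halfspace_kernel mulrBl mul1r mulN1r.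
Qed.

Lemma pD_le_kernel D pD t x y : open D -> dirichlet_heat_kernel D pD ->
  0 < t -> D x -> D y -> pD t x y <= heat_kernel t x y.
Proof.
move=> oD dk t0 Dx Dy; have [_ _ m] := dk y Dy.
by apply: (m _ (fundamental_kernel y oD)).
Qed.

Lemma pD_le_halfspace D pD a c t x y : open D -> dirichlet_heat_kernel D pD ->
  0 < t -> D x -> D y -> enorm a = 1 -> D `<=` halfspace a c ->
  pD t x y <= heat_kernel t x y * (1 - expR (- ((dot a x - c) * (dot a y - c) / t))).
Proof.
move=> oD dk t0 Dx Dy a1 DH; have [_ _ m] := dk y Dy.
rewrite -halfspace_kernelE//.
by apply: (m _ (fundamental_halfspace_kernel oD Dy a1 DH)).
Qed.

Lemma offdiagonal_small y (d e : R) : 0 < d -> 0 < e -> exists2 t0, 0 < t0 &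
  forall t x, 0 < t < t0 -> d <= enorm (x - y) -> heat_kernel t x y <= e.
Proof.
(* For [t < 1] the prefactor is at most [t ^- n]. Splitting [d ^+ 2 / (4 t)] into [n + 1] equal
   parts and using [1 + u <= expR u] for each bounds the exponential by [C * t ^+ n.+1], which
   leaves one factor [t]. *)
move=> d0 e0; pose m : R := n.+1%:R; pose C := (4 * m / d ^+ 2) ^+ n.+1.
have m0 : 0 < m by rewrite ltr0n.
have C0 : 0 < C by rewrite exprn_gt0// divr_gt0 ?mulr_gt0 ?exprn_gt0.
exists (Num.min 1 (e / C)); first by rewrite lt_min ltr01 divr_gt0.
move=> t x /andP[t0]; rewrite lt_min => /andP[t1 te] dx.
have p1 : 1 <= 4 * pi :> R.
  have := @pi_ge2 R; lra.
have st : t <= Num.sqrt (4 * pi * t).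
  rewrite -[leLHS](ger0_norm (ltW t0)) -sqrtr_sqr ler_wsqrtr// expr2 ler_wpM2r ?(ltW t0)//.
  by rewrite (le_trans (ltW t1)).
rewrite heat_kernel_gauss//.
have eb : expR (- ((4 * t)^-1 * dot (x - y) (x - y))) <= C * t ^+ n.+1.
  apply: (@le_trans _ _ (expR (- (d ^+ 2 / (4 * t))))).
    rewrite ler_expR lerN2 mulrC ler_wpM2l ?invr_ge0 ?mulr_ge0 ?(ltW t0)//.
    by rewrite -enorm_sqr ler_sqr ?nnegrE ?enorm_ge0 ?(ltW d0).
  have -> : d ^+ 2 / (4 * t) = d ^+ 2 / (4 * t * m) * n.+1%:R.
    by rewrite -/m; field; rewrite !gt_eqF.
  rewrite expRN expRM_natr -exprVn /C -exprMn lerXn2r// ?nnegrE ?invr_ge0 ?expR_ge0//.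
    by rewrite mulr_ge0 ?(ltW t0)// divr_ge0 ?mulr_ge0 ?exprn_ge0 ?(ltW m0) ?(ltW d0).
  have q0 : 0 < d ^+ 2 / (4 * t * m) by rewrite divr_gt0 ?mulr_gt0 ?exprn_gt0.
  have -> : 4 * m / d ^+ 2 * t = (d ^+ 2 / (4 * t * m))^-1.
    by field; rewrite !gt_eqF.
  rewrite lef_pV2 ?posrE ?expR_gt0//.
  by rewrite (le_trans _ (expR_ge1Dx _))// lerDr.
apply: (@le_trans _ _ (t^-1 ^+ n * (C * t ^+ n.+1))).
  apply: ler_pM; rewrite ?exprn_ge0 ?expR_ge0 ?invr_ge0 ?sqrtr_ge0//.
  rewrite lerXn2r// ?nnegrE ?invr_ge0 ?sqrtr_ge0 ?(ltW t0)//.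
  by rewrite lef_pV2 ?posrE// (lt_le_trans t0).
have -> : t^-1 ^+ n * (C * t ^+ n.+1) = t * C.
  by rewrite exprVn exprSr; field; rewrite expf_neq0// gt_eqF.
by rewrite -ler_pdivlMr// ltW.
Qed.

End FundamentalSolution.

(** * The initial trace *)

Section InitialTime.
Context {R : realType} {n : nat}.
Implicit Types (D : set 'rV[R]_n) (x y z a : 'rV[R]_n) (t s c : R).
Implicit Types (f u v w : R -> 'rV[R]_n -> R).

Definition heat_at w t x := exists ft g h, jet w t x ft g h /\ ft = \sum_i h i.

Lemma heat_atB u v t x : heat_at u t x -> heat_at v t x ->
  heat_at (fun t x => u t x - v t x) t x.
Proof.
move=> [ut [gu [hu [ju Eu]]]] [vt [gv [hv [jv Ev]]]].
by do 3 eexists; split; [exact: jetB ju jv|rewrite Eu Ev sumrB].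
Qed.

Lemma heat_atZ (k : R) u t x : heat_at u t x -> heat_at (fun t x => k * u t x) t x.
Proof.
move=> [ut [gu [hu [ju Eu]]]].
by do 3 eexists; split; [exact: jetZ ju|rewrite Eu big_distrr].
Qed.

Lemma heat_at_cst (k : R) t x : heat_at (fun _ _ => k) t x.
Proof. by do 3 eexists; split; [exact: jet_cst|rewrite big1]. Qed.

Lemma heat_atD u v t x : heat_at u t x -> heat_at v t x ->
  heat_at (fun t x => u t x + v t x) t x.
Proof.
move=> hu hv; have := heat_atB hu (heat_atZ (-1) hv).
by under eq_fun do under eq_fun do rewrite mulN1r opprK.
Qed.

Lemma heat_at_sum (I : Type) (S : seq I) (F : I -> R -> 'rV[R]_n -> R) t x :
  (forall i, heat_at (F i) t x) -> heat_at (fun t x => \sum_(i <- S) F i t x) t x.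
Proof.
move=> hF; elim: S => [|i S IH].
  by under eq_fun do under eq_fun do rewrite big_nil; exact: heat_at_cst.
under eq_fun do under eq_fun do rewrite big_cons.
exact: heat_atD.
Qed.

Lemma heat_at_shift u t x s : heat_at u (t - s) x -> heat_at (fun t => u (t - s)) t x.
Proof. by move=> [ut [gu [hu [ju E]]]]; exists ut, gu, hu; split => //; exact: jet_shift. Qed.

Lemma heat_at_kernel y t x : 0 < t -> heat_at (fun t x => heat_kernel t x y) t x.
Proof. by move=> t0; do 3 eexists; split; [exact: jet_kernel|]. Qed.

Lemma jointly_continuous_shift u t x s : jointly_continuous_at u (t - s) x ->
  jointly_continuous_at (fun t => u (t - s)) t x.
Proof.
move=> cu; apply: (@continuous_comp _ _ _ (fun q : R * 'rV[R]_n => (q.1 - s, q.2)) (fun q => u q.1 q.2)); last exact: cu.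
move=> A /nbhs_pairP[e e0 eA]; apply/nbhs_pairP; exists e => // s' z ss zx.
by apply: eA => //=; rewrite opprB addrA subrK.
Qed.

Lemma eball_net (N d : R) : 0 < d -> exists S : seq 'rV[R]_n,
  forall x, enorm x <= N -> exists2 z, z \in S & enorm (x - z) < d.
Proof.
move=> d0; have := @compact_eball R n N; rewrite compact_cover.
move=> /(_ _ setT (fun z => eball z d))[].
- by move=> z _; exact: open_eball.
- by move=> x _; exists x => //; exact: eball_center.
move=> S _ SP; exists (finmap.enum_fset S) => x /SP[z /= zS xz].
by exists z.
Qed.

(* The weights are the integrals of a continuous partition of unity. *)
Lemma quadrature (N : R) : 0 <= N -> exists2 C : R, 0 <= C & forall d : R, 0 < d <= 1 ->
  exists S : seq (R * 'rV[R]_n), (forall p, p \in S -> 0 <= p.1) /\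
  forall (F : 'rV[R]_n -> R) (w : R), continuous F ->
    (forall x, F x != 0 -> enorm x <= N) -> 0 <= w ->
    (forall z z', enorm (z - z') < d -> `|F z - F z'| <= w) ->
    `|integral_Rn F - \sum_(p <- S) p.1 * F p.2| <= C * w.
Proof.
move=> N0; have IT := @integral_theoryP R n.
(* A function bounded by [w] and supported in the ball of radius [N + 1] lies below
   [w * expR ((N + 1) ^+ 2)] times the unit Gaussian, so [integral_Rn_bound] applies. The radius
   grows by 1 because the cells have size [d <= 1]. *)
exists (expR ((N + 1) ^+ 2) * Num.sqrt (pi / 1) ^+ n).
  by rewrite mulr_ge0 ?expR_ge0// exprn_ge0// sqrtr_ge0.
move=> d /andP[d0 d1]; have [net netP] := eball_net N (divr_gt0 d0 (ltr0Sn R 1)).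
pose tent z x := Num.max 0 (d - enorm (x - z)).
pose sig x := \sum_(z <- net) tent z x.
(* The floor [d / 2] makes the quotient continuous everywhere. For [|x| <= N] some net point is
   within [d / 2], so the maximum is [sig x] and the functions [chi z] sum to 1. *)
pose den x := Num.max (d / 2) (sig x).
pose chi z x := tent z x / den x.
have tent0 z x : 0 <= tent z x by rewrite le_max lexx.
have sig0 x : 0 <= sig x by apply: sumr_ge0.
have den0 x : 0 < den x by rewrite lt_max divr_gt0.
have chi0 z x : 0 <= chi z x by rewrite divr_ge0// ltW.
have csub z : continuous (fun x => enorm (x - z)).
  move=> x; apply: (@continuous_comp _ _ _ (fun x => x - z) (@enorm R n)).
    by apply: (@cvgB _ _ _ _ (nbhs_filter x)); [exact: cvg_id|exact: cvg_cst].
  exact: continuous_enorm.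
have cmax (k : R) (g : 'rV[R]_n -> R) : continuous g -> continuous (fun x => Num.max k (g x)).
  move=> cg x; apply: (@continuous_comp 'rV[R]_n R R g (fun s => Num.max k s)); first exact: cg.
  by apply: continuous_max; [exact: cst_continuous|exact: cvg_id].
have ctent z : continuous (tent z).
  apply: cmax => x; apply: (@cvgB _ _ _ _ (nbhs_filter x)); first exact: cvg_cst.
  exact: csub.
have cden : continuous den.
  by apply: cmax => x; apply: (@cvg_bigsum _ _ _ _ (nbhs_filter x)) => z; exact: ctent.
have cchi z : continuous (chi z).
  move=> x; apply: (@cvgM _ _ _ (nbhs_filter x)); first exact: ctent.
  by apply: (@cvgV _ _ _ (nbhs_filter x)); [rewrite gt_eqF|exact: cden].
have chisum x : \sum_(z <- net) chi z x = sig x / den x by rewrite -mulr_suml.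
have chisum1 x : \sum_(z <- net) chi z x <= 1.
  by rewrite chisum ler_pdivrMr// mul1r le_max lexx orbT.
have chisumK x : enorm x <= N -> \sum_(z <- net) chi z x = 1.
  move=> /netP[z zS xz]; rewrite chisum /den (_ : Num.max _ _ = sig x).
    rewrite divff// gt_eqF// (lt_le_trans (y := d / 2)) ?divr_gt0//.
    rewrite /sig (big_rem z)//= (le_trans (y := tent z x)) ?lerDl ?sumr_ge0//.
    by rewrite le_max; apply/orP; right; lra.
  apply/max_idPr; rewrite /sig (big_rem z)//= (le_trans (y := tent z x)) ?lerDl ?sumr_ge0//.
  by rewrite le_max; apply/orP; right; lra.
have chinear z x : chi z x != 0 -> enorm (x - z) < d.
  apply: contraNT; rewrite -leNgt => h; rewrite /chi /tent.
  by rewrite (max_idPl _) ?mul0r// subr_le0.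
have chi1 z x : z \in net -> `|chi z x| <= 1.
  move=> zS; rewrite ger0_norm// (le_trans _ (chisum1 x))// (big_rem z)//= lerDl.
  exact: sumr_ge0.
have gchi z : z \in net -> gauss_dominated (chi z).
  move=> zS; apply: (@gauss_dominated_support _ _ _ 1 (enorm z + d)) => //.
  - by rewrite addr_ge0 ?enorm_ge0// ltW.
  - by move=> x; exact: chi1.
  - move=> x /chinear xz; have := enormD (x - z) z; rewrite subrK; lra.
have gsum (F : 'rV[R]_n -> R) (S : seq 'rV[R]_n) : {subset S <= net} ->
    gauss_dominated (fun x => \sum_(z <- S) F z * chi z x) /\
    integral_Rn (fun x => \sum_(z <- S) F z * chi z x) =
    \sum_(z <- S) integral_Rn (chi z) * F z.
  elim: S => [_|z S IH sub].
    have g0 : gauss_dominated (fun x : 'rV[R]_n => 0 : R).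
      split; first exact: cst_continuous.
      by exists 0, 1; split => // x; rewrite normr0 mul0r.
    split; first by under eq_fun do rewrite big_nil.
    rewrite big_nil; under eq_fun do rewrite big_nil.
    transitivity (integral_Rn (fun x : 'rV[R]_n => 0 * (0 : R))).
      by apply: eq_integral_Rn => x; rewrite mul0r.
    by rewrite integral_RnZ// mul0r.
  have [|g E] := IH; first by move=> u uS; apply: sub; rewrite inE uS orbT.
  have gz : gauss_dominated (chi z) by apply: gchi; apply: sub; rewrite inE eqxx.
  have FE : (fun x => \sum_(z0 <- z :: S) F z0 * chi z0 x) =
      (fun x => F z * chi z x + 1 * (\sum_(z0 <- S) F z0 * chi z0 x)).
    by apply/funext => x; rewrite big_cons mul1r.
  rewrite FE; split; first exact: gauss_dominated_lin.
  by rewrite (it_lin IT)// E big_cons mul1r mulrC.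
exists [seq (integral_Rn (chi z), z) | z <- net]; split.
  move=> p /mapP[z zS ->] /=.
  have gz := gchi z zS.
  have := it_mono IT (gauss_dominated_lin 0 0 gz gz) gz.
  rewrite (it_lin IT)// !mul0r addr0; apply => x.
  by rewrite !mul0r addr0.
move=> F w cF FN w0 Fw; rewrite big_map /=.
have [gS ES] := gsum F net (fun _ h => h); rewrite -ES.
have gF : gauss_dominated F.
  have cK := @compact_eball R n N.
  have [|M [N' [M0 N'0 FM FN']]] := @compact_support_bound _ _ F _ cF cK.
    by move=> x; apply: contra_notP => /eqP/FN.
  exact: gauss_dominated_support FM FN'.
have gD : gauss_dominated (fun x => 1 * F x + (-1) * \sum_(z <- net) F z * chi z x).
  exact: gauss_dominated_lin.
rewrite -[X in X - _]mul1r -mulN1r -(it_lin IT)//.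
have -> : expR ((N + 1) ^+ 2) * Num.sqrt (pi / 1) ^+ n * w =
  (w * expR ((N + 1) ^+ 2)) * Num.sqrt (pi / 1) ^+ n by ring.
apply: integral_Rn_bound => // x; rewrite mul1r mulN1r mul1r.
have bnd : `|F x - \sum_(z <- net) F z * chi z x| <= w.
  have -> : F x - \sum_(z <- net) F z * chi z x = \sum_(z <- net) (F x - F z) * chi z x.
    under [RHS]eq_bigr do rewrite mulrBl.
    rewrite sumrB -mulr_sumr; congr (_ - _).
    have [->|/FN/chisumK ->] := eqVneq (F x) 0; first by rewrite mul0r.
    by rewrite mulr1.
  apply: (le_trans (ler_norm_sum _ _ _)); rewrite -[leRHS]mulr1.
  apply: (@le_trans _ _ (w * \sum_(z <- net) chi z x)); last exact: ler_wpM2l.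
  rewrite mulr_sumr; apply: ler_sum => z _; rewrite normrM (ger0_norm (chi0 z x)).
  have [->|/chinear xz] := eqVneq (chi z x) 0; first by rewrite !mulr0.
  by apply: ler_wpM2r => //; exact: Fw.
have [xN|xN] := leP (enorm x) (N + 1).
  rewrite (le_trans bnd)// -mulrA -expRD ler_peMr// -[leLHS]expR0 ler_expR subr_ge0.
  by rewrite -enorm_sqr ler_sqr ?nnegrE ?enorm_ge0// addr_ge0.
suff -> : F x - \sum_(z <- net) F z * chi z x = 0.
  by rewrite normr0 !mulr_ge0 ?expR_ge0.
have F0 : F x = 0 by apply/eqP; apply: contraTT xN => /FN xN; rewrite -leNgt; lra.
rewrite F0 big1 ?subr0// => z _.
have [->|/chinear xz] := eqVneq (chi z x) 0; first by rewrite mulr0.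
have [->|/FN zN] := eqVneq (F z) 0; first by rewrite mul0r.
by have := enormD (x - z) z; rewrite subrK; lra.
Qed.

Lemma support_unif_continuous (f : 'rV[R]_n -> R) (N e : R) : continuous f ->
  (forall x, f x != 0 -> enorm x <= N) -> 0 < e ->
  exists2 d : R, 0 < d <= 1 & forall z z', enorm (z - z') < d -> `|f z - f z'| <= e.
Proof.
move=> cf fN e0; have /compact_near_coveringP cK := @compact_eball R n (N + 1).
have := cK R (0^'+) (fun d z => forall z', enorm (z - z') < d -> `|f z - f z'| <= e) _.
move=> /(_ _)[].
  move=> z0 _; have e2 : 0 < e / 2 by rewrite divr_gt0.
  have /nbhs_eballP[r r0 rP] : \forall z \near z0, `|f z0 - f z| < e / 2.
    by have /cvgrPdist_lt /(_ _ e2) := cf z0.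
  have r2 : 0 < r / 2 by rewrite divr_gt0.
  exists (eball z0 (r / 2), [set s : R | s < r / 2]) => /=.
    by split; [exact: nbhs_eball|exact: nbhs_right_lt].
  move=> [z s] [/= zz0 sr] z' zz'; rewrite /eball /= in zz0.
  have h1 : `|f z0 - f z| < e / 2 by apply: rP; rewrite /eball /=; lra.
  have h2 : `|f z0 - f z'| < e / 2.
    by apply: rP; rewrite /eball /=; have := enorm_triangle z z' z0; rewrite (enormBC z' z); lra.
  by rewrite (le_trans (ler_distD (f z0) _ _))// distrC [leRHS]splitr lerD// ltW.
move=> d /= d0 dP; exists (Num.min 1 (d / 2)).
  by rewrite lt_min ltr01 divr_gt0// ge_min lexx.
move=> z z'; rewrite lt_min => /andP[zz1 zzd].
have [zN|zN] := leP (enorm z) (N + 1).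
  have d2 : 0 < d / 2 by rewrite divr_gt0.
  apply: (dP (d / 2)) => //=; rewrite /ball /= sub0r normrN gtr0_norm//.
  by rewrite ltr_pdivrMr// ltr_pMr// ltr1n.
have fz : f z = 0 by apply/eqP; apply: contraTT zN => /fN; rewrite -leNgt; lra.
have fz' : f z' = 0.
  apply/eqP; apply: contraTT zN => /fN; rewrite -leNgt.
  by have := enormD (z - z') z'; rewrite subrK; lra.
by rewrite fz fz' subr0 normr0 ltW.
Qed.

Lemma heat_solution_at D u t x : open D -> heat_solution D u -> 0 < t -> D x ->
  heat_at u t x.
Proof. by move=> oD hu t0 Dx; exact: heat_solution_jet Dx. Qed.

Lemma kernel_lipschitz t x (L : R) (z z' : 'rV[R]_n) : 0 < t ->
  enorm (z - x) <= L -> enorm (z' - x) <= L ->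
  `|heat_kernel t z x - heat_kernel t z' x| <=
    (Num.sqrt (4 * pi * t))^-1 ^+ n * (2 * L / (4 * t)) * enorm (z - z').
Proof.
move=> t0 zL z'L; rewrite !heat_kernel_gauss// -mulrBr normrM -[leRHS]mulrA.
have P0 : 0 <= (Num.sqrt (4 * pi * t))^-1 ^+ n by rewrite exprn_ge0// invr_ge0 sqrtr_ge0.
rewrite (ger0_norm P0); apply: ler_wpM2l => //.
have lip (p q : R) : 0 <= p -> 0 <= q -> `|expR (- p) - expR (- q)| <= `|p - q|.
  have aux (p' q' : R) : 0 <= p' -> p' <= q' -> `|expR (- p') - expR (- q')| <= `|p' - q'|.
    move=> p0 pq; rewrite ger0_norm ?subr_ge0 ?ler_expR ?lerN2//.
    rewrite ler0_norm ?subr_le0// opprB.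
    have -> : expR (- q') = expR (- p') * expR (- (q' - p')) by rewrite -expRD; congr expR; ring.
    have e1 : expR (- p') <= 1 by rewrite -expR0 ler_expR oppr_le0.
    have e2 := expR_ge1Dx (- (q' - p')).
    have e3 := expR_ge0 (- p').
    have : 0 <= q' - p' by rewrite subr_ge0.
    have : expR (- (q' - p')) <= 1 by rewrite -expR0 ler_expR oppr_le0 subr_ge0.
    nra.
  move=> p0 q0; have [pq|/ltW qp] := leP p q; first exact: aux.
  by rewrite distrC (distrC p); exact: aux.
have i0 : 0 <= (4 * t)^-1 by rewrite invr_ge0 mulr_ge0// ltW.
apply: (le_trans (lip _ _ _ _)); rewrite ?mulr_ge0 ?dotxx_ge0//.
rewrite -mulrBr normrM (ger0_norm i0) [leRHS](_ : _ = (4 * t)^-1 * (2 * L * enorm (z - z'))); last by ring.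
apply: ler_wpM2l => //; rewrite -!enorm_sqr subr_sqr normrM mulrC.
apply: ler_pM => //.
  by rewrite ger0_norm ?addr_ge0 ?enorm_ge0//; lra.
have := enorm_dist (z - x) (z' - x); congr (_ <= enorm _).
by rewrite opprB addrA subrK.
Qed.

(** The kernel and [v] tend weakly to the same point mass, so their difference [h >= 0] has little
    mass near [y] at a small time [s0]. From then on [h] is at most [e / 2] plus the heat flow of
    its slice at [s0], and this flow is bounded by the mass times the supremum of the kernel. A
    quadrature sum replaces the flow: a finite sum of kernels solves the heat equation without
    differentiation under the integral. *)
Lemma initial_trace D v y : open D -> D y -> fundamental_solution D y v ->
  (forall t x, 0 < t -> D x -> v t x <= heat_kernel t x y) ->
  forall e, 0 < e -> exists2 d, 0 < d & forall t x, 0 < t < d -> enorm (x - y) < d ->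
    heat_kernel t x y - v t x <= e.
Proof.
move=> oD Dy [v0 hv vphi] vp e e0; have IT := @integral_theoryP R n.
have [r3 r30 r3D] := open_eballP oD Dy; pose r := r3 / 3.
have r0 : 0 < r by rewrite divr_gt0.
have rD x : enorm (x - y) <= 2 * r -> D x.
  move=> xr; apply: r3D; rewrite /eball /=.
  have : r3 = r * 3 by rewrite /r divfK.
  by lra.
pose phi x := Num.max 0 (Num.min 1 (2 - enorm (x - y) / r)).
have ceb : continuous (fun x => enorm (x - y)).
  move=> x; apply: (@continuous_comp _ _ _ (fun x => x - y) (@enorm R n)).
    by apply: (@cvgB _ _ _ _ (nbhs_filter x)); [exact: cvg_id|exact: cvg_cst].
  exact: continuous_enorm.
have cphi : continuous phi.
  move=> x; apply: (@continuous_comp 'rV[R]_n R R (fun x => enorm (x - y))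
      (fun s => Num.max 0 (Num.min 1 (2 - s / r)))); first exact: ceb.
  apply: continuous_max; first exact: cst_continuous.
  apply: continuous_min; first exact: cst_continuous.
  apply: continuousB; first exact: cst_continuous.
  by apply: continuousM; [exact: cvg_id|exact: cst_continuous].
have phi01 x : 0 <= phi x <= 1.
  by rewrite /phi le_max lexx /= ge_max ler01 /= ge_min lexx.
have phi1 x : enorm (x - y) <= r -> phi x = 1.
  move=> xr; rewrite /phi (_ : Num.min _ _ = 1) ?(max_idPr _)//.
  by apply/min_idPl; rewrite lerBrDr -lerBrDl -[_ - 1](_ : 1 = _) ?ler_pdivrMr ?mul1r//; lra.
have phi0 x : 2 * r <= enorm (x - y) -> phi x = 0.
  move=> xr; apply/max_idPl; rewrite ge_min; apply/orP; right.
  by rewrite subr_le0 ler_pdivlMr.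
pose N := enorm y + 2 * r.
have N0 : 0 <= N by rewrite addr_ge0 ?enorm_ge0 ?mulr_ge0// ltW.
have phiN x : phi x != 0 -> enorm (x - y) < 2 * r.
  by apply: contraNT; rewrite -leNgt => /phi0 ->.
have bN x : enorm (x - y) < 2 * r -> enorm x <= N.
  by have := enormD (x - y) y; rewrite subrK /N; lra.
have tphi : test_function D phi.
  split => //; exists [set x | enorm (x - y) <= 2 * r]; split.
  - have cl : closed [set x | enorm (x - y) <= 2 * r].
      by apply: (@closed_comp _ _ (fun x => enorm (x - y)) [set s : R | s <= 2 * r]);
        [move=> x _; exact: ceb|exact: closed_le].
    apply: (subclosed_compact cl (@compact_eball R n N)) => x /= xr.
    by have := enormD (x - y) y; rewrite subrK /N; lra.
  - by move=> x /rD.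
  - by move=> x /= /negP; rewrite -ltNge => /ltW /phi0.
have e4 : 0 < e / 4 by rewrite divr_gt0.
(* This controls [h] near the sphere of radius [r] around [y], the lateral boundary of the
   comparison, where [h <= e / 4 < W]. It also fixes the final [d], before [s0] is chosen in terms
   of [t]. *)
have [t1 t10 off] := @offdiagonal_small _ _ y (r / 2) (e / 4) (divr_gt0 r0 (ltr0Sn _ 1)) e4.
exists (Num.min t1 r); first by rewrite lt_min t10.
move=> t x /andP[t0]; rewrite !lt_min => /andP[tt1 _] /andP[_ xr].
pose h t x := heat_kernel t x y - v t x.
have h0 s z : 0 < s -> D z -> 0 <= h s z by move=> *; rewrite subr_ge0 vp.
have P0 s : 0 <= (Num.sqrt (4 * pi * s))^-1 ^+ n by rewrite exprn_ge0// invr_ge0 sqrtr_ge0.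
pose P := (Num.sqrt (4 * pi * (t / 2)))^-1 ^+ n.
have P1 : 0 < P + 1 by rewrite ltr_wpDl// P0.
have ch s z : 0 < s -> D z -> jointly_continuous_at h s z.
  move=> s0 Dz; apply: continuousB; first exact: jointly_continuous_kernel.
  by have [] := hv s z s0 Dz.
have hh s z : 0 < s -> D z -> heat_at h s z.
  by move=> s0 Dz; apply: heat_atB; [exact: heat_at_kernel|exact: heat_solution_at Dz].
have cslice s : 0 < s -> continuous (fun z => h s z * phi z).
  move=> s0 z; have [zr|zr] := ltP (2 * r) (enorm (z - y)).
    have zn : \forall q \near z, 0 = h s q * phi q.
      have /cvgr_gt /(_ _ zr) := ceb z.
      by apply: filterS => q /ltW /phi0 ->; rewrite mulr0.
    apply: cvg_trans (near_eq_cvg zn) _.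
    by rewrite -(nbhs_singleton zn); exact: cvg_cst.
  apply: (@cvgM _ _ _ (nbhs_filter z)); last exact: cphi.
  apply: (@continuous_comp _ _ _ (fun z => (s, z)) (fun q : R * 'rV[R]_n => h q.1 q.2)); last first.
    by apply: ch => //; exact: rD.
  move=> A /nbhs_pairP[d d0 dA]; apply/nbhs_eballP; exists d => // q qz.
  by apply: dA => //; rewrite subrr normr0.
have hb s z : 0 < s -> `|h s z * phi z| <= (Num.sqrt (4 * pi * s))^-1 ^+ n.
  move=> s0; have [/eqP z0|/phiN/ltW/rD Dz] := eqVneq (phi z) 0.
    by rewrite (eqP z0) mulr0 normr0.
  have := phi01 z => /andP[p0 p1].
  rewrite normrM (ger0_norm (h0 s z s0 Dz)) (ger0_norm p0).
  rewrite (le_trans (ler_piMr _ p1)) ?h0//.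
  rewrite (le_trans _ (heat_kernel_le z y s0))// /h gerBl.
  exact: v0.
have intlim : (integral_Rn (fun z => h s z * phi z)) @[s --> 0^'+] --> (0 : R).
  have phiM z : `|phi z| <= 1 by have /andP[? ?] := phi01 z; rewrite ger0_norm.
  suff : (integral_Rn (fun z => h s z * phi z)) @[s --> 0^'+] --> phi y - phi y.
    by rewrite subrr.
  apply: (cvg_trans _ (cvgB (kernel_initial (y := y) cphi phiM) (vphi phi tphi))).
  apply: near_eq_cvg; apply: filterS (nbhs_right_gt 0) => s s0 /=.
  have g1 : gauss_dominated (fun z => heat_kernel s z y * phi z).
    by apply: gauss_dominatedM phiM => //; exact: gauss_dominated_kernel.
  have g2 : gauss_dominated (fun z => h s z * phi z).
    apply: (@gauss_dominated_support _ _ _ _ N (P0 s) N0 (cslice s s0)) => z.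
      exact: hb.
    by rewrite mulf_eq0 negb_or => /andP[_ /phiN/bN].
  have E : integral_Rn (fun z => v s z * phi z) =
      integral_Rn (fun z => 1 * (heat_kernel s z y * phi z) + (-1) * (h s z * phi z)).
    by apply: eq_integral_Rn => z; rewrite /h; ring.
  transitivity (integral_Rn (fun z => heat_kernel s z y * phi z) -
    integral_Rn (fun z => v s z * phi z)) => //.
  by rewrite E (it_lin IT)//; ring.
have eP : 0 < e / 8 / (P + 1) by rewrite !divr_gt0.
have [s0 [s00 s0t intl]] : exists s0, [/\ 0 < s0, s0 < t / 2 &
    integral_Rn (fun z => h s0 z * phi z) <= e / 8 / (P + 1)].
  have /cvgrPdist_le /(_ _ eP) near1 := intlim.
  have near2 : \forall s \near 0^'+, s < t / 2 by apply: nbhs_right_lt; rewrite divr_gt0.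
  have [s [[h1 h3] h2]] := @filter_ex _ _ (at_right_proper_filter (0 : R)) _ (filterI (filterI near1 near2) (nbhs_right_gt 0)).
  exists s; split => //.
  by rewrite sub0r normrN in h1; rewrite (le_trans (ler_norm _)).
pose f z := h s0 z * phi z; pose M := (Num.sqrt (4 * pi * s0))^-1 ^+ n.
have cf : continuous f by exact: cslice.
have fM z : `|f z| <= M by exact: hb.
have M0 : 0 <= M by exact: P0.
have fN z : f z != 0 -> enorm (z - y) < 2 * r by rewrite mulf_eq0 negb_or => /andP[_ /phiN].
have f_ge0 z : 0 <= f z.
  have [->|fz] := eqVneq (f z) 0 => //.
  apply: mulr_ge0; last by have /andP[] := phi01 z.
  by apply: h0 => //; apply: rD; exact: ltW (fN z fz).
have fN' z : f z != 0 -> enorm z <= N by move=> /fN/bN.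
have e16 : 0 < e / 16 by rewrite divr_gt0.
have [d1 /andP[d10 _] d1P] := support_unif_continuous cf fN' e16.
have M1 : 0 < 4 * M + 1 by rewrite ltr_wpDl// mulr_ge0.
have [th0 th00 th0P] := @kernel_approx_rate R n _ _ d10 (divr_gt0 e16 M1).
(* The slice [f] is smoothed by the heat flow over a short time [th]. The kernels at the quadrature
   nodes thus start at [s0 - th] and are regular at [s0]. *)
pose th := th0 / 2; have th_gt0 : 0 < th by rewrite divr_gt0.
have approx z : f z - e / 8 <= integral_Rn (fun q => heat_kernel th q z * f q).
  have := kernel_approx (y := z) (t := th) (e := e / 16) (d := d1) th_gt0 cf fM (ltW e16) d10.
  move=> /(_ (fun q qz => d1P q z qz)); rewrite ler_norml => /andP[+ _].
  have /th0P : 0 < th < th0 by rewrite th_gt0 /th ltr_pdivrMr// ltr_pMr// ltr1n.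
  move=> /(ler_wpM2l (mulr_ge0 (ler0n _ 4) M0)).
  have : 4 * M * (e / 16 / (4 * M + 1)) <= e / 16.
    by rewrite mulrA ler_pdivrMr// mulrC ler_wpM2l ?(ltW e16)// lerDl.
  lra.
have [C C0 quad] := quadrature N0.
pose Pth := (Num.sqrt (4 * pi * th))^-1 ^+ n; pose L := 3 * r + 1.
pose Lip := Pth * (2 * L / (4 * th)).
have L0 : 0 < L by rewrite ltr_wpDl// mulr_ge0// ltW.
have Lip0 : 0 <= Lip by rewrite mulr_ge0 ?P0// divr_ge0 ?mulr_ge0 ?ltW.
(* The first entry bounds the pointwise quadrature error by [e / 8], the second keeps the total
   weight of the sum within twice [e / 8 / (P + 1)]. *)
pose w := Num.min (e / 8 / (C + 1)) (e / 8 / (P + 1) / (C + 1)).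
have C1 : 0 < C + 1 by rewrite ltr_wpDl.
have w0 : 0 < w by rewrite lt_min !divr_gt0.
have Cw1 : C * w <= e / 8.
  apply: (@le_trans _ _ ((C + 1) * (e / 8 / (C + 1)))).
    by rewrite ler_pM ?(ltW w0)// ?lerDl// ge_min lexx.
  by rewrite mulrC divfK// gt_eqF.
have Cw2 : C * w <= e / 8 / (P + 1).
  apply: (@le_trans _ _ ((C + 1) * (e / 8 / (P + 1) / (C + 1)))).
    by rewrite ler_pM ?(ltW w0)// ?lerDl// ge_min lexx orbT.
  by rewrite mulrC divfK// gt_eqF.
pose wf := Num.min w (w / 2 / (Pth + 1)).
have Pth1 : 0 < Pth + 1 by rewrite ltr_wpDl// P0.
have wf0 : 0 < wf by rewrite lt_min w0 !divr_gt0.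
have [d2 /andP[d20 d21] d2P] := support_unif_continuous cf fN' wf0.
pose d3 := Num.min d2 (w / 2 / (M * Lip + 1)).
have ML1 : 0 < M * Lip + 1 by rewrite ltr_wpDl// mulr_ge0.
have d30 : 0 < d3 <= 1.
  by rewrite lt_min d20 !divr_gt0//= ge_min d21.
have [d32 d3w] : d3 <= d2 /\ d3 <= w / 2 / (M * Lip + 1).
  by rewrite !ge_min !lexx orbT.
have [S [Spos SP]] := quad d3 d30.
have modf z z' : enorm (z - z') < d3 -> `|f z - f z'| <= wf.
  by move=> zz; apply: d2P; exact: lt_le_trans d32.
have sumf : \sum_(p <- S) p.1 * f p.2 <= 2 * (e / 8 / (P + 1)).
  have wfw : wf <= w by rewrite ge_min lexx.
  have := SP f w cf fN' (ltW w0) (fun z z' zz => le_trans (modf z z' zz) wfw).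
  rewrite ler_norml => /andP[+ _]; rewrite -/f in intl; move: intl Cw2; lrac.
have sumK z : enorm (z - y) <= r ->
    f z - e / 4 <= \sum_(p <- S) p.1 * (heat_kernel th p.2 z * f p.2).
  move=> zr; pose F q := heat_kernel th q z * f q.
  have cF : continuous F.
    move=> q; apply: (@cvgM _ _ _ (nbhs_filter q)); last exact: cf.
    by have [cK _] := gauss_dominated_kernel z th_gt0; exact: cK.
  have FN q : F q != 0 -> enorm q <= N by rewrite mulf_eq0 negb_or => /andP[_ /fN'].
  have Fw q q' : enorm (q - q') < d3 -> `|F q - F q'| <= w.
    move=> qq; have -> : F q - F q' = heat_kernel th q z * (f q - f q') +
       f q' * (heat_kernel th q z - heat_kernel th q' z) by rewrite /F; ring.
    rewrite (le_trans (ler_normD _ _))// [leRHS]splitr; apply: lerD.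
      rewrite normrM (ger0_norm (heat_kernel_ge0 _ _ _)).
      apply: (@le_trans _ _ ((Pth + 1) * (w / 2 / (Pth + 1)))); last first.
        by rewrite mulrC divfK// gt_eqF.
      apply: ler_pM; rewrite ?heat_kernel_ge0//.
        by rewrite (le_trans (heat_kernel_le _ _ th_gt0))// lerDl.
      by rewrite (le_trans (modf _ _ qq))// ge_min lexx orbT.
    have [->|fq'] := eqVneq (f q') 0.
      by rewrite mul0r normr0 divr_ge0// ltW.
    have q'y := fN _ fq'; have := d30 => /andP[d3_gt0 d3_le1].
    have q'z : enorm (q' - z) <= L.
      by have := enorm_triangle y q' z; rewrite (enormBC y z) /L; move: q'y zr; lrac.
    have qz : enorm (q - z) <= L.
      by have := enorm_triangle q' q z; have := enorm_triangle y q' z; rewrite (enormBC y z) /L; move: q'y zr qq d3_le1; lrac.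
    rewrite normrM.
    apply: (@le_trans _ _ (M * (Lip * d3))).
      apply: ler_pM => //; rewrite (le_trans (kernel_lipschitz th_gt0 qz q'z))//.
      by rewrite ler_wpM2l// ltW.
    apply: (@le_trans _ _ ((M * Lip + 1) * (w / 2 / (M * Lip + 1)))); last first.
      by rewrite mulrC divfK// gt_eqF.
    rewrite mulrA; apply: ler_pM => //; last by rewrite lerDl.
      by rewrite mulr_ge0.
    exact: ltW.
  have := SP F w cF FN (ltW w0) Fw; rewrite ler_norml => /andP[_].
  have := approx z; rewrite -/F; move: Cw1; lrac.
have pf p : p \in S -> 0 <= p.1 * f p.2.
  by move=> pS; apply: mulr_ge0; [exact: Spos|exact: f_ge0].
(* At time [s0] the constant [e / 2] absorbs the errors of smoothing and quadrature, [e / 8] each.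
   At time [t] the sum has decayed to at most [e / 4], because [t - s0 > t / 2]. *)
pose W t x := e / 2 + \sum_(p <- S) (p.1 * f p.2) * heat_kernel (t - (s0 - th)) x p.2.
have tau s : s0 <= s -> 0 < s - (s0 - th) by move: th_gt0; lrac.
have hW s z : s0 <= s -> heat_at W s z.
  move=> ss; apply: heat_atD; first exact: heat_at_cst.
  apply: heat_at_sum => p; apply: heat_atZ.
  by apply: (heat_at_shift (u := fun t x => heat_kernel t x p.2)); apply: heat_at_kernel; exact: tau.
have cW s z : s0 <= s -> jointly_continuous_at W s z.
  move=> ss; apply: continuousD; first exact: cst_continuous.
  apply: cvg_bigsum => p; apply: cvgM; first exact: cvg_cst.
  apply: (jointly_continuous_shift (u := fun t x => heat_kernel t x p.2)).
  by apply: jointly_continuous_kernel; exact: tau.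
have We2 s z : s0 <= s -> e / 2 <= W s z.
  move=> ss; rewrite lerDl big_seq; apply: sumr_ge0 => p pS.
  by apply: mulr_ge0; [exact: pf|exact: heat_kernel_ge0].
have Wt : W t x <= e.
  rewrite /W; apply: (@le_trans _ _ (e / 2 + P * (\sum_(p <- S) p.1 * f p.2))).
    rewrite lerD2l mulr_sumr big_seq [leRHS]big_seq; apply: ler_sum => p pS.
    rewrite mulrC; apply: ler_wpM2r; first exact: pf.
    have tt : 0 < t - (s0 - th) by apply: tau; move: s0t t0; lrac.
    apply: (le_trans (heat_kernel_le _ _ tt)).
    by apply: sqrt_inv_le; move: s0t t0 th_gt0; lrac.
  have : P * \sum_(p <- S) p.1 * f p.2 <= (P + 1) * (2 * (e / 8 / (P + 1))).
    apply: ler_pM => //; rewrite ?P0 ?lerDl//.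
    by rewrite big_seq; apply: sumr_ge0 => p pS; exact: pf.
  have -> : (P + 1) * (2 * (e / 8 / (P + 1))) = e / 4 by field; rewrite gt_eqF.
  by move: e0; lrac.
have Dr z : enorm (z - y) < r -> D z by move=> zr; apply: rD; move: zr r0; lrac.
pose Om := [set q : R * 'rV[R]_n | enorm (q.2 - y) < r].
have oOm : open Om.
  rewrite openE => -[s z] /= zr; apply/nbhs_pairP; exists (r - enorm (z - y)).
    by rewrite subr_gt0.
  by move=> s' z' _ zz; rewrite /Om /=; have := enorm_triangle z z' y; move: zz; lrac.
suff : h t x - W t x <= 0 by rewrite subr_le0 => /le_trans; apply.
apply: (max_principle (Om := Om) (w := fun t x => h t x - W t x) (s := s0) (t1 := t) oOm) => //.
- move=> s z /andP[ss _] zr; apply: continuousB; last by apply: cW; exact: ltW.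
  by apply: ch; [exact: lt_trans ss|exact: Dr].
- move=> s z /andP[ss _] zr _.
  have [|ft [g [hh' [jw E]]]] := heat_atB (hh s z _ (Dr z zr)) (hW s z (ltW ss)); first exact: lt_trans ss.
  by exists ft, g, hh'; split => //; rewrite E.
- move=> s z e1 e10 /andP[ss st] nin.
  have [zr|zr] := ltP (enorm (z - y)) r.
    have -> : s = s0.
      apply/eqP; rewrite eq_le ss andbT leNgt; apply/negP => ss'; exact: nin.
    have neg : h s0 z - W s0 z < e1.
      apply: (@le_lt_trans _ _ 0) => //; rewrite subr_le0 /W.
      have := sumK z (ltW zr); rewrite /f (phi1 z (ltW zr)) mulr1.
      have -> : \sum_(p <- S) p.1 * (heat_kernel th p.2 z * f p.2) =
          \sum_(p <- S) p.1 * f p.2 * heat_kernel (s0 - (s0 - th)) z p.2.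
        apply: eq_bigr => p _; rewrite subKr heat_kernelC; ring.
      by move: e0; lrac.
    have cc : jointly_continuous_at (fun t x => h t x - W t x) s0 z.
      by apply: continuousB; [apply: ch => //; exact: Dr|exact: cW].
    have /cvgr_lt /(_ _ neg) := cc.
    by apply: filterS => q /ltW.
  have [zr'|zr'] := ltP r (enorm (z - y)).
    apply/nbhs_pairP; exists (enorm (z - y) - r); first by rewrite subr_gt0.
    move=> s' z' _ zz _ z'r; exfalso; rewrite /Om /= in z'r.
    by have := enorm_triangle z' z y; rewrite (enormBC z z'); move: z'r zz; lrac.
  apply/nbhs_pairP; exists (r / 2); first by rewrite divr_gt0.
  move=> s' z' _ zz /andP[/= ss' st'] z'r; rewrite /Om /= in z'r.
  have h4 : h s' z' <= e / 4.
    apply: (@le_trans _ _ (heat_kernel s' z' y)).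
      by rewrite gerBl; apply: v0; [exact: lt_trans ss'|exact: Dr].
    apply: off; first by rewrite (lt_trans s00 ss') (le_lt_trans st' tt1).
    by have := enorm_triangle z' z y; rewrite (enormBC z z'); move: zr zz; lrac.
  have := We2 s' z' (ltW ss'); move: h4 e0 e10; lrac.
- move=> e1 e10; exists N => s z _ zr; rewrite ltNge => /negP[]; apply: bN.
  rewrite /Om /= in zr; move: zr r0; lrac.
by rewrite lexx andbT; move: s0t t0; lrac.
Qed.

End InitialTime.

(** * A subsolution on a moving ball *)

Section BridgeOperator.
Context {R : realType} {n : nat}.
Implicit Types (x y z : 'rV[R]_n) (t s : R) (f u v phi : R -> 'rV[R]_n -> R).

(* Writing a solution as the kernel times a function turns the heat operator
   into the generator of the Brownian bridge started at [y]. *)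
Lemma jet_bridge phi y t x pt g h : 0 < t -> jet phi t x pt g h ->
  exists ft gE hE, jet (fun t x => expR (logp y t x - phi t x)) t x ft gE hE /\
    [/\ gE = (fun i z => expR (logp y t z - phi t z) * (- ((z - y) 0 i / (2 * t)) - g i z)) &
    ft - \sum_i hE i = expR (logp y t x - phi t x) *
      (\sum_i h i - pt - (\sum_i (x - y) 0 i * g i x) / t - \sum_i g i x ^+ 2)].
Proof.
move=> t0 jp; have jE := jet_expR (jetB (jet_logp y x t0) jp).
do 3 eexists; split; first exact: jE.
split => //; rewrite -mulr_sumr -mulrBr; congr (_ * _).
rewrite big_split /= sumrB sumr_const card_ord.
have -> : \sum_(i < n) (- ((x - y) 0 i / (2 * t)) - g i x) ^+ 2 =
    dot (x - y) (x - y) / (4 * t ^+ 2) + (\sum_i (x - y) 0 i * g i x) / t + \sum_i g i x ^+ 2.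
  rewrite /dot !mulr_suml -!big_split /=; apply: eq_bigr => i _.
  by field; rewrite gt_eqF.
rewrite -mulr_natr; field; rewrite gt_eqF//.
Qed.

End BridgeOperator.

Section Profile.
Context {R : realType}.
Implicit Types (A K b r p : R).

(* [r] is the square root of the rescaled time and [p] the rescaled distance
   to the boundary. The term in [A] is a boundary layer of width [r] that
   compensates the curvature of the sphere, and the factor [expR (- K r)] pays
   for it. *)
Definition profile A K b r p :=
  b * expR (- (K * r)) * (p + A * (r * p ^+ 2 / (r + p))) / r ^+ 2.

Definition profile_p A K b r p :=
  b * expR (- (K * r)) * (1 + A * (r * p * (2 * r + p) / (r + p) ^+ 2)) / r ^+ 2.

Definition profile_pp A K b r p :=
  b * expR (- (K * r)) * (A * (2 * r ^+ 3 / (r + p) ^+ 3)) / r ^+ 2.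

Definition profile_r A K b r p :=
  b * expR (- (K * r)) * (- K * (p + A * (r * p ^+ 2 / (r + p))) +
    A * (p ^+ 3 / (r + p) ^+ 2) - 2 * (p + A * (r * p ^+ 2 / (r + p))) / r) / r ^+ 2.

Lemma is_derive_profile A K b (r p : R -> R) (x r' p' : R) :
  is_derive x 1 r r' -> is_derive x 1 p p' -> r x != 0 -> r x + p x != 0 ->
  is_derive x 1 (fun s => profile A K b (r s) (p s))
    (profile_r A K b (r x) (p x) * r' + profile_p A K b (r x) (p x) * p').
Proof.
move=> dr dp r0 rp0.
have drp := @is_deriveV R (r + p) x _ 1 rp0 (is_deriveD dr dp).
have r20 : (r * r) x != 0 by rewrite mulf_neq0.
have dr2 := @is_deriveV R (r * r) x _ 1 r20 (is_deriveM dr dr).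
have dE := is_derive_comp1 (is_deriveM (is_derive_cst (- K) x 1) dr) (is_derive_expR _).
have -> : (fun s => profile A K b (r s) (p s)) =
    cst b * (fun s => expR ((cst (- K) * r) s)) *
    (p + cst A * (r * (p * p) * (fun s => ((r + p) s)^-1))) * (fun s => ((r * r) s)^-1).
  by apply/funext => s; rewrite /profile !fctE mulNr !expr2.
have dF := is_deriveD dp (is_deriveM (is_derive_cst A x 1)
  (is_deriveM (is_deriveM dr (is_deriveM dp dp)) drp)).
apply: (is_derive_eq (is_deriveM (is_deriveM (is_deriveM (is_derive_cst b x 1) dE) dF) dr2)).
rewrite /GRing.scale /= !fctE /= mulNr /profile_r /profile_p.
by field; rewrite r0 rp0.
Qed.

Lemma is_derive_profile_p A K b r (p : R -> R) (x p' : R) :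
  is_derive x 1 p p' -> r != 0 -> r + p x != 0 ->
  is_derive x 1 (fun s => profile_p A K b r (p s)) (profile_pp A K b r (p x) * p').
Proof.
move=> dp r0 rp0.
have drp := @is_deriveV R (cst r + p) x _ 1 rp0 (is_deriveD (is_derive_cst r x 1) dp).
have -> : (fun s => profile_p A K b r (p s)) =
    cst (b * expR (- (K * r)) / r ^+ 2) *
    (cst 1 + cst (A * r) * (p * (cst (2 * r) + p) *
      ((fun s => ((cst r + p) s)^-1) * (fun s => ((cst r + p) s)^-1)))).
  by apply/funext => s; rewrite /profile_p !fctE !expr2 !invfM; ring.
have dn := is_deriveD (is_derive_cst (2 * r) x 1) dp.
have dF := is_deriveD (is_derive_cst (1 : R) x 1) (is_deriveM (is_derive_cst (A * r) x 1)
  (is_deriveM (is_deriveM dp dn) (is_deriveM drp drp))).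
apply: (is_derive_eq (is_deriveM (is_derive_cst (b * expR (- (K * r)) / r ^+ 2) x 1) dF)).
rewrite /GRing.scale /= !fctE /= /profile_pp.
by field; rewrite r0 rp0.
Qed.

(** The subsolution inequality reduced to two scalars: [m] is the dimension, [q] the value of the
    bump at the pole, and [1 - 2 * p] the squared distance to the centre in units of the radius. *)
Lemma profile_ineq (m A K b r r1 p q : R) : 0 <= m -> A = m / 2 ->
  2 * (7 * A + (2 * m * A + 4 * A) * r1) <= K -> 0 < r <= r1 -> 0 <= p <= 2^-1 ->
  0 <= q -> b = q / (1 + A) ->
  profile_r A K b r p / (2 * r) - profile_p A K b r p * (q - p) / r ^+ 2 +
    profile_p A K b r p ^+ 2 * (1 - 2 * p) <=
  profile_pp A K b r p * (1 - 2 * p) - m * profile_p A K b r p.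
Proof.
move=> m0 AE hK /andP[r0 rr1] /andP[p0 p1] q0 bE.
have A0 : 0 <= A by rewrite AE divr_ge0.
have rp0 : 0 < r + p by rewrite ltr_wpDr.
pose M1 := r * p * (2 * r + p) / (r + p) ^+ 2; pose M2 := 2 * r ^+ 3 / (r + p) ^+ 3.
pose M := r * p ^+ 2 / (r + p); pose e := expR (- (K * r)).
have K0 : 0 <= K.
  by apply: le_trans hK; rewrite mulr_ge0// addr_ge0 ?mulr_ge0 ?addr_ge0 ?mulr_ge0// (le_trans (ltW r0)).
have e01 : 0 < e <= 1.
  by rewrite expR_gt0 -[leRHS]expR0 ler_expR oppr_le0 mulr_ge0// ltW.
have rp1 : 0 < (r + p) ^+ 2 by rewrite exprn_gt0.
have M1r : M1 <= 2 * r by rewrite ler_pdivrMr//; nra.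
have M1p : M1 <= 2 * p by rewrite ler_pdivrMr//; nra.
have M10 : 0 <= M1 by rewrite divr_ge0 ?exprn_ge0 ?mulr_ge0 ?addr_ge0 ?mulr_ge0// ltW.
have M_ge0 : 0 <= M by rewrite divr_ge0 ?mulr_ge0 ?exprn_ge0// ltW.
have M20 : 0 <= M2 by rewrite divr_ge0 ?mulr_ge0 ?exprn_ge0// ltW.
have M22 : M2 <= 2.
  rewrite ler_pdivrMr ?exprn_gt0// ler_wpM2l// lerXn2r ?nnegrE ?(ltW r0) ?(ltW rp0)//.
  by rewrite lerDl.
have M23 : 2 * (r - 3 * p) <= r * M2.
  rewrite mulrA ler_pdivlMr ?exprn_gt0//.
  rewrite -subr_ge0.
  have -> : r * (2 * r ^+ 3) - 2 * (r - 3 * p) * (r + p) ^+ 3 =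
    2 * (p ^+ 2 * (6 * r ^+ 2 + 8 * r * p + 3 * p ^+ 2)) by ring.
  by rewrite !mulr_ge0 ?exprn_ge0// !addr_ge0// !mulr_ge0 ?exprn_ge0// ltW.
have A1 : 0 < 1 + A by rewrite ltr_pwDl.
have b0 : 0 <= b by rewrite bE divr_ge0// ltW.
have [e0 e1] : 0 < e /\ e <= 1 by case/andP: e01.
pose c := b * e / r ^+ 2; have c0 : 0 <= c by rewrite divr_ge0 ?mulr_ge0 ?exprn_ge0// ltW.
pose q1 := 1 + A * M1; pose F := p + A * M.
have q11 : q1 <= 1 + A.
  by rewrite lerD2l ler_piMr// (le_trans M1p)// -ler_pdivlMl// mulr1.
have q10 : 0 <= q1 by rewrite addr_ge0// mulr_ge0.
have cq : c * q1 <= q / r ^+ 2.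
  rewrite /c mulrAC ler_wpM2r ?invr_ge0 ?exprn_ge0 ?(ltW r0)//.
  apply: (@le_trans _ _ (b * 1 * (1 + A))); last by rewrite mulr1 bE divfK// gt_eqF.
  by rewrite ler_pM// ?mulr_ge0 ?(ltW e0)// ler_wpM2l.
have Fp : p <= F by rewrite lerDl mulr_ge0.
have ppE : profile_p A K b r p = c * q1 by rewrite /profile_p -/e -/M1 -/q1 /c mulrAC.
have pppE : profile_pp A K b r p = c * (A * M2) by rewrite /profile_pp -/e -/M2 /c mulrAC.
have prE : profile_r A K b r p / (2 * r) =
    c * (- (K * F) / (2 * r) + A * p * M1 / (2 * r ^+ 2) - q1 * p / r ^+ 2).
  rewrite /profile_r -/e /c /F /q1 /M /M1; field.
  by rewrite !gt_eqF.
rewrite prE ppE pppE.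
(* The choice [b = q / (1 + A)] gives [c * q1 <= q / r ^+ 2], so the drift towards the pole absorbs
   the square of the gradient. *)
have h1 : (c * q1) ^+ 2 * (1 - 2 * p) <= c * q1 * (q / r ^+ 2).
  rewrite expr2 -mulrA; apply: ler_wpM2l; first by rewrite mulr_ge0.
  by apply: le_trans cq; apply: ler_piMr; [exact: mulr_ge0|rewrite gerBl mulr_ge0].
have r2 : 0 < 2 * r by rewrite mulr_gt0.
(* At [p = 0] the layer contributes [2 * A] and the curvature [m], which cancel since [A = m / 2].
   The remaining terms carry a factor [p], and [K * F / (2 * r)] pays for them because [F >= p]. *)
have h2 : - (K * F) / (2 * r) + A * p * M1 / (2 * r ^+ 2) <= A * M2 * (1 - 2 * p) - m * q1.
  have e3 : A * p * M1 / (2 * r ^+ 2) <= A * p / r.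
    rewrite ler_pdivrMr ?mulr_gt0 ?exprn_gt0// -[leRHS](_ : A * p * (2 * r) = _).
      by rewrite ler_wpM2l// mulr_ge0.
    by field; rewrite gt_eqF.
  have e4 : - (K * F) / (2 * r) <= - (K * p) / (2 * r).
    by rewrite ler_pM2r ?invr_gt0// lerN2 ler_wpM2l.
  have e5 : A * (2 * (r - 3 * p) - 4 * p * r) <= A * M2 * (1 - 2 * p) * r.
    have -> : A * M2 * (1 - 2 * p) * r = A * (r * M2 - 2 * p * r * M2) by ring.
    rewrite ler_wpM2l// lerB// -[leRHS](_ : 2 * p * r * 2 = _); last by ring.
    by rewrite ler_wpM2l// !mulr_ge0// ltW.
  have e6 : m * q1 <= m * (1 + 2 * A * p).
    by rewrite ler_wpM2l// lerD2l; move: (ler_wpM2l A0 M1p); lrac.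
  have e7 : A * p + m * (1 + 2 * A * p) * r <= A * (2 * (r - 3 * p) - 4 * p * r) + K * p / 2.
    have kp : (7 * A + (2 * m * A + 4 * A) * r) * p <= K * p / 2.
      rewrite [leRHS]mulrAC; apply: ler_wpM2r => //; rewrite ler_pdivlMr// mulrC.
      apply: le_trans hK; rewrite ler_wpM2l// lerD2l ler_wpM2l//.
      by rewrite addr_ge0// !mulr_ge0.
    have mA : m = 2 * A by rewrite AE; field.
    by move: kp; rewrite mA; lra.
  have key : (A * p / r + - (K * p) / (2 * r)) * r <= (A * M2 * (1 - 2 * p) - m * (1 + 2 * A * p)) * r.
    have -> : (A * p / r + - (K * p) / (2 * r)) * r = A * p - K * p / 2 by field; rewrite gt_eqF.
    by rewrite mulrBl; move: e5 e7; lrac.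
  rewrite ler_pM2r// in key.
  by move: e3 e4 e6 key; lrac.
have h3 : c * (- (K * F) / (2 * r) + A * p * M1 / (2 * r ^+ 2)) <= c * (A * M2 * (1 - 2 * p) - m * q1).
  by rewrite ler_wpM2l.
have -> : c * q1 * (q - p) / r ^+ 2 = c * q1 * (q / r ^+ 2) - c * (q1 * p / r ^+ 2) by field; rewrite gt_eqF.
by move: h1 h3; lrac.
Qed.

End Profile.

Lemma min_one_le_expR (R : realType) (f : R) : 0 <= f ->
  Num.min 1 f / 2 <= 1 - expR (- f).
Proof.
move=> f0; have f1 : 0 < 1 + f by rewrite ltr_pwDl.
have e1 : expR (- f) <= (1 + f)^-1.
  by rewrite expRN lef_pV2 ?posrE ?expR_gt0// expR_ge1Dx.
apply: (@le_trans _ _ (1 - (1 + f)^-1)); last by rewrite lerD2l lerN2.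
have -> : 1 - (1 + f)^-1 = f / (1 + f) by field; rewrite gt_eqF.
rewrite ler_pdivrMr// mulrAC ler_pdivlMr//.
have [m1 m2] : Num.min 1 f <= 1 /\ Num.min 1 f <= f by rewrite !ge_min !lexx orbT.
by case: (leP 1 f) => h; nra.
Qed.

Lemma layer_bounds (R : realType) (r p : R) : 0 < r -> 0 < p <= 2^-1 ->
  0 <= r * p ^+ 2 / (r + p) <= p.
Proof.
move=> r0 /andP[p0 p1]; have rp : 0 < r + p by rewrite addr_gt0.
apply/andP; split.
  by apply: divr_ge0; [rewrite mulr_ge0 ?exprn_ge0// ltW|rewrite ltW].
rewrite ler_pdivrMr// expr2 mulrA mulrC; apply: ler_wpM2l; first exact: ltW.
apply: (@le_trans _ _ r); last by rewrite lerDl ltW.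
by rewrite ler_piMr ?(ltW r0)// (le_trans p1)// invf_le1// ler1n.
Qed.

Section MovingBall.
Context {R : realType} {n : nat}.
Variables (kap : R) (o u : 'rV[R]_n).
Hypothesis kap0 : 0 < kap.
Implicit Types (x y z : 'rV[R]_n) (t s A K b : R).

Definition center t := o + t *: u.

(** A smooth substitute for the relative depth in the ball: inside, it lies between one half of
    [(kap - |x - center t|) / kap] and the whole. *)
Definition bump t x := (kap ^+ 2 - dot (x - center t) (x - center t)) / (2 * kap ^+ 2).

Definition ball_profile A K b t x := profile A K b (Num.sqrt t / kap) (bump t x).

Lemma is_derive_bump_x t x v :
  is_derive x v (bump t) (- (dot (x - center t) v / kap ^+ 2)).
Proof.
have -> : bump t = cst (2 * kap ^+ 2)^-1 * (cst (kap ^+ 2) - (fun z => dot (z - center t) (z - center t))).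
  by apply/funext => z; rewrite /bump [LHS]mulrC.
have d := is_derive_dist2 x v (center t).
apply: (is_derive_eq (is_deriveM (is_derive_cst (2 * kap ^+ 2)^-1 x v)
  (is_deriveB (is_derive_cst (kap ^+ 2) x v) d))).
by rewrite /GRing.scale /=; field; rewrite gt_eqF.
Qed.

Lemma is_derive_bump_t t x :
  is_derive t 1 (bump ^~ x) (dot (x - center t) u / kap ^+ 2).
Proof.
have E s : x - center s = s *: (- u) + (x - o).
  by rewrite /center scalerN opprD addrA addrC.
have d : is_derive t 1 (fun s => dot (x - center s) (x - center s)) (- (2 * dot (x - center t) u)).
  have d1 := is_derive_dist2 (t *: (- u) + (x - o)) (- u) 0.
  have := is_derive_line d1; rewrite subr0 -E dotNr mulrN.
  by under eq_fun do rewrite subr0 -E.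
have -> : bump ^~ x = cst (2 * kap ^+ 2)^-1 * (cst (kap ^+ 2) - (fun s => dot (x - center s) (x - center s))).
  by apply/funext => z; rewrite /bump [LHS]mulrC.
apply: (is_derive_eq (is_deriveM (is_derive_cst (2 * kap ^+ 2)^-1 t 1)
  (is_deriveB (is_derive_cst (kap ^+ 2) t 1) d))).
by rewrite /GRing.scale /=; field; rewrite gt_eqF.
Qed.

Lemma bump_bounds t x : enorm (x - center t) < kap -> 0 < bump t x <= 2^-1.
Proof.
rewrite lt_enorm ?(ltW kap0)// => h; have k2 : 0 < 2 * kap ^+ 2 by rewrite mulr_gt0 ?exprn_gt0.
by rewrite divr_gt0 ?subr_gt0//= ler_pdivrMr// mulrA mulVf ?mul1r ?gerBl ?dotxx_ge0.
Qed.

Lemma bump_depth t x : enorm (x - center t) < kap ->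
  (kap - enorm (x - center t)) / (2 * kap) <= bump t x.
Proof.
move=> h; rewrite /bump -enorm_sqr.
have -> : (kap ^+ 2 - enorm (x - center t) ^+ 2) / (2 * kap ^+ 2) =
  (kap - enorm (x - center t)) / (2 * kap) * (1 + enorm (x - center t) / kap).
  by field; rewrite gt_eqF.
rewrite ler_peMr// ?lerDl ?divr_ge0 ?enorm_ge0 ?(ltW kap0)//.
  by rewrite subr_ge0 ltW.
by rewrite mulr_ge0// ltW.
Qed.

Lemma jointly_continuous_bump t x : jointly_continuous_at bump t x.
Proof.
apply: continuousM; last exact: cst_continuous.
apply: continuousB; first exact: cst_continuous.
have -> : (fun q : R * 'rV[R]_n => dot (q.2 - center q.1) (q.2 - center q.1)) =
    (fun z : 'rV[R]_n => dot (z - 0) (z - 0)) \o (fun q => q.2 - center q.1).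
  by apply/funext => q /=; rewrite !subr0.
apply: continuous_comp.
  apply: continuousB; first exact: cvg_snd.
  apply: continuousD; first exact: cst_continuous.
  by apply: (@cvgZ _ _ _ _ (nbhs_filter (t, x))); [exact: cvg_fst|exact: cvg_cst].
exact: continuous_dist2.
Qed.

Lemma jointly_continuous_ball_profile A K b t x : 0 < t ->
  enorm (x - center t) < kap -> jointly_continuous_at (ball_profile A K b) t x.
Proof.
move=> t0 /bump_bounds/andP[p0 _]; have cp := @jointly_continuous_bump t x.
have st : 0 < Num.sqrt t / kap by rewrite divr_gt0// sqrtr_gt0.
have cr : jointly_continuous_at (fun t (_ : 'rV[R]_n) => Num.sqrt t / kap) t x.
  apply: (@jointly_continuous_time _ _ (fun t => Num.sqrt t / kap)).
  by apply: continuousM; [exact: sqrt_continuous|exact: cst_continuous].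
apply: continuousM; last first.
  apply: continuousV; first by rewrite expf_neq0// gt_eqF.
  exact: (continuousM cr cr).
apply: continuousM.
  apply: continuousM; first exact: cst_continuous.
  apply: continuous_comp; last exact: continuous_expR.
  by apply: continuousN; apply: continuousM => //; exact: cst_continuous.
apply: continuousD => //; apply: continuousM; first exact: cst_continuous.
apply: continuousM; last first.
  by apply: continuousV; [rewrite gt_eqF// addr_gt0|apply: continuousD].
by apply: continuousM => //; exact: (continuousM cp cp).
Qed.

Lemma jet_ball_profile A K b t x : 0 < t -> enorm (x - center t) < kap ->
  jet (ball_profile A K b) t x
    ((profile_r A K b (Num.sqrt t / kap) (bump t x) / (2 * (Num.sqrt t / kap)) +
      profile_p A K b (Num.sqrt t / kap) (bump t x) * dot (x - center t) u) / kap ^+ 2)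
    (fun i z => profile_p A K b (Num.sqrt t / kap) (bump t z) * - ((z - center t) 0 i / kap ^+ 2))
    (fun i => profile_pp A K b (Num.sqrt t / kap) (bump t x) * ((x - center t) 0 i / kap ^+ 2) ^+ 2
      - profile_p A K b (Num.sqrt t / kap) (bump t x) / kap ^+ 2).
Proof.
move=> t0 /bump_bounds/andP[p0 _]; set r := Num.sqrt t / kap.
have st0 : 0 < Num.sqrt t by rewrite sqrtr_gt0.
have r0 : 0 < r by rewrite divr_gt0.
have rn : r != 0 by rewrite gt_eqF.
have near_p : \forall z \near x, r + bump t z != 0.
  have cp : {for x, continuous (bump t)}.
    apply: (@cvgM _ _ _ (nbhs_filter x)); last exact: cvg_cst.
    by apply: (@cvgB _ _ _ _ (nbhs_filter x)); [exact: cvg_cst|exact: continuous_dist2].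
  have /cvgr_gt /(_ _ p0) := cp; apply: filterS => z pz.
  by rewrite gt_eqF// addr_gt0.
have dx z v : r + bump t z != 0 ->
    is_derive z v (ball_profile A K b t) (profile_p A K b r (bump t z) * - (dot (z - center t) v / kap ^+ 2)).
  move=> pz; apply: is_derive_lineP.
  have dl : is_derive (0 : R) 1 (fun s => bump t (s *: v + z)) (- (dot (z - center t) v / kap ^+ 2)).
    by apply: is_derive_line; rewrite scale0r add0r; exact: is_derive_bump_x.
  have := @is_derive_profile R A K b (cst r) _ 0 0 _ (is_derive_cst r (0 : R) 1) dl rn.
  by rewrite scale0r add0r => /(_ pz) d; apply: (is_derive_eq d); rewrite mulr0 add0r.
split.
- have ds : is_derive t 1 (fun s => Num.sqrt s / kap) ((2 * Num.sqrt t)^-1 / kap).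
    have := is_deriveM (is_derive1_sqrt t0) (is_derive_cst kap^-1 t 1).
    by move=> d; apply: (is_derive_eq d); rewrite /GRing.scale /= mulr0 add0r mulrC.
  have := @is_derive_profile R A K b _ _ t _ _ ds (is_derive_bump_t t x) rn.
  have nz : Num.sqrt t / kap + bump t x != 0 by rewrite gt_eqF// addr_gt0.
  move=> /(_ nz) d; rewrite /ball_profile; apply: (is_derive_eq d).
  by rewrite -/r /r; field; rewrite !gt_eqF.
- by move=> i; apply: filterS near_p => z pz; apply: (is_derive_eq (dx z (ei i) pz)); rewrite dot_ei.
- move=> i; have dP : is_derive x (ei i) (fun z => profile_p A K b r (bump t z))
      (profile_pp A K b r (bump t x) * - (dot (x - center t) (ei i) / kap ^+ 2)).
    apply: is_derive_lineP.
    have dl : is_derive (0 : R) 1 (fun s => bump t (s *: ei i + x)) (- (dot (x - center t) (ei i) / kap ^+ 2)).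
      by apply: is_derive_line; rewrite scale0r add0r; exact: is_derive_bump_x.
    have := @is_derive_profile_p R A K b r _ 0 _ dl rn.
    have nz : r + bump t x != 0 by rewrite gt_eqF// addr_gt0.
    by rewrite scale0r add0r => /(_ nz).
  have dc : is_derive x (ei i) (fun z : 'rV[R]_n => - ((z - center t) 0 i / kap ^+ 2)) (- (kap ^+ 2)^-1).
    have -> : (fun z : 'rV[R]_n => - ((z - center t) 0 i / kap ^+ 2)) =
      cst (- (kap ^+ 2)^-1) * ((fun z : 'rV[R]_n => z 0 i) - cst (center t 0 i)).
      by apply/funext => z; rewrite !fctE /= !mxE; ring.
    have := is_derive_coord x i i; rewrite eqxx => d.
    apply: (is_derive_eq (is_deriveM (is_derive_cst _ x (ei i)) (is_deriveB d (is_derive_cst _ x (ei i))))).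
    by rewrite /GRing.scale /=; ring.
  apply: (is_derive_eq (is_deriveM dP dc)); rewrite dot_ei /GRing.scale /=; ring.
Qed.

Lemma ball_barrier y t x S A K q : 0 < t <= S * kap ^+ 2 ->
  enorm (x - center t) < kap ->
  A = n%:R / 2 -> 2 * (7 * A + (2 * n%:R * A + 4 * A) * Num.sqrt S) <= K ->
  q = (kap ^+ 2 - dot (y - o) (y - o)) / (2 * kap ^+ 2) -> 0 <= q ->
  exists ft g h, jet (fun t x => expR (logp y t x) -
    expR (logp y t x - ball_profile A K (q / (1 + A)) t x)) t x ft g h /\ ft <= \sum_i h i.
Proof.
move=> /andP[t0 tS] xk AE hK qE q0; set b := q / (1 + A).
have [ft [g [h [j [gE E]]]]] := jet_bridge y t0 (jet_ball_profile A K b t0 xk).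
have jk := jet_expR (jet_logp y x t0).
do 3 eexists; split; first exact: jetB jk j.
rewrite sumrB.
have -> : expR (logp y t x) * (- (n%:R / (2 * t)) + dot (x - y) (x - y) / (4 * t ^+ 2)) =
  \sum_i expR (logp y t x) * (- (2 * t)^-1 + (- ((x - y) 0 i / (2 * t))) ^+ 2).
  rewrite -mulr_sumr; congr (_ * _); rewrite big_split /= sumr_const card_ord.
  rewrite -mulr_natr /dot mulr_suml.
  have -> : \sum_(i < n) (x - y) 0 i * (x - y) 0 i / (4 * t ^+ 2) =
     \sum_(i < n) (- ((x - y) 0 i / (2 * t))) ^+ 2.
    by apply: eq_bigr => i _; field; rewrite gt_eqF.
  by congr (_ + _); field; rewrite gt_eqF.
rewrite lerD2l lerN2 -subr_ge0 E mulr_ge0 ?expR_ge0//.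
set r := Num.sqrt t / kap; set P := profile_p A K b r (bump t x).
set PP := profile_pp A K b r (bump t x); set PR := profile_r A K b r (bump t x).
have /andP[p0 p1] := bump_bounds xk; set p := bump t x in p0 p1 P PP PR *.
have k2 : 0 < kap ^+ 2 by rewrite exprn_gt0.
have S0 : 0 <= S by rewrite -(pmulr_lge0 _ k2) (le_trans _ tS)// ltW.
have r0 : 0 < r by rewrite divr_gt0// sqrtr_gt0.
have r2 : r ^+ 2 = t / kap ^+ 2 by rewrite expr_div_n sqr_sqrtr// ltW.
have rS : r <= Num.sqrt S.
  by rewrite ler_pdivrMr// -(ger0_norm (ltW kap0)) -sqrtr_sqr -sqrtrM// ler_wsqrtr.
have ZZ : dot (x - center t) (x - center t) = kap ^+ 2 * (1 - 2 * p).
  by rewrite /p /bump; field; rewrite gt_eqF.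
have -> : \sum_i (PP * ((x - center t) 0 i / kap ^+ 2) ^+ 2 - P / kap ^+ 2) =
    (PP * (1 - 2 * p) - n%:R * P) / kap ^+ 2.
  rewrite sumrB sumr_const card_ord -mulr_natl.
  have -> : \sum_i PP * ((x - center t) 0 i / kap ^+ 2) ^+ 2 =
      PP / kap ^+ 4 * dot (x - center t) (x - center t).
    by rewrite /dot mulr_sumr; apply: eq_bigr => i _; field; rewrite gt_eqF.
  by rewrite ZZ; field; rewrite gt_eqF.
have -> : \sum_i (x - y) 0 i * (P * - ((x - center t) 0 i / kap ^+ 2)) =
    - (P * dot (x - y) (x - center t) / kap ^+ 2).
  rewrite /dot mulr_sumr mulr_suml -sumrN; apply: eq_bigr => i _; field; rewrite gt_eqF//.
have -> : \sum_i (P * - ((x - center t) 0 i / kap ^+ 2)) ^+ 2 = P ^+ 2 * (1 - 2 * p) / kap ^+ 2.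
  have -> : P ^+ 2 * (1 - 2 * p) / kap ^+ 2 = P ^+ 2 / kap ^+ 4 * dot (x - center t) (x - center t).
    by rewrite ZZ; field; rewrite gt_eqF.
  by rewrite /dot mulr_sumr; apply: eq_bigr => i _; field; rewrite gt_eqF.
have A0 : 0 <= A by rewrite AE divr_ge0.
have P0 : 0 <= P.
  have b0 : 0 <= b by rewrite divr_ge0// addr_ge0.
  have rp := addr_ge0 (ltW r0) (ltW p0).
  apply: divr_ge0; last by rewrite exprn_ge0// ltW.
  apply: mulr_ge0; first by rewrite mulr_ge0// expR_ge0.
  apply: addr_ge0 => //; apply: mulr_ge0 => //; apply: divr_ge0; last exact: exprn_ge0.
  apply: mulr_ge0; first by rewrite mulr_ge0// ltW.
  by apply: addr_ge0; [rewrite mulr_ge0// ltW|rewrite ltW].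
(* Expand the square of [(x - center t) - (y - o)]. The term with [u] is exactly the one in the time
   derivative of the bump, so the velocity drops out of the final inequality. *)
have cross : kap ^+ 2 * (q - p) + t * dot (x - center t) u <= dot (x - y) (x - center t).
  have -> : x - y = (x - center t) - (y - o) + t *: u by rewrite /center; vring.
  rewrite (dotDl _ (t *: u)) dotZl (dotC u) (dotBl _ (y - o)) lerD2r.
  have := dotxx_ge0 ((x - center t) - (y - o)); rewrite dotBB ZZ.
  have -> : dot (y - o) (y - o) = kap ^+ 2 * (1 - 2 * q).
    by rewrite qE; field; rewrite gt_eqF.
  by rewrite (dotC (y - o)); lrac.
have := @profile_ineq R n%:R A K b r (Num.sqrt S) p q (ler0n _ _) AE hK _ _ q0 erefl.
rewrite r0 rS (ltW p0) p1 => /(_ isT isT); rewrite -/P -/PP -/PR => ineq.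
have -> : (PP * (1 - 2 * p) - n%:R * P) / kap ^+ 2 - (PR / (2 * r) + P * dot (x - center t) u) / kap ^+ 2 -
   - (P * dot (x - y) (x - center t) / kap ^+ 2) / t - P ^+ 2 * (1 - 2 * p) / kap ^+ 2 =
   ((PP * (1 - 2 * p) - n%:R * P) - (PR / (2 * r) - P * (q - p) / r ^+ 2 + P ^+ 2 * (1 - 2 * p))) / kap ^+ 2
   + P * (dot (x - y) (x - center t) - (kap ^+ 2 * (q - p) + t * dot (x - center t) u)) / (kap ^+ 2 * t).
  rewrite r2; field; rewrite !gt_eqF//.
apply: addr_ge0.
  by apply: divr_ge0; [rewrite subr_ge0|exact: ltW].
apply: divr_ge0; last by apply: mulr_ge0; exact: ltW.
by apply: mulr_ge0 => //; rewrite subr_ge0.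
Qed.

End MovingBall.

Section Stage.
Context {R : realType} {n : nat}.
Implicit Types (o u x y z : 'rV[R]_n) (kap s t : R) (v : R -> 'rV[R]_n -> R).

Lemma ball_profile_le kap o u A K b t x : 0 < kap -> 0 < t -> 0 <= A -> 0 <= K -> 0 <= b ->
  enorm (x - center o u t) < kap ->
  ball_profile kap o u A K b t x <= b * (1 + A) * kap ^+ 2 * (bump kap o u t x / t).
Proof.
move=> k0 t0 A0 K0 b0 xk; have /andP[p0 p1] := bump_bounds k0 xk; rewrite /ball_profile.
set p := bump _ _ _ _ _ in p0 p1 *; set r := Num.sqrt t / kap.
have r0 : 0 < r by rewrite divr_gt0// sqrtr_gt0.
have /andP[l0 l1] : 0 <= r * p ^+ 2 / (r + p) <= p by apply: layer_bounds => //; rewrite p0.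
have r2 : t = r ^+ 2 * kap ^+ 2 by rewrite expr_div_n sqr_sqrtr ?(ltW t0)// divfK// gt_eqF// exprn_gt0.
have -> : b * (1 + A) * kap ^+ 2 * (p / t) = b * 1 * (p + A * p) / r ^+ 2.
  by rewrite r2; field; rewrite !gt_eqF.
rewrite ler_pM2r ?invr_gt0 ?exprn_gt0// ler_pM//.
- by rewrite mulr_ge0// expR_ge0.
- by rewrite addr_ge0 ?(ltW p0)// mulr_ge0.
- by rewrite ler_wpM2l// -[leRHS]expR0 ler_expR oppr_le0 mulr_ge0// ltW.
- by rewrite lerD2l ler_wpM2l.
Qed.

Lemma ball_profile_ge kap o u A K b S t x : 0 < kap -> 0 < t <= S * kap ^+ 2 -> 0 <= A -> 0 <= K -> 0 <= b ->
  enorm (x - center o u t) < kap ->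
  b * expR (- (K * Num.sqrt S)) * kap ^+ 2 * (bump kap o u t x / t) <= ball_profile kap o u A K b t x.
Proof.
move=> k0 /andP[t0 tS] A0 K0 b0 xk; have /andP[p0 p1] := bump_bounds k0 xk; rewrite /ball_profile.
set p := bump _ _ _ _ _ in p0 p1 *; set r := Num.sqrt t / kap.
have r0 : 0 < r by rewrite divr_gt0// sqrtr_gt0.
have /andP[l0 l1] : 0 <= r * p ^+ 2 / (r + p) <= p by apply: layer_bounds => //; rewrite p0.
have r2 : t = r ^+ 2 * kap ^+ 2 by rewrite expr_div_n sqr_sqrtr ?(ltW t0)// divfK// gt_eqF// exprn_gt0.
have k2 : 0 < kap ^+ 2 by rewrite exprn_gt0.
have S0 : 0 <= S by rewrite -(pmulr_lge0 _ k2) (le_trans _ tS)// ltW.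
have rS : r <= Num.sqrt S.
  by rewrite ler_pdivrMr// -(ger0_norm (ltW k0)) -sqrtr_sqr -sqrtrM// ler_wsqrtr.
set E := expR (- (K * Num.sqrt S)).
have -> : b * E * kap ^+ 2 * (p / t) = b * E * p / r ^+ 2.
  by rewrite r2; field; rewrite !gt_eqF.
rewrite ler_pM2r ?invr_gt0 ?exprn_gt0// ler_pM ?(ltW p0)//.
- by rewrite mulr_ge0// expR_ge0.
- by rewrite ler_wpM2l// ler_expR lerN2 ler_wpM2l.
- by rewrite lerDl mulr_ge0.
Qed.

(** The kernel has its pole at time 0, while the ball may start later, at time [s]; [o] is its
    centre extrapolated back to time 0. The constant does not depend on the velocity [u]. *)
Definition moving_ball_bound (C S : R) := forall kap o u y s t1 v,
  0 < kap -> enorm (y - o) < kap -> 0 <= s < t1 -> t1 <= S * kap ^+ 2 ->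
  (forall t x, s < t <= t1 -> enorm (x - center o u t) < kap ->
    [/\ 0 <= v t x, jointly_continuous_at v t x & heat_at v t x]) ->
  (forall x e, 0 < e -> enorm (x - center o u s) <= kap ->
    \forall q \near (s, x), s < q.1 -> enorm (q.2 - center o u q.1) < kap ->
      heat_kernel q.1 q.2 y - v q.1 q.2 <= e) ->
  forall x, enorm (x - center o u t1) < kap ->
  C * Num.min 1 ((kap - enorm (y - o)) * (kap - enorm (x - center o u t1)) / t1) *
    heat_kernel t1 x y <= v t1 x.

Lemma ball_lower_bound (S : R) : 0 <= S -> exists2 C : R, 0 < C & moving_ball_bound C S.
Proof.
move=> S0; pose A : R := n%:R / 2.
pose K := 2 * (7 * A + (2 * n%:R * A + 4 * A) * Num.sqrt S).
have A0 : 0 <= A by rewrite divr_ge0.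
have K0 : 0 <= K by rewrite mulr_ge0// addr_ge0 ?mulr_ge0 ?addr_ge0 ?mulr_ge0 ?sqrtr_ge0.
(* The 4 comes from [bump_depth] at both ends, [1 + A] from [b], and the exponential from the decay
   of the profile for [r <= Num.sqrt S]. *)
pose C0 := expR (- (K * Num.sqrt S)) / (4 * (1 + A)).
have A1 : 0 < 1 + A by rewrite ltr_pwDl.
have C00 : 0 < C0 by rewrite divr_gt0 ?expR_gt0// mulr_gt0.
have C01 : C0 <= 1.
  rewrite ler_pdivrMr ?mulr_gt0// mul1r (@le_trans _ _ 1)//; last by lra.
  by rewrite -[leRHS]expR0 ler_expR oppr_le0 mulr_ge0// sqrtr_ge0.
exists (C0 / 2); first by rewrite divr_gt0.
move=> kap o u y s t1 v k0 yk /andP[s0 st1] t1S hv hini x xk.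
have k2 : 0 < kap ^+ 2 by rewrite exprn_gt0.
have t10 : 0 < t1 by apply: le_lt_trans st1.
pose q := (kap ^+ 2 - dot (y - o) (y - o)) / (2 * kap ^+ 2).
have yk' : enorm (y - center o u 0) < kap by rewrite /center scale0r addr0.
have qE : bump kap o u 0 y = q by rewrite /bump /center scale0r addr0.
have q0 : 0 <= q by rewrite -qE; have /andP[/ltW] := bump_bounds k0 yk'.
pose b := q / (1 + A); have b0 : 0 <= b by rewrite divr_ge0// ltW.
pose phi := ball_profile kap o u A K b.
pose U t x := expR (logp y t x) - expR (logp y t x - phi t x).
pose w t x := U t x - v t x.
pose Om := [set p : R * 'rV[R]_n | 0 < p.1 /\ enorm (p.2 - center o u p.1) < kap].
have cc (p : R * 'rV[R]_n) : {for p, continuous (fun p : R * 'rV[R]_n => enorm (p.2 - center o u p.1))}.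
  apply: (@continuous_comp _ _ _ (fun p : R * 'rV[R]_n => p.2 - center o u p.1) (@enorm R n)).
    apply: continuousB; first exact: cvg_snd.
    apply: continuousD; first exact: cst_continuous.
    by apply: (@cvgZ _ _ _ _ (nbhs_filter p)); [exact: cvg_fst|exact: cvg_cst].
  exact: continuous_enorm.
have oOm : open Om.
  apply: openI; first by apply: (@open_comp _ _ fst [set t : R | 0 < t]); [move=> ? _; exact: cvg_fst|exact: open_gt].
  by apply: (@open_comp _ _ (fun p : R * 'rV[R]_n => enorm (p.2 - center o u p.1)) [set t : R | t < kap]);
    [move=> p _; exact: cc|exact: open_lt].
have UP t z : 0 < t -> U t z <= heat_kernel t z y.
  by move=> t0; rewrite heat_kernelE// gerBl expR_ge0.
have UE t z : 0 < t -> U t z = heat_kernel t z y * (1 - expR (- phi t z)).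
  by move=> t0; rewrite heat_kernelE// /U expRD; ring.
have Uphi t z : 0 < t -> U t z <= heat_kernel t z y * phi t z.
  move=> t0; rewrite UE// ler_wpM2l ?heat_kernel_ge0//.
  by have := expR_ge1Dx (- phi t z); lra.
suff /(_ t1 x) : forall t x, s < t <= t1 -> Om (t, x) -> w t x <= 0.
  rewrite st1 lexx => /(_ isT (conj t10 xk)); rewrite subr_le0; apply: le_trans.
  rewrite UE// mulrC; apply: ler_wpM2l; first exact: heat_kernel_ge0.
  have phi_ge : C0 * ((kap - enorm (y - o)) * (kap - enorm (x - center o u t1)) / t1) <= phi t1 x.
    have t1S' : 0 < t1 <= S * kap ^+ 2 by rewrite t10.
    apply: le_trans (ball_profile_ge k0 t1S' A0 K0 b0 xk).
    have h1 := bump_depth k0 xk; have h2 := bump_depth k0 yk'.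
    rewrite qE /center scale0r addr0 -/(center o u t1) in h2.
    rewrite /b /C0; set e := expR _; set dx := kap - enorm (x - _) in h1 *.
    set dy := kap - enorm (y - o) in h2 *.
    have -> : e / (4 * (1 + A)) * (dy * dx / t1) =
        e / (1 + A) / t1 * kap ^+ 2 * ((dy / (2 * kap)) * (dx / (2 * kap))).
      by field; rewrite !gt_eqF.
    have -> : q / (1 + A) * e * kap ^+ 2 * (bump kap o u t1 x / t1) =
        e / (1 + A) / t1 * kap ^+ 2 * (q * bump kap o u t1 x).
      by field; rewrite !gt_eqF.
    apply: ler_wpM2l.
      by rewrite mulr_ge0 ?(ltW k2)// divr_ge0 ?(ltW t10)// divr_ge0 ?(ltW A1)// expR_ge0.
    have dge a : enorm a < kap -> 0 <= (kap - enorm a) / (2 * kap).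
      by move=> ak; rewrite divr_ge0 ?subr_ge0 ?(ltW ak)// mulr_ge0// ltW.
    by apply: ler_pM => //; exact: dge.
  set m := (kap - _) * _ / _ in phi_ge *.
  have m0 : 0 <= m by rewrite divr_ge0 ?(ltW t10)// mulr_ge0// subr_ge0 ltW.
  have phi0 : 0 <= phi t1 x by apply: le_trans phi_ge; rewrite mulr_ge0// ltW.
  apply: le_trans (min_one_le_expR phi0); rewrite mulrAC ler_pM2r ?invr_gt0//.
  rewrite le_min; apply/andP; split.
    by rewrite -[leRHS]mulr1 ler_pM// ?(ltW C00)// ?ge_min ?lexx// le_min ler01.
  by apply: le_trans phi_ge; rewrite ler_pM2l// ge_min lexx orbT.
apply: (max_principle oOm).
- move=> t z /andP[st tt] [t0 /= zk]; have [|_ cv _] := hv t z _ zk; first by rewrite st.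
  apply: continuousB => //; apply: (@eq_jointly_continuous _ _ (fun t z => heat_kernel t z y * (1 - expR (- phi t z)))).
    by apply: filterS (near_pos_open openT t0 (I : setT z)) => p [p0 _]; rewrite -UE.
  apply: continuousM; first exact: jointly_continuous_kernel.
  apply: continuousB; first exact: cst_continuous.
  apply: continuous_comp; last exact: continuous_expR.
  by apply: continuousN; exact: jointly_continuous_ball_profile.
- move=> t z /andP[st tt] [t0 /= zk] _; have [|_ _ hz] := hv t z _ zk; first by rewrite st.
  have tS : 0 < t <= S * kap ^+ 2 by rewrite t0 (le_trans tt).
  have [ft [g [h [j le]]]] := @ball_barrier R n kap o u k0 y t z S A K q tS zk erefl (lexx _) erefl q0.
  have [vt [gv [hw [jv Ev]]]] := hz.
  by do 3 eexists; split; [exact: jetB j jv|rewrite sumrB Ev lerD2r].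
- move=> t z e e0 /andP[st tt] nOm; have [ts|ts] := eqVneq t s.
    subst t; have [zk|zk] := leP (enorm (z - center o u s)) kap.
      apply: filterS (hini z e e0 zk) => -[t' z'] /= h /andP[st' _] [t'0 zk'].
      by apply: le_trans (h st' zk'); rewrite lerD2r UP.
    have /cvgr_gt /(_ _ zk) := cc (s, z); apply: filterS => p /= h _ [_].
    by rewrite ltNge (ltW h).
  have {ts}st' : s < t by rewrite lt_neqAle eq_sym ts.
  have t0 : 0 < t by apply: le_lt_trans st'.
  have zk : kap <= enorm (z - center o u t).
    by rewrite leNgt; apply/negP => zk; apply: nOm; split.
  (* At the lateral boundary [U] is dominated by a function continuous across the moving sphere and
     nonpositive outside it; the profile itself has the denominator [r + p], which may vanish
     there. *)
  pose G t z := heat_kernel t z y * (b * (1 + A) * kap ^+ 2 * (bump kap o u t z / t)).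
  have G0 : G t z <= 0.
    apply: mulr_ge0_le0; first exact: heat_kernel_ge0.
    apply: mulr_ge0_le0; first by apply: mulr_ge0; [apply: mulr_ge0 => //; exact: ltW|exact: ltW].
    apply: mulr_le0_ge0; last by rewrite invr_ge0 ltW.
    apply: mulr_le0_ge0; last by rewrite invr_ge0 mulr_ge0// ltW.
    by rewrite subr_le0 -enorm_sqr lerXn2r ?nnegrE ?enorm_ge0 ?(ltW k0).
  have cG : jointly_continuous_at G t z.
    apply: continuousM; first exact: jointly_continuous_kernel.
    apply: continuousM; first exact: cst_continuous.
    apply: continuousM; first exact: jointly_continuous_bump.
    by apply: continuousV; [rewrite gt_eqF|exact: cvg_fst].
  have /cvgr_lt /(_ _ (le_lt_trans G0 e0)) := cG.
  apply: filterS => -[t' z'] /= Ge st'1 [t'0 zk'].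
  have [v0 _ _] := hv t' z' st'1 zk'.
  rewrite (le_trans _ (ltW Ge))// (@le_trans _ _ (U t' z'))// ?gerBl// (le_trans (Uphi _ _ t'0))//.
  by rewrite ler_wpM2l ?heat_kernel_ge0// ball_profile_le.
- move=> e e0; exists (kap + enorm o + t1 * enorm u) => t z /andP[st tt] [t0 /= zk].
  rewrite ltNge => /negP[]; have -> : z = (z - center o u t) + (o + t *: u) by rewrite /center; vring.
  rewrite (le_trans (enormD _ _))// -addrA lerD ?(ltW zk)// (le_trans (enormD _ _))// lerD2l.
  by rewrite enormZ (gtr0_norm t0) ler_wpM2r ?enorm_ge0.
Qed.

End Stage.

(** * Upper bound *)

Section KernelMultiplier.
Context {R : realType} {n : nat}.
Implicit Types (x y z : 'rV[R]_n) (t s : R) (f : R -> 'rV[R]_n -> R).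

Lemma jet_kernelM f y t x pt g h : 0 < t -> jet f t x pt g h ->
  exists ft gE hE, jet (fun t x => expR (logp y t x) * f t x) t x ft gE hE /\
    ft - \sum_i hE i = expR (logp y t x) *
      (pt + (\sum_i (x - y) 0 i * g i x) / t - \sum_i h i).
Proof.
move=> t0 jf; have jk := jet_expR (jet_logp y x t0).
do 3 eexists; split; first exact: jetM jk jf.
have -> : \sum_i (expR (logp y t x) * h i + 2 * (expR (logp y t x) * - ((x - y) 0 i / (2 * t))) * g i x +
    f t x * (expR (logp y t x) * (- (2 * t)^-1 + (- ((x - y) 0 i / (2 * t))) ^+ 2))) =
  expR (logp y t x) * (\sum_i h i - (\sum_i (x - y) 0 i * g i x) / t +
    f t x * (dot (x - y) (x - y) / (4 * t ^+ 2) - \sum_(i < n) (2 * t)^-1)).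
  rewrite /dot !mulr_suml -!sumrB !mulr_sumr -big_split /= mulr_sumr.
  by apply: eq_bigr => i _; field; rewrite gt_eqF.
rewrite sumr_const card_ord -mulr_natl; field; rewrite gt_eqF//.
Qed.

Lemma kernel_infinity y s t1 e : 0 < s -> 0 < e -> exists N, forall t x,
  s < t <= t1 -> N < enorm x -> heat_kernel t x y <= e.
Proof.
move=> s0 e0; pose C := (Num.sqrt (4 * pi * s))^-1 ^+ n.
have C0 : 0 <= C by rewrite exprn_ge0 ?invr_ge0 ?sqrtr_ge0.
exists (enorm y + Num.sqrt (4 * `|t1| * C / e)) => t x /andP[st tt] Nx.
have t0 : 0 < t by apply: lt_trans st.
have t10 : 0 < t1 by apply: lt_le_trans tt.
rewrite gtr0_norm// in Nx.
have xy : Num.sqrt (4 * t1 * C / e) < enorm (x - y).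
  have := enorm_triangle y x 0; rewrite !subr0; move: Nx; lra.
have m0 : 0 <= 4 * t1 * C / e by rewrite divr_ge0 ?(ltW e0)// !mulr_ge0// ltW.
have d0 : 0 < enorm (x - y) by rewrite (le_lt_trans _ xy)// sqrtr_ge0.
have d2 : 4 * t1 * C / e <= dot (x - y) (x - y).
  rewrite -(sqr_sqrtr m0) -enorm_sqr lerXn2r ?nnegrE ?sqrtr_ge0 ?enorm_ge0//.
  exact: ltW.
have dp : 0 < dot (x - y) (x - y) by rewrite -enorm_sqr exprn_gt0.
rewrite heat_kernel_gauss// (@le_trans _ _ (C * (4 * t1 / dot (x - y) (x - y))))//; last first.
  by rewrite mulrA ler_pdivrMr// [C * _]mulrC [e * _]mulrC -ler_pdivrMr.
apply: ler_pM; [by rewrite exprn_ge0 ?invr_ge0 ?sqrtr_ge0|exact: expR_ge0|exact: sqrt_inv_le (ltW st)|].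
rewrite expRN -[leRHS]invrK lef_pV2 ?posrE ?expR_gt0 ?invr_gt0 ?divr_gt0 ?mulr_gt0//.
rewrite invf_div; apply: le_trans (expR_ge1Dx _); rewrite ler_wpDl//.
rewrite mulrC ler_pM2r// lef_pV2 ?posrE ?mulr_gt0// ler_pM2l//.
Qed.

End KernelMultiplier.

Section BlowUp.
Context {R : realType}.
Implicit Types (s t E : R).

(* The solution of [e' = - e ^ 3 / (2 t ^ 2)] that blows up at time [s]. *)
Definition blowup s t := Num.sqrt (s * t / (t - s)).

Lemma blowup_sqr s t : 0 < s < t -> blowup s t ^+ 2 = s * t / (t - s).
Proof.
move=> /andP[s0 st]; rewrite sqr_sqrtr// divr_ge0 ?subr_ge0 ?(ltW st)//.
by rewrite mulr_ge0 ?(ltW s0)// ltW// (lt_trans s0).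
Qed.

Lemma blowup_gt0 s t : 0 < s < t -> 0 < blowup s t.
Proof.
move=> /andP[s0 st]; rewrite sqrtr_gt0 divr_gt0 ?subr_gt0// mulr_gt0//.
exact: lt_trans st.
Qed.

Lemma is_derive_blowup s t : 0 < s < t ->
  is_derive t 1 (blowup s) (- (blowup s t ^+ 3 / (2 * t ^+ 2))).
Proof.
move=> st; have e0 := blowup_gt0 st; have e2 := blowup_sqr st.
case/andP: st => s0 st; have t0 : 0 < t by apply: lt_trans st.
have ts0 : 0 < t - s by rewrite subr_gt0.
have d1 : is_derive t 1 (fun u => s * u / (u - s)) (- (s ^+ 2 / (t - s) ^+ 2)).
  have tsn : t - s != 0 by rewrite gt_eqF.
  have d2 : is_derive t 1 (fun u : R => u - s) 1 by apply: is_derive_eq; rewrite subr0.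
  have d3 := @is_deriveV R (fun u : R => u - s) t 1 _ tsn d2.
  have -> : (fun u => s * u / (u - s)) = cst s * id * (fun u : R => (u - s)^-1) by [].
  apply: (is_derive_eq (is_deriveM (is_deriveM (is_derive_cst s t 1) (is_derive_id t 1)) d3)).
  by rewrite /GRing.scale /= !fctE /=; field; rewrite gt_eqF.
have p0 : 0 < s * t / (t - s) by rewrite divr_gt0// mulr_gt0.
apply: (is_derive_eq (is_derive_comp1 d1 (is_derive1_sqrt p0))).
rewrite -/(blowup s t).
have -> : (2 * blowup s t)^-1 * - (s ^+ 2 / (t - s) ^+ 2) =
  blowup s t ^+ 3 * ((blowup s t ^+ 2) ^+ 2)^-1 / 2 * - (s ^+ 2 / (t - s) ^+ 2).
  by field; rewrite !gt_eqF.
by rewrite e2; field; rewrite !gt_eqF.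
Qed.

(** The inverse square of the blow-up is [s^-1 - t^-1], which increases with [t]; [s] is chosen so
    that the value at [t1] is [E]. *)
Lemma blowup_ge s t t1 E : 0 < E -> 0 < t1 -> s = (t1^-1 + E ^- 2)^-1 -> s < t <= t1 ->
  E <= blowup s t.
Proof.
move=> E0 t10 sE /andP[st tt].
have s0 : 0 < s by rewrite sE invr_gt0 addr_gt0 ?invr_gt0 ?exprn_gt0.
have t0 : 0 < t by apply: lt_trans st.
have st' : 0 < s < t by rewrite s0.
have e0 := blowup_gt0 st'.
rewrite -(@ler_pXn2r _ 2%N) ?nnegrE ?(ltW E0) ?(ltW e0)// blowup_sqr//.
have -> : s * t / (t - s) = (s^-1 - t^-1)^-1.
  have -> : s^-1 - t^-1 = (t - s) / (s * t) by field; rewrite !gt_eqF.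
  by rewrite invf_div.
have i0 : 0 < s^-1 - t^-1 by rewrite subr_gt0 ltf_pV2.
rewrite -[leLHS]invrK lef_pV2 ?posrE ?invr_gt0 ?exprn_gt0// sE invrK.
by rewrite addrAC gerDr subr_le0 lef_pV2 ?posrE.
Qed.

Lemma blowup_end t1 E : 0 < E -> 0 < t1 -> blowup ((t1^-1 + E ^- 2)^-1) t1 = E.
Proof.
move=> E0 t10; rewrite /blowup -[RHS](ger0_norm (ltW E0)) -sqrtr_sqr; congr Num.sqrt.
have h : 0 < E ^+ 2 + t1 by rewrite addr_gt0// exprn_gt0.
have -> : (t1^-1 + E ^- 2)^-1 = t1 * E ^+ 2 / (E ^+ 2 + t1) by field; rewrite !gt_eqF.
have -> : t1 - t1 * E ^+ 2 / (E ^+ 2 + t1) = t1 ^+ 2 / (E ^+ 2 + t1) by field; rewrite !gt_eqF.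
by field; rewrite !gt_eqF.
Qed.

End BlowUp.

Section UpperBound.
Context {R : realType} {n : nat}.
Implicit Types (D : set 'rV[R]_n) (x y z a : 'rV[R]_n) (t s : R).

Lemma jet_affine a (c : R) (f : R -> R) t x f' : is_derive t 1 f f' ->
  jet (fun t x => (dot a x - c) * f t) t x ((dot a x - c) * f')
    (fun i _ => a 0 i * f t) (fun=> 0).
Proof.
move=> df; split.
- have d := is_deriveM (is_derive_cst (dot a x - c) t 1) df.
  by apply: (is_derive_eq d); rewrite /GRing.scale /= mulr0 addr0.
- move=> i; apply: nearWx => z.
  have d := is_deriveM (is_deriveB (is_derive_dot z (ei i) a) (is_derive_cst c z (ei i)))
    (is_derive_cst (f t) z (ei i)).
  by apply: (is_derive_eq d); rewrite /GRing.scale /= mulr0 add0r dot_ei subr0 mulrC.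
- by move=> i; exact: is_derive_cst.
Qed.

Lemma jointly_continuous_affine a (c : R) (f : R -> R) t x : {for t, continuous f} ->
  jointly_continuous_at (fun t x => (dot a x - c) * f t) t x.
Proof.
move=> cf; apply: continuousM; last exact: jointly_continuous_time.
apply: (@continuous_comp _ _ _ snd (fun x => dot a x - c)); first exact: cvg_snd.
by apply: (@cvgB _ _ _ _ (nbhs_filter x)); [exact: continuous_dot|exact: cvg_cst].
Qed.

Section Barrier.
Variables (a1 a2 : 'rV[R]_n) (k1 k2 : R) (y : 'rV[R]_n) (s t1 E : R).
Hypotheses (u1 : enorm a1 = 1) (u2 : enorm a2 = 1) (E0 : 0 < E) (t10 : 0 < t1).
Hypothesis sE : s = (t1^-1 + E ^- 2)^-1.
Let b := dot a1 y - k1.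
Let c := dot a2 y - k2.
Hypotheses (b0 : 0 <= b) (c0 : 0 < c).

(* [pD <= p * amplitude] by the half-space [a2], and [2 * p * amplitude *
   (1 - exp (- rate))] is a supersolution where [rate < 1]. Without [blowup],
   [rate] is the exponent in the kernel of the half-space [a1]; the blow-up
   makes the comparison hold at time [s]. *)
Definition rate t x := (dot a1 x - k1) * ((b + blowup s t) / t).

(** The kernel times the first summand is [- 2 * c] times the derivative of the kernel along [a2],
    so the kernel times [amplitude] solves the heat equation. The term [c ^+ 2 / s] puts it above
    the exponent of the half-space [a2] from time [s] on, and [4 * c / E] is the slack for the
    product of gradients. *)
Definition amplitude t x := (dot a2 x - k2 - c) * (c / t) + (c ^+ 2 / s + 4 * c / E).

Lemma pos_start : 0 < s.
Proof. by rewrite sE invr_gt0 addr_gt0 ?invr_gt0 ?exprn_gt0. Qed.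

Lemma jet_rate t x : s < t -> jet rate t x
  ((dot a1 x - k1) * (- (blowup s t ^+ 3 / (2 * t ^+ 3)) - (b + blowup s t) / t ^+ 2))
  (fun i _ => a1 0 i * ((b + blowup s t) / t)) (fun=> 0).
Proof.
move=> st; have s0 := pos_start; have t0 : 0 < t by apply: lt_trans st.
apply: jet_affine; have st' : 0 < s < t by rewrite s0.
have tn : t != 0 by rewrite gt_eqF.
have dV := @is_deriveV R id t 1 _ tn (is_derive_id t 1).
have d := is_deriveM (is_deriveD (is_derive_cst b t 1) (is_derive_blowup st')) dV.
by apply: (is_derive_eq d); rewrite /GRing.scale /= !fctE /=; field; rewrite gt_eqF.
Qed.

Lemma jet_amplitude t x : s < t -> jet amplitude t x
  ((dot a2 x - k2 - c) * - (c / t ^+ 2)) (fun i _ => a2 0 i * (c / t)) (fun=> 0).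
Proof.
move=> st; have s0 := pos_start; have t0 : 0 < t by apply: lt_trans st.
have tn : t != 0 by rewrite gt_eqF.
have d : is_derive t 1 (fun t => c / t) (- (c / t ^+ 2)).
  have dV := @is_deriveV R id t 1 _ tn (is_derive_id t 1).
  apply: (is_derive_eq (is_deriveM (is_derive_cst c t 1) dV)).
  by rewrite /GRing.scale /=; field.
have j := jetB (jet_affine a2 (k2 + c) x d) (jet_cst (- (c ^+ 2 / s + 4 * c / E)) t x).
have -> : amplitude = fun t x => (dot a2 x - (k2 + c)) * (c / t) - - (c ^+ 2 / s + 4 * c / E).
  by apply/funext => t'; apply/funext => x'; rewrite /amplitude opprK (opprD k2 c) (addrA _ (- k2)).
case: j => j1 j2 j3; split.
- by apply: (is_derive_eq j1); rewrite subr0 opprD addrA.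
- by move=> i; apply: filterS (j2 i) => z jz; apply: (is_derive_eq jz); rewrite subr0.
- by move=> i; exact: is_derive_cst.
Qed.

Lemma amplitude_ge t x : s <= t -> 0 <= dot a2 x - k2 ->
  (dot a2 x - k2) * c / t + 4 * c / E <= amplitude t x.
Proof.
move=> st h; have s0 := pos_start; have t0 : 0 < t by apply: lt_le_trans st.
rewrite /amplitude addrA lerD2r -subr_ge0.
have -> : (dot a2 x - k2 - c) * (c / t) + c ^+ 2 / s - (dot a2 x - k2) * c / t =
  c ^+ 2 * (s^-1 - t^-1) by ring.
by rewrite mulr_ge0 ?exprn_ge0 ?(ltW c0)// subr_ge0 lef_pV2 ?posrE.
Qed.

(* The drift created by the blow-up of [blowup s] absorbs the interaction of
   the gradients of the two factors as long as [rate < 1]. *)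
Lemma barrier t x : s < t <= t1 -> 0 < dot a1 x - k1 -> 0 < dot a2 x - k2 -> rate t x < 1 ->
  exists ft g h, jet (fun t x => expR (logp y t x) *
    (amplitude t x * (1 - expR (- 1 * rate t x)))) t x ft g h /\ \sum_i h i <= ft.
Proof.
move=> st x1 x2 r1; have s0 := pos_start; have /andP[st1 tt] := st.
have t0 : 0 < t by apply: lt_trans st1.
have jr := jet_expR (jetZ (- 1) (jet_rate x st1)).
have jG := jetB (jet_cst 1 t x) jr.
have [ft [g [h [j Eh]]]] := jet_kernelM y t0 (jetM (jet_amplitude x st1) jG).
exists ft, g, h; split => //; rewrite -subr_ge0 Eh; apply: mulr_ge0; first exact: expR_ge0.
have e_ge := blowup_ge E0 t10 sE st.
have e0 : 0 < blowup s t by apply: lt_le_trans e_ge.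
set e := blowup s t in e_ge e0 r1 *; set B := b + e.
have B0 : 0 < B by rewrite ltr_wpDl.
set ph := rate t x in r1 *; set A := amplitude t x; set X := expR _.
have X0 : 0 < X by exact: expR_gt0.
set xi := dot a1 x - k1 in x1 *; set et := dot a2 x - k2 in x2 *.
have -> : \sum_i (A * (0 - X * (- 1 * 0 + (- 1 * (a1 0 i * (B / t))) ^+ 2)) +
    2 * (a2 0 i * (c / t)) * (0 - X * (- 1 * (a1 0 i * (B / t)))) + (1 - X) * 0) =
   X * (2 * (c / t) * (B / t) * dot a2 a1 - A * (B / t) ^+ 2 * dot a1 a1).
  by rewrite /dot !mulr_sumr -sumrB mulr_sumr; apply: eq_bigr => i _; ring.
have -> : \sum_i (x - y) 0 i * (A * (0 - X * (- 1 * (a1 0 i * (B / t)))) +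
     (1 - X) * (a2 0 i * (c / t))) =
   A * X * (B / t) * dot (x - y) a1 + (1 - X) * (c / t) * dot (x - y) a2.
  by rewrite /dot !mulr_sumr -big_split /=; apply: eq_bigr => i _; ring.
rewrite (dotC (x - y)) (dotC (x - y)) !dotBr dotaa//.
have -> : dot a1 x - dot a1 y = xi - b by rewrite /xi /b; ring.
have -> : dot a2 x - dot a2 y = et - c by rewrite /et /c; ring.
have -> : A * (0 - X * (- 1 * (xi * (- (e ^+ 3 / (2 * t ^+ 3)) - B / t ^+ 2)))) +
  (1 - X) * ((et - c) * - (c / t ^+ 2)) +
  (A * X * (B / t) * (xi - b) + (1 - X) * (c / t) * (et - c)) / t -
  X * (2 * (c / t) * (B / t) * dot a2 a1 - A * (B / t) ^+ 2 * 1) =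
  X / t ^+ 2 * (A * (B * e - xi * e ^+ 3 / (2 * t)) - 2 * c * B * dot a2 a1).
  by rewrite /B; field; rewrite gt_eqF.
apply: mulr_ge0; first by rewrite divr_ge0 ?exprn_ge0// ltW.
have xt : xi * B <= t.
  by move: r1; rewrite /ph /rate -/xi -/e -/B mulrA ltr_pdivrMr// mul1r => /ltW.
(* The slack [4 * c / E] of the amplitude and [E <= e]: this is what pays for the cross term
   [2 * c * B * dot a2 a1]. *)
have A4 : 4 * c <= A * e.
  have hA : 4 * c / E <= A.
    apply: le_trans (amplitude_ge (ltW st1) (ltW x2)); rewrite lerDr divr_ge0 ?(ltW t0)//.
    by rewrite mulr_ge0// ltW.
  apply: (@le_trans _ _ (A * E)); first by rewrite -ler_pdivrMr.
  by rewrite ler_wpM2l// (le_trans _ hA)// divr_ge0 ?mulr_ge0// ltW.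
have A0 : 0 <= A.
  by rewrite -(pmulr_lge0 _ e0) (le_trans _ A4)// mulr_ge0// ltW.
have h1 : B * e / 2 <= B * e - xi * e ^+ 3 / (2 * t).
  have -> : B * e / 2 = B * e - B * e / 2 by field.
  rewrite lerD2l lerN2.
  rewrite ler_pdivrMr ?mulr_gt0//.
  have -> : B * e / 2 * (2 * t) = B * e * t by field.
  have -> : xi * e ^+ 3 = e * (xi * e ^+ 2) by ring.
  apply: (@le_trans _ _ (B * e * (xi * B))).
    have -> : B * e * (xi * B) = e * (xi * B ^+ 2) by ring.
    apply: ler_wpM2l; first exact: ltW.
    apply: ler_wpM2l; first exact: ltW.
    by rewrite lerXn2r ?nnegrE ?(ltW e0) ?(ltW B0)// lerDr.
  by apply: ler_wpM2l => //; rewrite mulr_ge0// ltW.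
have h2 : 2 * c * B * dot a2 a1 <= 2 * c * B.
  rewrite ler_piMr ?mulr_ge0 ?(ltW c0) ?(ltW B0)//.
  by have := dot_le_unit a1 u2; rewrite u1.
have h3 : 2 * c * B <= A * (B * e / 2).
  have -> : A * (B * e / 2) = A * e * (B / 2) by field.
  have -> : 2 * c * B = 4 * c * (B / 2) by field.
  by rewrite ler_wpM2r// divr_ge0// ltW.
have h4 := ler_wpM2l A0 h1.
by rewrite subr_ge0 (le_trans h2)// (le_trans h3).
Qed.

End Barrier.

Lemma min_one_expR (f : R) : 0 <= f -> 1 - expR (- f) <= Num.min 1 f.
Proof.
move=> f0; rewrite le_min gerBl expR_ge0 /=.
by have := expR_ge1Dx (- f); lra.
Qed.

Lemma expR_half (f : R) : 1 <= f -> expR (- f) <= 2^-1.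
Proof.
move=> f1; rewrite expRN lef_pV2 ?posrE ?expR_gt0//.
by apply: le_trans (expR_ge1Dx _); rewrite lerD2l.
Qed.

(** If one of the factors [1 /\ a b / t] and [1 /\ c H / t] is 1, the bound of the other half-space
    suffices; the barrier treats the remaining case. At the final time [c / E] times the rate is at
    most [2 a c / t], so the term [a c / t] collects [2 * (1 + 5 * 2) = 22]. *)
Lemma pD_upper D pD a1 a2 (k1 k2 : R) t x y : open D -> dirichlet_heat_kernel D pD ->
  0 < t -> D x -> D y -> enorm a1 = 1 -> enorm a2 = 1 ->
  D `<=` halfspace a1 k1 -> D `<=` halfspace a2 k2 ->
  dot a2 y - k2 <= dot a1 y - k1 ->
  pD t x y <= 22 * (Num.min 1 ((dot a1 x - k1) * (dot a2 y - k2) / t) +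
    Num.min 1 ((dot a1 x - k1) * (dot a1 y - k1) / t) *
    Num.min 1 ((dot a2 y - k2) * (dot a2 x - k2) / t)) * heat_kernel t x y.
Proof.
move=> oD dk t0 Dx Dy u1 u2 D1 D2 cb.
have pos1 z : D z -> 0 < dot a1 z - k1 by move/D1; rewrite subr_gt0.
have pos2 z : D z -> 0 < dot a2 z - k2 by move/D2; rewrite subr_gt0.
have le2 s z : 0 < s -> D z -> pD s z y <= heat_kernel s z y * (1 - expR (- ((dot a2 z - k2) * (dot a2 y - k2) / s))).
  by move=> s0 Dz; exact: (pD_le_halfspace oD dk s0 Dz Dy u2 D2).
set a := dot a1 x - k1; set b := dot a1 y - k1 in cb *; set c := dot a2 y - k2 in le2 cb *.
set H := dot a2 x - k2.
have a0 : 0 < a by exact: pos1.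
have b0 : 0 < b by exact: pos1.
have c0 : 0 < c by exact: pos2.
have H0 : 0 < H by exact: pos2.
have p0 := heat_kernel_ge0 t x y; set p := heat_kernel t x y in p0 *.
have ge0 (f g : R) : 0 < f -> 0 < g -> 0 <= f * g / t.
  by move=> f0 g0; rewrite divr_ge0 ?mulr_ge0// ltW.
have min0 (f : R) : 0 <= f -> 0 <= Num.min 1 f by move=> f0; rewrite le_min ler01.
have weak (m q : R) : 0 <= m -> 0 <= q -> m * p <= 22 * (q + m) * p.
  move=> m0 q0; rewrite ler_wpM2r// mulrDr ler_wpDl ?mulr_ge0//.
  by rewrite ler_peMl// ler1n.
have [bt|bt] := leP t (a * b).
  have m1 : Num.min 1 (a * b / t) = 1 by apply/min_idPl; rewrite ler_pdivlMr// mul1r.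
  rewrite m1 mul1r; apply: le_trans (weak _ _ (min0 _ (ge0 _ _ c0 H0)) (min0 _ (ge0 _ _ a0 c0))).
  rewrite mulrC (le_trans (le2 t x t0 Dx))// ler_wpM2l// -/H (mulrC H).
  exact: min_one_expR (ge0 _ _ c0 H0).
have [ct|ct] := leP t (c * H).
  have m1 : Num.min 1 (c * H / t) = 1 by apply/min_idPl; rewrite ler_pdivlMr// mul1r.
  rewrite m1 mulr1; apply: le_trans (weak _ _ (min0 _ (ge0 _ _ a0 b0)) (min0 _ (ge0 _ _ a0 c0))).
  rewrite mulrC (le_trans (pD_le_halfspace oD dk t0 Dx Dy u1 D1))// ler_wpM2l// -/a -/b.
  exact: min_one_expR (ge0 _ _ a0 b0).
have -> : Num.min 1 (a * b / t) = a * b / t.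
  by apply/min_idPr; rewrite ler_pdivrMr// mul1r ltW.
have -> : Num.min 1 (c * H / t) = c * H / t.
  by apply/min_idPr; rewrite ler_pdivrMr// mul1r ltW.
have -> : Num.min 1 (a * c / t) = a * c / t.
  by apply/min_idPr; rewrite ler_pdivrMr// mul1r (le_trans _ (ltW bt))// ler_pM2l.
(* [E >= b] bounds [c / E] times the final rate [a (b + E) / t] by [2 a c / t]; [E <= b + t / H]
   bounds [c H / t] times that rate by [2 (a b / t) (c H / t) + a c / t]. *)
pose E := Num.max b (t / H).
have Eb : b <= E by rewrite le_max lexx.
have EH : t / H <= E by rewrite le_max lexx orbT.
have E0 : 0 < E by apply: lt_le_trans Eb.
have E2 : E <= b + t / H.
  by rewrite ge_max lerDl lerDr (ltW b0) divr_ge0 ?(ltW t0) ?(ltW H0).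
pose s := (t^-1 + E ^- 2)^-1.
have s0 : 0 < s by rewrite invr_gt0 addr_gt0 ?invr_gt0 ?exprn_gt0.
have st : s < t.
  rewrite -[ltRHS]invrK ltf_pV2 ?posrE ?invr_gt0 ?addr_gt0 ?invr_gt0 ?exprn_gt0//.
  by rewrite ltrDl invr_gt0 exprn_gt0.
pose ph := rate a1 k1 y s; pose A := amplitude a2 k2 y s E.
pose V t x := heat_kernel t x y * (A t x * (1 - expR (- 1 * ph t x))).
pose w t x := pD t x y - 2 * V t x.
have A_ge u z : s <= u -> D z -> (dot a2 z - k2) * c / u <= A u z.
  move=> su Dz; apply: le_trans (amplitude_ge E0 t0 erefl c0 su (ltW (pos2 z Dz))).
  by rewrite lerDl divr_ge0 ?mulr_ge0// ltW.
have A0 u z : s <= u -> D z -> 0 <= A u z.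
  move=> su Dz; apply: le_trans (A_ge u z su Dz).
  by rewrite divr_ge0 ?mulr_ge0 ?(ltW (pos2 z Dz)) ?(ltW c0)// ltW// (lt_le_trans s0).
have pDA u z : s <= u -> D z -> pD u z y <= heat_kernel u z y * A u z.
  move=> su Dz; have u0 : 0 < u by apply: lt_le_trans su.
  apply: le_trans (le2 u z u0 Dz) _; apply: ler_wpM2l; first exact: heat_kernel_ge0.
  apply: le_trans (A_ge u z su Dz).
  have f0 : 0 <= (dot a2 z - k2) * c / u.
    by rewrite divr_ge0 ?mulr_ge0 ?(ltW (pos2 z Dz)) ?(ltW c0)// ltW.
  by apply: le_trans (min_one_expR f0) _; rewrite ge_min lexx orbT.
have ph0 u z : s < u -> D z -> 0 < ph u z.
  move=> su Dz; have u0 : 0 < u by apply: lt_trans su.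
  rewrite mulr_gt0 ?pos1// divr_gt0// addr_gt0//; apply: blowup_gt0.
  by rewrite s0.
(* Origin of the factor 2 in [w]: where the rate is at least 1, [2 * (1 - expR (- rate))] is at
   least 1 and the bound by the amplitude alone suffices. The maximum principle then only sees
   points with rate below 1. *)
have wneg u z : s < u -> D z -> 1 <= ph u z -> w u z <= 0.
  move=> su Dz p1; rewrite subr_le0 (le_trans (pDA u z (ltW su) Dz))// /V.
  rewrite [leRHS]mulrCA ler_wpM2l ?heat_kernel_ge0// mulrCA.
  rewrite ler_peMr ?A0 ?(ltW su)// mulN1r.
  by have := expR_half p1; lra.
have V0 u z : s < u -> D z -> 0 <= V u z.
  move=> su Dz; rewrite mulr_ge0 ?heat_kernel_ge0// mulr_ge0 ?A0 ?(ltW su)//.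
  by rewrite subr_ge0 -[leRHS]expR0 ler_expR mulN1r oppr_le0 ltW// ph0.
pose Om := [set q : R * 'rV[R]_n | D q.2].
have oOm : open Om by apply: (@open_comp _ _ snd D) => // q _; exact: cvg_snd.
have [[pD0 hpD _] bc _] := dk y Dy.
suff /(_ t x) : forall u z, s < u <= t -> Om (u, z) -> w u z <= 0.
  rewrite st lexx => /(_ isT Dx); rewrite subr_le0 => /le_trans; apply.
  rewrite /V -/p mulrCA mulrC; apply: ler_wpM2r => //.
  have phE : ph t x = a * (b + E) / t by rewrite /ph /rate blowup_end// mulrA.
  have h1 : 1 - expR (- 1 * ph t x) <= ph t x.
    by rewrite mulN1r; have := expR_ge1Dx (- ph t x); lra.
  have hA : A t x <= c * H / t + 5 * (c / E).
    have -> : A t x = c * H / t + (c / E) ^+ 2 + 4 * (c / E).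
      rewrite /A /amplitude -/c -/H /s; field; rewrite !gt_eqF//.
      by rewrite addr_gt0// exprn_gt0.
    have : (c / E) ^+ 2 <= c / E.
      rewrite expr2 ler_piMr ?divr_ge0 ?(ltW c0) ?(ltW E0)//.
      by rewrite ler_pdivrMr// mul1r (le_trans cb).
    lra.
  apply: (@le_trans _ _ (2 * ((c * H / t + 5 * (c / E)) * ph t x))).
    apply: ler_wpM2l => //; apply: ler_pM => //; first by rewrite A0// ltW.
    by rewrite subr_ge0 -[leRHS]expR0 ler_expR mulN1r oppr_le0 ltW// ph0.
  rewrite phE.
  have g1 : c * H / t * (a * (b + E) / t) <= c * H / t * (a * (2 * b + t / H) / t).
    apply: ler_wpM2l; first exact: ge0.
    by rewrite ler_pM2r ?invr_gt0// ler_pM2l//; move: E2; lra.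
  have g2 : c / E * (a * (b + E) / t) <= 2 * (a * c / t).
    have -> : 2 * (a * c / t) = c / E * (a * (2 * E) / t) by field; rewrite !gt_eqF.
    apply: ler_wpM2l; first by rewrite divr_ge0// ltW.
    by rewrite ler_pM2r ?invr_gt0// ler_pM2l//; move: Eb; lra.
  have g3 : c * H / t * (a * (2 * b + t / H) / t) = 2 * ((a * b / t) * (c * H / t)) + a * c / t.
    by field; rewrite !gt_eqF.
  have g4 := ge0 _ _ a0 b0; have g5 := ge0 _ _ c0 H0; have g6 := mulr_ge0 g4 g5.
  rewrite mulrDl; move: g1 g2 g6; rewrite g3 -!mulrA.
  by lra.
apply: (max_principle oOm).
- move=> u z /andP[su ut] Dz; have u0 : 0 < u by apply: lt_trans su.
  have [cp _ _ _ _] := hpD u z u0 Dz.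
  have cV1 : {for u, continuous (fun v : R => v^-1)} by apply: inv_continuous; rewrite gt_eqF.
  have cblow : {for u, continuous (blowup s)}.
    have su' : 0 < s < u by rewrite s0.
    by apply/differentiable_continuous/derivable1_diffP; case: (is_derive_blowup su').
  apply: continuousB => //; apply: continuousM; first exact: cst_continuous.
  apply: continuousM; first exact: jointly_continuous_kernel.
  apply: continuousM.
    apply: continuousD; last exact: cst_continuous.
    have -> : (fun q : R * 'rV[R]_n => (dot a2 q.2 - k2 - (dot a2 y - k2)) * ((dot a2 y - k2) / q.1)) =
       (fun q => (dot a2 q.2 - (k2 + c)) * (c / q.1)).
      by apply/funext => q; rewrite (opprD k2 c) addrA.
    apply: (@jointly_continuous_affine a2 (k2 + c) (fun u => c / u)).
    by apply: continuousM => //; exact: cst_continuous.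
  apply: continuousB; first exact: cst_continuous.
  apply: continuous_comp; last exact: continuous_expR.
  apply: continuousM; first exact: cst_continuous.
  apply: (@jointly_continuous_affine a1 k1 (fun u => (b + blowup s u) / u)).
  by apply: continuousM => //; apply: continuousD => //; exact: cst_continuous.
- move=> u z suz Dz wpos; have /andP[su ut] := suz; have u0 : 0 < u by apply: lt_trans su.
  have ph1 : ph u z < 1.
    by rewrite ltNge; apply/negP => /(wneg u z su Dz); rewrite leNgt wpos.
  have [Vt [gV [hV [jV EV]]]] := barrier u1 u2 E0 t0 erefl (ltW b0) c0 suz (pos1 z Dz) (pos2 z Dz) ph1.
  have [pt [gp [hp [jp Ep]]]] := heat_solution_at oD hpD u0 Dz.
  have jV' := jetZ 2 jV.
  exists (pt - 2 * Vt), (fun i z => gp i z - 2 * gV i z), (fun i => hp i - 2 * hV i); split.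
    have [j1 j2 j3] := jetB jp jV'; split; last 2 first.
    + move=> i; apply: filterS (j2 i) => z'; rewrite /w /V.
      have -> : (fun z0 => pD u z0 y - 2 * (expR (logp y u z0) * (amplitude a2 k2 y s E u z0 *
        (1 - expR (-1 * rate a1 k1 y s u z0))))) = w u.
        by apply/funext => z0; rewrite /w /V heat_kernelE.
      exact.
    + exact: j3.
    + apply: near_eq_is_derive j1; apply: filterS (near_gt0 u0) => v v0.
      by rewrite /w /V heat_kernelE.
  by rewrite sumrB Ep lerD2l lerN2 -mulr_sumr ler_pM2l.
- move=> u z e e0 /andP[su ut] nOm; have u0 : 0 < u by apply: lt_le_trans su.
  have [Dz|nDz] := pselect (D z).
    have us : u = s.
      by apply/eqP; rewrite eq_sym eq_le su leNgt; apply/negP => su'; apply: nOm.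
    (* Near [z] the distance to the first hyperplane stays above [m], while the blow-up tends to
       infinity; so the rate exceeds 1 just after time [s], and [wneg] settles the initial
       comparison. *)
    subst u; pose m := (dot a1 z - k1) / 2.
    have m0 : 0 < m by rewrite divr_gt0// pos1.
    have near1 : \forall q \near (s, z), m < dot a1 q.2 - k1.
      have c1 : jointly_continuous_at (fun (t : R) x => (dot a1 x - k1) * 1) s z.
        by apply: (@jointly_continuous_affine a1 k1 (fun=> 1)); exact: cst_continuous.
      have : m < (dot a1 z - k1) * 1 by rewrite mulr1 ltr_pdivrMr// ltr_pMr ?pos1// ltr1n.
      by move/(cvgr_gt _ c1); apply: filterS => q; rewrite mulr1.
    have near2 : \forall q \near (s, z), s < q.1 -> m * (blowup s q.1 / q.1) >= 1.
      apply/nbhs_pairP; exists (Num.min s (m ^+ 2 / 2)); first by rewrite lt_min s0 divr_gt0 ?exprn_gt0.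
      move=> v z' /=; rewrite ltr_norml !lt_min => /andP[_ /andP[v1 v2]] _ sv.
      have v0 : 0 < v by apply: lt_trans sv.
      have bl : 0 < blowup s v by apply: blowup_gt0; rewrite s0.
      rewrite mulrA ler_pdivlMr// mul1r -(@ler_pXn2r _ 2%N) ?nnegrE ?(ltW v0) ?(mulr_ge0 (ltW m0) (ltW bl))//.
      rewrite exprMn blowup_sqr ?s0// mulrA ler_pdivlMr ?subr_gt0//.
      have -> : v ^+ 2 * (v - s) = v * (v * (v - s)) by ring.
      have -> : m ^+ 2 * (s * v) = v * (2 * s * (m ^+ 2 / 2)) by field.
      apply: ler_wpM2l; first exact: ltW.
      apply: ler_pM; rewrite ?subr_ge0 ?(ltW v0) ?(ltW sv) ?(ltW v2)//.
      by move: v1; rewrite ltrBlDr mulr2n mulrDl mul1r => /ltW.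
    apply: filterS2 near1 near2 => -[u' z'] /= n1 n2 /andP[su' _] Dz'.
    rewrite (le_trans _ (ltW e0))// wneg// (le_trans (n2 su'))//.
    have u'0 : 0 < u' by apply: lt_trans su'.
    have bl : 0 < blowup s u' by apply: blowup_gt0; rewrite s0.
    rewrite /ph /rate; apply: ler_pM; rewrite ?(ltW m0) ?(ltW n1)//.
      by rewrite divr_ge0// ltW.
    by rewrite ler_pM2r ?invr_gt0// lerDr ltW.
  have [clz|nclz] := pselect (closure D z).
    have bz : boundary D z by apply/boundary_openE.
    have := bc u z u0 bz; move/cvgr_lt => /(_ e e0); rewrite near_withinE.
    apply: filterS => -[u' z'] /= h /andP[su' _] Dz'.
    by rewrite (le_trans _ (ltW (h Dz')))// gerBl mulr_ge0// V0.
  have nz : \forall q \near (u, z), ~ D q.2.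
    have oc : open (~` closure D) by apply: closed_openC; exact: closed_closure.
    have := near_pos_open oc u0 nclz; apply: filterS => q [_ nq] Dq.
    by apply: nq; exact: subset_closure.
  by apply: filterS nz => q nq _ /nq.
- move=> e e0; have [N NP] := kernel_infinity y t s0 e0.
  exists N => u z suz Dz Nz; have /andP[su ut] := suz.
  have u0 : 0 < u by apply: lt_trans su.
  rewrite (le_trans _ (NP u z suz Nz))// (le_trans _ (pD_le_kernel oD dk u0 Dz Dy))//.
  by rewrite gerBl mulr_ge0// V0.
Qed.

End UpperBound.

(** * Lower bound *)

Lemma min_one_scale (R : realType) (c f g : R) : 0 <= c <= 1 -> c * f <= g ->
  c * Num.min 1 f <= Num.min 1 g.
Proof.
move=> /andP[c0 c1] fg; rewrite le_min; apply/andP; split.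
  by apply: le_trans c1; rewrite ler_piMr// ge_min lexx.
by apply: le_trans fg; rewrite ler_wpM2l// ge_min lexx orbT.
Qed.

(** * Legs of the path and change of pole *)

Section Stations.
Context {R : realType} {n : nat}.
Variables (C S : R) (D : set 'rV[R]_n) (y : 'rV[R]_n) (v : R -> 'rV[R]_n -> R).
Hypotheses (C0 : 0 < C) (S8 : 8 <= S) (hC : @moving_ball_bound R n C S).
Hypothesis cD : convex D.
Hypothesis hv : forall t x, 0 < t -> D x ->
  [/\ 0 <= v t x, jointly_continuous_at v t x & heat_at v t x].
Hypothesis hi : forall e, 0 < e -> exists2 d, 0 < d & forall t x, 0 < t < d ->
  enorm (x - y) < d -> heat_kernel t x y - v t x <= e.
Implicit Types (x z o : 'rV[R]_n) (t s kap lam mu : R).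

Lemma moving_ball_sub o0 o1 kap s : 0 < kap -> 0 <= s <= 1 ->
  eball o0 kap `<=` D -> eball o1 kap `<=` D ->
  eball ((1 - s) *: o0 + s *: o1) kap `<=` D.
Proof.
move=> k0 s01 D0 D1.
have := convex_eball cD (D0 _ (eball_center _ k0)) (D1 _ (eball_center _ k0)) (ltW k0) (ltW k0) s01 D0 D1.
by rewrite -mulrDl subrK mul1r.
Qed.

(** A leg starting at the time of the pole. Its initial condition is the trace hypothesis near [y];
    away from [y] the kernel itself tends to 0 and [v >= 0]. *)
Lemma pole_stage kap o0 o1 t1 : 0 < kap -> 0 < t1 <= S * kap ^+ 2 ->
  eball o0 kap `<=` D -> eball o1 kap `<=` D -> enorm (y - o0) < kap ->
  forall x, enorm (x - o1) < kap ->
  C * Num.min 1 ((kap - enorm (y - o0)) * (kap - enorm (x - o1)) / t1) *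
    heat_kernel t1 x y <= v t1 x.
Proof.
move=> k0 /andP[t10 t1S] D0 D1 yo; pose u := t1^-1 *: (o1 - o0).
have cE t : center o0 u t = (1 - t / t1) *: o0 + (t / t1) *: o1.
  by rewrite /center /u scalerA; vring.
have c1 : center o0 u t1 = o1.
  by rewrite cE mulfV ?gt_eqF// subrr scale0r add0r scale1r.
have inD t z : 0 <= t <= t1 -> enorm (z - center o0 u t) < kap -> D z.
  move=> /andP[t0 tt] zk; have s01 : 0 <= t / t1 <= 1.
    by rewrite divr_ge0 ?(ltW t10)//= ler_pdivrMr// mul1r.
  by apply: (moving_ball_sub k0 s01 D0 D1); rewrite /eball /= -cE.
move=> x; rewrite -c1; apply: (@hC kap o0 u y 0 t1 v k0 yo) => //.
- by rewrite lexx.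
- move=> t z /andP[t0 tt] zk; apply: hv => //; apply: inD zk.
  by rewrite (ltW t0).
- move=> z e e0 zk; have [d d0 dP] := hi e0.
  have d20 : 0 < d / 2 by rewrite divr_gt0.
  have [t2 t20 t2P] := @offdiagonal_small R n y (d / 2) e d20 e0.
  apply/nbhs_pairP; exists (Num.min (Num.min t1 t2) (d / 2)); first by rewrite !lt_min t10 t20.
  move=> t z'; rewrite subr0 !lt_min => /andP[/andP[tt1 tt2] td] /andP[_ zd] /= t0 zk'.
  rewrite gtr0_norm// in tt1 tt2 td.
  have Dz' : D z' by apply: inD zk'; rewrite (ltW t0) (ltW tt1).
  have [zy|zy] := ltP (enorm (z' - y)) d.
    by apply: dP => //; rewrite t0; lra.
  have [v0 _ _] := hv t0 Dz'.
  apply: (@le_trans _ _ (heat_kernel t z' y)); first by rewrite gerBl.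
  by apply: t2P; [rewrite t0|lra].
Qed.

(** A later leg: the lower bound known at time [s] is a kernel with pole [y'] at time [th], so the
    clock restarts at [th], and [o] is the centre of the ball extrapolated back to that time.
    Division of [v] by [k] reduces it to [moving_ball_bound]. *)
Lemma relay_stage kap th s t1 k o0 o1 y' : 0 < kap -> 0 <= th < s -> s < t1 ->
  t1 - th <= S * kap ^+ 2 -> 0 < k ->
  eball o0 kap `<=` D -> eball o1 kap `<=` D ->
  enorm (y' - (o0 - ((s - th) / (t1 - s)) *: (o1 - o0))) < kap ->
  (forall x, enorm (x - o0) <= kap -> D x /\ k * heat_kernel (s - th) x y' <= v s x) ->
  forall x, enorm (x - o1) < kap ->
  C * Num.min 1 ((kap - enorm (y' - (o0 - ((s - th) / (t1 - s)) *: (o1 - o0)))) *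
      (kap - enorm (x - o1)) / (t1 - th)) * (k * heat_kernel (t1 - th) x y') <= v t1 x.
Proof.
move=> k0 /andP[th0 ths] st t1S kk D0 D1; set o := o0 - _ => yo ini.
have ts : 0 < t1 - s by rewrite subr_gt0.
pose u := (t1 - s)^-1 *: (o1 - o0).
have cE t : center o u (t - th) = (1 - (t - s) / (t1 - s)) *: o0 + ((t - s) / (t1 - s)) *: o1.
  by rewrite /center /u /o scalerA; apply/rowP => i; rewrite !mxE; field; rewrite gt_eqF.
have cs : center o u (s - th) = o0.
  by rewrite cE subrr mul0r subr0 scale1r scale0r addr0.
have c1 : center o u (t1 - th) = o1.
  by rewrite cE mulfV ?gt_eqF// subrr scale0r add0r scale1r.
have inD t z : s <= t <= t1 -> enorm (z - center o u (t - th)) < kap -> D z.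
  move=> /andP[t0 tt] zk; have s01 : 0 <= (t - s) / (t1 - s) <= 1.
    by rewrite divr_ge0 ?subr_ge0 ?(ltW st)//= ler_pdivrMr// mul1r lerD2r.
  by apply: (moving_ball_sub k0 s01 D0 D1); rewrite /eball /= -cE.
(* The form [t - - th] fits the shift lemmas, which are stated for [t - s]. *)
pose v' t x := k^-1 * v (t - - th) x.
have vE t z : v' (t - th) z = k^-1 * v t z by rewrite /v' opprK subrK.
move=> x; rewrite -c1 => xk.
rewrite mulrCA -ler_pdivlMl// -vE.
apply: (@hC kap o u y' (s - th) (t1 - th) v' k0 yo) => //.
- by rewrite subr_ge0 (ltW ths) ltrD2r.
- move=> t z /andP[t0 tt] zk; have s_t : s < t - - th by rewrite opprK -ltrBlDr.
  have t_1 : t - - th <= t1 by rewrite opprK -lerBrDr.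
  have tp : 0 < t - - th by apply: lt_trans s_t; apply: le_lt_trans ths.
  have Dz : D z.
    by apply: (inD (t - - th)); [rewrite (ltW s_t)|rewrite opprK addrK].
  have [v0 cv hz] := hv tp Dz; split.
  + by rewrite mulr_ge0// invr_ge0 ltW.
  + by apply: continuousM; [exact: cst_continuous|exact: jointly_continuous_shift].
  + by apply: heat_atZ; exact: heat_at_shift.
- move=> z e e0; rewrite cs => zk; have [Dz kz] := ini z zk.
  have s0 : 0 < s by apply: le_lt_trans ths.
  have [_ cv _] := hv s0 Dz.
  have c : jointly_continuous_at (fun t z => heat_kernel t z y' - v' t z) (s - th) z.
    apply: continuousB; first by apply: jointly_continuous_kernel; rewrite subr_gt0.
    apply: continuousM; first exact: cst_continuous.
    by apply: jointly_continuous_shift; rewrite opprK subrK.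
  have : heat_kernel (s - th) z y' - v' (s - th) z < e.
    by rewrite (le_lt_trans _ e0)// subr_le0 vE ler_pdivlMl.
  by move/(cvgr_lt _ c); apply: filterS => q /ltW.
Qed.

(** Along the uniform motion [y + s *: V], a kernel started later from the point reached is more
    concentrated. The constant makes both sides equal at [y + s2 *: V]; elsewhere the exponents
    differ by a nonnegative multiple of the squared distance [dot ze ze] to that point. *)
Lemma kernel_shift_pole (V : 'rV[R]_n) s2 s' z : 0 < s' <= s2 ->
  heat_kernel s' z (y + (s2 - s') *: V) *
    expR (- (n%:R / 2) * (ln (4 * pi * s2) - ln (4 * pi * s')) - (s2 - s') * dot V V / 4) <=
  heat_kernel s2 z y.
Proof.
move=> /andP[s0 s'2]; have s20 : 0 < s2 by apply: lt_le_trans s'2.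
rewrite !heat_kernelE// -expRD ler_expR /logp.
pose ze := z - y - s2 *: V.
have -> : z - (y + (s2 - s') *: V) = ze + s' *: V by rewrite /ze; vring.
have -> : z - y = ze + s2 *: V by rewrite /ze; vring.
have dE a : dot (ze + a *: V) (ze + a *: V) = dot ze ze + 2 * a * dot V ze + a ^+ 2 * dot V V.
  by rewrite dotDl !(dotDr ze) !dotZl !dotZr (dotC ze V); ring.
rewrite !dE -subr_ge0.
set l2 := ln (4 * pi * s2); set l' := ln (4 * pi * s').
have -> : - (n%:R / 2) * l2 - (dot ze ze + 2 * s2 * dot V ze + s2 ^+ 2 * dot V V) / (4 * s2) -
  (- (n%:R / 2) * l' - (dot ze ze + 2 * s' * dot V ze + s' ^+ 2 * dot V V) / (4 * s') +
   (- (n%:R / 2) * (l2 - l') - (s2 - s') * dot V V / 4)) = dot ze ze * (s'^-1 - s2^-1) / 4.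
  by field; rewrite !gt_eqF.
by rewrite divr_ge0// mulr_ge0 ?dotxx_ge0// subr_ge0 lef_pV2 ?posrE.
Qed.

(** At the end of the motion the quadratic terms match, as [t = (s2 - s') + 3 s']. Only the
    normalization is lost: [3 s'] against [s'] costs [3 ^ (- n / 2)]. *)
Lemma kernel_unshift_pole (V : 'rV[R]_n) s2 s' t : 0 < s' -> 0 < s2 -> t = s2 + 2 * s' ->
  expR (- (n%:R / 2) * ln 3) * heat_kernel t (y + t *: V) y <=
  expR (- (n%:R / 2) * (ln (4 * pi * s2) - ln (4 * pi * s')) - (s2 - s') * dot V V / 4) *
    heat_kernel (3 * s') (y + t *: V) (y + (s2 - s') *: V).
Proof.
move=> s0 s20 tE; have t0 : 0 < t by rewrite tE addr_gt0// mulr_gt0.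
have p4 : 0 < 4 * pi :> R by rewrite mulr_gt0// pi_gt0.
rewrite !heat_kernelE ?mulr_gt0// -!expRD ler_expR /logp.
have -> : y + t *: V - y = t *: V by vring.
have -> : y + t *: V - (y + (s2 - s') *: V) = (3 * s') *: V by rewrite tE; vring.
rewrite !dotZl !dotZr.
have -> : ln (4 * pi * (3 * s')) = ln 3 + ln (4 * pi * s').
  have -> : 4 * pi * (3 * s') = 3 * (4 * pi * s') :> R by ring.
  by rewrite lnM ?posrE//; exact: mulr_gt0.
have lt2 : ln (4 * pi * s2) <= ln (4 * pi * t).
  rewrite ler_ln ?posrE; [|exact: mulr_gt0|exact: mulr_gt0].
  by rewrite ler_pM2l// tE lerDl mulr_ge0// ltW.
have := ler_wpM2l (divr_ge0 (ler0n R n) (ler0n R 2)) lt2.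
set l2 := ln (4 * pi * s2); set l' := ln (4 * pi * s'); set l := ln (4 * pi * t); set l3 := ln 3.
have -> : t * (t * dot V V) / (4 * t) = t * dot V V / 4 by field; rewrite gt_eqF.
have -> : 3 * s' * (3 * s' * dot V V) / (4 * (3 * s')) = 3 * s' * dot V V / 4 by field; rewrite gt_eqF.
by rewrite tE; lra.
Qed.

(* Three legs: a ball slides from the one touching at [y] to [m1], then along the
   segment to [m2], then to the one touching at [x]. The last leg uses as pole the
   point of the segment reached a little before [m2], so that the depth of the
   pole in the ball extrapolated backwards stays of order [kap]. *)
Lemma two_stations kap t lam mu x oy ox : 0 < kap -> 0 < t <= S * (kap / 8) ^+ 2 ->
  0 < lam <= 4^-1 -> 0 < mu <= 4^-1 ->
  eball ((1 - lam) *: y + lam *: x) kap `<=` D ->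
  eball ((1 - mu) *: x + mu *: y) kap `<=` D ->
  eball oy kap `<=` D -> enorm (y - oy) < kap ->
  eball ox (kap / 8) `<=` D -> enorm (x - ox) < kap / 8 ->
  C ^+ 3 / (6 * S) * expR (- (n%:R / 2) * ln 3) *
    (Num.min 1 ((kap - enorm (y - oy)) * kap / (lam * t)) *
     Num.min 1 ((kap / 8 - enorm (x - ox)) * kap / (mu * t))) * heat_kernel t x y <= v t x.
Proof.
move=> k0 /andP[t0 tS] /andP[l0 l4] /andP[m0 m4].
set m1 := (1 - lam) *: y + _; set m2 := (1 - mu) *: x + _.
move=> D1 D2 Doy yoy Dox xox.
have S0 : 0 < S by apply: lt_le_trans S8.
have k2 : 0 < kap ^+ 2 by rewrite exprn_gt0.
pose V := t^-1 *: (x - y).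
have xE : x = y + t *: V by rewrite /V scalerA mulfV ?gt_eqF// scale1r addrC subrK.
have m1E : m1 = y + (lam * t) *: V by rewrite /m1 xE; vring.
pose s2 := (1 - mu) * t.
have m2E : m2 = y + s2 *: V by rewrite /m2 /s2 xE; vring.
have s20 : 0 < s2 by rewrite mulr_gt0// subr_gt0; lra.
have s2t : s2 <= t by rewrite ler_piMl ?(ltW t0)// gerBl ltW.
have lt0 : 0 < lam * t by rewrite mulr_gt0.
have mt0 : 0 < mu * t by rewrite mulr_gt0.
have ls : lam * t < s2 by rewrite ltr_pM2r//; lra.
have t64 : t <= S * kap ^+ 2 / 64.
  by move: tS; rewrite exprMn -[(8^-1)^+2]/(8^-1 * 8^-1 : R); lra.
have tSk : t <= S * kap ^+ 2.
  by apply: le_trans t64 _; rewrite ler_pdivrMr// ler_peMr ?ler1n// mulr_ge0 ?(ltW k2) ?(ltW S0).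
set dy := kap - enorm (y - oy); have dy0 : 0 < dy by rewrite subr_gt0.
set dx := kap / 8 - enorm (x - ox); have dx0 : 0 < dx by rewrite subr_gt0.
pose M1 := Num.min 1 (dy * kap / (lam * t)).
have M10 : 0 < M1 by rewrite lt_min ltr01 divr_gt0// mulr_gt0.
(* Besides [C] for each leg, the first costs [1 / 2] for targets within [kap / 2] of [m1], the
   second [8 / S] and the third [1 / 24]; the product is [C ^+ 3 / (6 * S)]. *)
pose k1 := C * (2^-1 * M1).
have k10 : 0 < k1 by rewrite !mulr_gt0 ?invr_gt0.
(* The radii [kap], [kap / 2], [kap / 8] decrease so that each leg gives a bound on the closed ball
   where the next one starts. *)
have b1 z : enorm (z - m1) <= kap / 2 -> D z /\ k1 * heat_kernel (lam * t) z y <= v (lam * t) z.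
  move=> zm; have zm' : enorm (z - m1) < kap by apply: le_lt_trans zm _; lra.
  split; first exact: D1.
  have lS : 0 < lam * t <= S * kap ^+ 2.
    by rewrite lt0 (le_trans _ tSk)// ler_piMl ?(ltW t0)//; lra.
  apply: le_trans (pole_stage k0 lS Doy D1 yoy zm').
  apply: ler_wpM2r; first exact: heat_kernel_ge0.
  apply: ler_wpM2l; first exact: ltW.
  apply: min_one_scale; first by rewrite invr_ge0 ler0n invf_le1// ler1n.
  rewrite mulrA ler_pM2r ?invr_gt0// mulrCA ler_pM2l//; lra.
pose k2' := C * (8 / S) * k1.
have k20 : 0 < k2' by rewrite !mulr_gt0// invr_gt0.
have b2 z : enorm (z - m2) <= kap / 8 -> D z /\ k2' * heat_kernel s2 z y <= v s2 z.
  move=> zm; have zm' : enorm (z - m2) < kap / 2 by apply: le_lt_trans zm _; lra.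
  split; first by apply: D2; apply: lt_le_trans zm' _; lra.
  have kh : 0 < kap / 2 by rewrite divr_gt0.
  (* The second leg follows the uniform motion from [y] at time 0 to [x] at time [t]; extrapolated
     back to time 0 its centre is the pole, at full depth [kap / 2]. *)
  have oE : m1 - ((lam * t - 0) / (s2 - lam * t)) *: (m2 - m1) = y.
    rewrite m1E m2E; apply/rowP => i; rewrite !mxE; field.
    by rewrite gt_eqF//= gt_eqF// subr_gt0.
  have yo : enorm (y - (m1 - ((lam * t - 0) / (s2 - lam * t)) *: (m2 - m1))) < kap / 2.
    by rewrite oE subrr enorm0.
  have tS2 : s2 - 0 <= S * (kap / 2) ^+ 2.
    rewrite subr0 (le_trans s2t)// (le_trans t64)// exprMn -[(2^-1)^+2]/(2^-1 * 2^-1 : R).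
    by have := mulr_gt0 S0 k2; lra.
  have th : 0 <= (0 : R) < lam * t by rewrite lexx.
  have sub1 : eball m1 (kap / 2) `<=` D by apply: subset_trans D1; apply: eball_le; lra.
  have sub2 : eball m2 (kap / 2) `<=` D by apply: subset_trans D2; apply: eball_le; lra.
  have := @relay_stage (kap / 2) 0 (lam * t) s2 k1 m1 m2 y kh th ls tS2 k10 sub1 sub2 yo _ z zm'.
  rewrite oE subrr enorm0 !subr0 => /(_ b1); apply: le_trans.
  rewrite /k2' -[C * (8 / S) * k1 * _]mulrA; apply: ler_wpM2r.
    by rewrite mulr_ge0 ?heat_kernel_ge0// ltW.
  apply: ler_wpM2l; first exact: ltW.
  rewrite le_min ler_pdivrMr// mul1r S8 /= ler_pdivrMr//.
  rewrite mulrAC ler_pdivlMr//.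
  apply: (@le_trans _ _ ((kap / 2) * (kap / 4) * S)); last first.
    by rewrite ler_pM2r// ler_pM2l//; lra.
  have -> : kap / 2 * (kap / 4) * S = 8 * (S * kap ^+ 2 / 64) by field.
  by rewrite ler_pM2l// (le_trans s2t).
(* The last leg lasts [mu * t = 2 * s'] and its pole is set [s'] before its start. Extrapolation by
   half the leg puts the pole at distance [|x - ox| / 2] from the centre, less than half of the
   radius [kap / 8]. *)
pose s' := mu * t / 2.
have s'0 : 0 < s' by rewrite divr_gt0.
have s'2 : s' < s2.
  by rewrite /s' /s2 mulrAC ltr_pM2r//; lra.
have tE : t = s2 + 2 * s' by rewrite /s2 /s'; field.
pose q := - (n%:R / 2) * (ln (4 * pi * s2) - ln (4 * pi * s')) - (s2 - s') * dot V V / 4.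
pose y' := y + (s2 - s') *: V.
pose k3 := k2' * expR q.
have k30 : 0 < k3 by rewrite mulr_gt0// expR_gt0.
have r0 : 0 < kap / 8 by rewrite divr_gt0.
have s2s : s2 - (s2 - s') = s' by rewrite subKr.
have b3 z : enorm (z - m2) <= kap / 8 -> D z /\ k3 * heat_kernel (s2 - (s2 - s')) z y' <= v s2 z.
  move=> zm; have [Dz bz] := b2 z zm; split => //; apply: le_trans bz.
  rewrite s2s /k3 -mulrA ler_pM2l// mulrC; apply: kernel_shift_pole.
  by rewrite s'0 ltW.
have oE : y' - (m2 - ((s2 - (s2 - s')) / (t - s2)) *: (ox - m2)) = - (2^-1 *: (x - ox)).
  have -> : t - s2 = 2 * s' by rewrite tE addrC addKr.
  rewrite s2s m2E /y' xE tE; apply/rowP => i; rewrite !mxE; field.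
  by rewrite !gt_eqF.
have yo : enorm (y' - (m2 - ((s2 - (s2 - s')) / (t - s2)) *: (ox - m2))) < kap / 8.
  rewrite oE enormN enormZ ger0_norm ?invr_ge0//.
  by move: xox (enorm_ge0 (x - ox)); lra.
have tS3 : t - (s2 - s') <= S * (kap / 8) ^+ 2.
  by apply: le_trans tS; rewrite gerBl subr_ge0 ltW.
have th : 0 <= s2 - s' < s2 by rewrite subr_ge0 (ltW s'2) gtrBl.
have st : s2 < t by rewrite tE ltrDl mulr_gt0.
have sub2 : eball m2 (kap / 8) `<=` D by apply: subset_trans D2; apply: eball_le; lra.
have := @relay_stage (kap / 8) (s2 - s') s2 t k3 m2 ox y' r0 th st tS3 k30 sub2 Dox yo b3 x xox.
apply: le_trans; rewrite oE enormN enormZ ger0_norm ?invr_ge0//.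
have -> : t - (s2 - s') = 3 * s' by rewrite tE; ring.
have h1 : 24^-1 * Num.min 1 (dx * kap / (mu * t)) <=
    Num.min 1 ((kap / 8 - 2^-1 * enorm (x - ox)) * dx / (3 * s')).
  apply: min_one_scale; first by rewrite invr_ge0 ler0n invf_le1// ler1n.
  have -> : 24^-1 * (dx * kap / (mu * t)) = kap / 16 * dx / (3 * s').
    by rewrite /s'; field; rewrite !gt_eqF.
  rewrite ler_pM2r ?invr_gt0 ?mulr_gt0// ler_pM2r//.
  by move: xox; lra.
have h2 := kernel_unshift_pole V s'0 s20 tE; rewrite -xE -/q -/y' in h2.
set M2 := Num.min 1 (dx * kap / (mu * t)) in h1 *.
have M20 : 0 <= M2 by rewrite le_min ler01 divr_ge0 ?mulr_ge0 ?(ltW dx0) ?(ltW k0) ?(ltW m0) ?(ltW t0).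
apply: (@le_trans _ _ (C * (24^-1 * M2) * (k2' * (expR (- (n%:R / 2) * ln 3) * heat_kernel t x y)))).
  rewrite /k2' /k1 -/M1.
  rewrite [leRHS](_ : _ = C ^+ 3 / (6 * S) * expR (- (n%:R / 2) * ln 3) * (M1 * M2) * heat_kernel t x y) ?lexx//.
  by set X := expR _; set P := heat_kernel _ _ _; field; rewrite gt_eqF.
apply: ler_pM.
- by rewrite !mulr_ge0 ?(ltW C0).
- by apply: mulr_ge0; [exact: ltW|rewrite mulr_ge0 ?expR_ge0 ?heat_kernel_ge0].
- by rewrite ler_pM2l.
- rewrite /k3 -[leRHS]mulrA; apply: ler_wpM2l => //; exact: ltW.
Qed.

End Stations.

(** Each half-space factor is at most [(M + 1)] times the corresponding factor [X] or [Y], plus [Q].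
    In the product every term other than [X * Y] is at most a multiple of [Q], and
    [(M + 1)^2 + (2 M + 3) = (M + 2)^2]. *)
Lemma combine_bounds (R : realType) (V P K M t a b c H hw hz : R) : 0 < t -> 0 <= P -> 0 <= K -> 0 <= M ->
  0 <= a -> 0 <= c -> 0 <= b -> 0 <= H -> 0 <= hw -> 0 <= hz ->
  K * Num.min 1 (a * c / t) * P <= V ->
  K * (Num.min 1 (c * hw / t) * Num.min 1 (a * hz / t)) * P <= V ->
  b <= M * hz + c -> H <= M * hw + a ->
  K / (M + 2) ^+ 2 * (Num.min 1 (a * b / t) * Num.min 1 (c * H / t)) * P <= V.
Proof.
move=> t0 P0 K0 M0 a0 c0 b0 H0 hw0 hz0; set Q := Num.min 1 (a * c / t).
set X := Num.min 1 (c * hw / t); set Y := Num.min 1 (a * hz / t) => hQ hXY bM HM.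
have mle (f : R) : Num.min 1 f <= 1 by rewrite ge_min lexx.
have mge (f g : R) : 0 <= f -> 0 <= g -> 0 <= Num.min 1 (f * g / t).
  by move=> f0 g0; rewrite le_min ler01 divr_ge0 ?mulr_ge0// ltW.
have key (f g h k : R) : 0 <= f -> 0 <= h -> 0 <= k -> g <= M * h + k ->
    Num.min 1 (f * g / t) <= (M + 1) * Num.min 1 (f * h / t) + Num.min 1 (f * k / t).
  move=> f0 h0 k0 gM; have [h1|h1] := leP 1 (f * h / t).
    by apply: le_trans (mle _) _; rewrite mulr1 -addrA addrCA lerDl addr_ge0// mge.
  have [k1|k1] := leP 1 (f * k / t).
    apply: le_trans (mle _) _; rewrite lerDr mulr_ge0 ?addr_ge0//.
    by rewrite divr_ge0 ?mulr_ge0// ltW.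
  rewrite ge_min; apply/orP; right.
  have -> : (M + 1) * (f * h / t) + f * k / t = f * ((M + 1) * h + k) / t by field; rewrite gt_eqF.
  rewrite ler_pM2r ?invr_gt0// ler_wpM2l// (le_trans gM)// mulrDl mul1r; lra.
have eY := key a b hz c a0 hz0 c0 bM; have eX := key c H hw a c0 hw0 a0 HM.
rewrite (mulrC c a) -/Q -/X -/Y in eX eY.
have [Q0 X0 Y0] : [/\ 0 <= Q, 0 <= X & 0 <= Y] by split; exact: mge.
have [Q1 X1 Y1] : [/\ Q <= 1, X <= 1 & Y <= 1] by split; exact: mle.
have V0 : 0 <= V by apply: le_trans hQ; rewrite !mulr_ge0.
have M2 : 0 < M + 2 by rewrite ltr_wpDl.
apply: (@le_trans _ _ (K / (M + 2) ^+ 2 * ((M + 1) ^+ 2 * (X * Y) + (2 * M + 3) * Q) * P)).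
  apply: ler_wpM2r => //; apply: ler_wpM2l; first by rewrite divr_ge0// exprn_ge0// ltW.
  apply: (@le_trans _ _ (((M + 1) * Y + Q) * ((M + 1) * X + Q))).
    by apply: ler_pM => //; exact: mge.
  have QX : Q * X <= Q by rewrite ler_piMr.
  have QY : Q * Y <= Q by rewrite ler_piMr.
  have QQ : Q * Q <= Q by rewrite ler_piMr.
  have := ler_wpM2l (addr_ge0 M0 ler01) QX; have := ler_wpM2l (addr_ge0 M0 ler01) QY.
  by move: QQ; lra.
have -> : K / (M + 2) ^+ 2 * ((M + 1) ^+ 2 * (X * Y) + (2 * M + 3) * Q) * P =
  ((M + 1) ^+ 2 * (K * (X * Y) * P) + (2 * M + 3) * (K * Q * P)) / (M + 2) ^+ 2.
  by field; rewrite gt_eqF.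
rewrite ler_pdivrMr ?exprn_gt0//.
have h1 := ler_wpM2l (exprn_ge0 2 (addr_ge0 M0 ler01)) hXY.
have M3 : 0 <= 2 * M + 3 by rewrite addr_ge0// mulr_ge0.
have h2 := ler_wpM2l M3 hQ.
by move: h1 h2; lra.
Qed.

(** * Interior balls and the chord condition *)

Section Geometry.
Context {R : realType} {n : nat}.
Implicit Types (D : set 'rV[R]_n) (x y z w a o m : 'rV[R]_n) (r k rho kap s h : R).

Lemma nearest_point D r a k y : open D -> C11r r D -> 0 < r -> D y ->
  enorm a = 1 -> D `<=` halfspace a k -> delta D y = dot a y - k ->
  [/\ boundary D (y - delta D y *: a), dot a (y - delta D y *: a) = k &
    exists2 s, r <= s & eball (y - delta D y *: a + s *: a) s `<=` D].
Proof.
move=> oD [_ cD] r0 Dy a1 DH dy; have bw := boundary_proj oD Dy a1 DH dy.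
set w := _ - _ in bw *.
have wk : dot a w = k by rewrite /w dotBr dotZr (dotaa a1) mulr1 dy subKr.
split => //; have [[b [s [rs wb bD]]] _] := cD w bw; exists s => //.
have s0 : 0 < s by apply: lt_le_trans rs.
by rewrite -(interior_ball_normal a1 wk s0 (subset_trans bD DH) wb).
Qed.

(** A point deeper than [kap] is the centre of its own ball; otherwise the ball of radius [kap]
    touching the boundary at the foot of [y] lies in the interior ball there. *)
Lemma end_ball D r a k y kap : open D -> C11r r D -> D y ->
  enorm a = 1 -> D `<=` halfspace a k -> delta D y = dot a y - k ->
  0 < kap <= r -> exists2 o, eball o kap `<=` D &
    enorm (y - o) <= kap - Num.min (delta D y) kap.
Proof.
move=> oD cD Dy a1 DH dy /andP[k0 kr]; have r0 : 0 < r by apply: lt_le_trans kr.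
have [_ _ [s rs sD]] := nearest_point oD cD r0 Dy a1 DH dy.
set c := delta D y in sD *; have [ck|ck] := ltP c kap; last first.
  exists y; last by rewrite subrr enorm0 subrr.
  by apply: subset_trans (eball_delta oD Dy); exact: eball_le.
exists (y - c *: a + kap *: a).
  apply: subset_trans sD; apply: eball_sub.
  have -> : y - c *: a + kap *: a - (y - c *: a + s *: a) = (kap - s) *: a by vring.
  rewrite enormZ a1 mulr1 ler0_norm ?opprB//.
  by rewrite subr_le0 (le_trans kr).
have -> : y - (y - c *: a + kap *: a) = (c - kap) *: a by vring.
by rewrite enormZ a1 mulr1 ltr0_norm ?subr_lt0// opprB.
Qed.

(** Passage from the chord [w z] to the segment [y x]. If [h / 2] exceeds the displacement
    [(1 - s) * c + s * a], half of the ball survives; otherwise the balls at [y] and [x] themselves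
    supply radius [h / 2]. The homothety of ratio [sg] towards [y] then shrinks it. *)
Lemma transfer_ball D y x w z (c a s h sg : R) : convex D -> D y -> D x ->
  0 <= c -> 0 <= a -> eball y c `<=` D -> eball x a `<=` D ->
  enorm (y - w) <= c -> enorm (x - z) <= a ->
  0 <= s <= 1 -> 0 <= sg <= 1 -> 0 < h -> eball ((1 - s) *: w + s *: z) h `<=` D ->
  eball ((1 - s * sg) *: y + (s * sg) *: x) (sg * (h / 2)) `<=` D.
Proof.
move=> cD Dy Dx c0 a0 yD xD yw xz s01 g01 h0 mD.
set m := (1 - s) *: w + s *: z in mD; pose q := (1 - s) *: y + s *: x.
have Dq : D q by apply: cD.
have /andP[s0 s1] := s01.
have qD : eball q (h / 2) `<=` D.
  have [hr|hr] := leP (h / 2) ((1 - s) * c + s * a).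
    apply: subset_trans (convex_eball cD Dy Dx c0 a0 s01 yD xD).
    exact: eball_le.
  apply: subset_trans mD; apply: eball_sub.
  have -> : q - m = (1 - s) *: (y - w) + s *: (x - z) by rewrite /q /m; vring.
  apply: (@le_trans _ _ ((1 - s) * c + s * a)); last by move: hr; lrac.
  rewrite (le_trans (enormD _ _))// !enormZ (ger0_norm s0) ger0_norm ?subr_ge0//.
  by rewrite lerD// ler_wpM2l// subr_ge0.
have h20 : 0 <= h / 2 by rewrite divr_ge0// ltW.
have y0 : eball y 0 `<=` D by move=> p; rewrite /eball /= ltNge enorm_ge0.
have := convex_eball cD Dy Dq (lexx 0) h20 g01 y0 qD.
rewrite mulr0 add0r; have -> // : (1 - sg) *: y + sg *: q = (1 - s * sg) *: y + (s * sg) *: x.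
by rewrite /q; vring.
Qed.

Section Stations.
Variables (D : set 'rV[R]_n) (rho : R) (w z a : 'rV[R]_n) (k : R).
Hypotheses (oD : open D) (sD : strictly_convex D) (rho0 : 0 < rho) (hrho : RD D = rho%:E).
Hypotheses (bw : boundary D w) (bz : boundary D z) (wz : w <> z).
Hypotheses (a1 : enorm a = 1) (DH : D `<=` halfspace a k) (wk : dot a w = k).
Hypothesis tw : tangent_halfspace D w = halfspace a k.

Lemma segment_interior s : 0 < s < 1 -> D ((1 - s) *: w + s *: z).
Proof.
by move=> s01; rewrite -(interior_id D).1//; apply: sD => //; [case: bw|case: bz].
Qed.

Lemma ratioE s : 0 < s < 1 -> distance_ratio D w ((1 - s) *: w + s *: z) =
  delta D ((1 - s) *: w + s *: z) / (s * (dot a z - k)).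
Proof.
move=> s01; rewrite /distance_ratio tw; congr (_ / _).
rewrite delta_halfspace//; last exact: DH (segment_interior s01).
by rewrite dotDr !dotZr wk; ring.
Qed.

Lemma midpointE : midpoint w z = (1 - 2^-1) *: w + 2^-1 *: z.
Proof. by rewrite /midpoint; apply/rowP => i; rewrite !mxE; field. Qed.

Lemma half01 : 0 < (2^-1 : R) < 1.
Proof. by rewrite invr_gt0 ltr0n invf_lt1// ltr1n. Qed.

Lemma depth_gt0 : 0 < dot a z - k.
Proof.
have := DH (segment_interior half01); rewrite /halfspace /= dotDr !dotZr wk.
by rewrite -subr_gt0 => h; lra.
Qed.

(** At the midpoint the distance to the tangent hyperplane at [w] is half the depth of [z], whence
    [rho / 2]. *)
Lemma RD_near : delta D (midpoint w z) <= 1 ->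
  rho / 2 * (dot a z - k) <= delta D (midpoint w z).
Proof.
move=> h1; have z0 := depth_gt0.
have : (RD D <= (distance_ratio D w (midpoint w z))%:E)%E.
  rewrite /RD ge_min; apply/orP; left; apply: ge_ereal_inf.
  by exists (distance_ratio D w (midpoint w z))%:E => //; exists w, z.
rewrite hrho lee_fin midpointE (ratioE half01) ler_pdivlMr ?mulr_gt0// ?invr_gt0//.
by rewrite mulrA.
Qed.

(** The supremum over the chord need not be attained, so a point with ratio above [rho / 2 < rho] is
    taken. It is not an endpoint, where [delta D] is at most 0. *)
Lemma RD_far : 1 < delta D (midpoint w z) -> exists s h, [/\ 0 < s <= 1, 1 < h,
  eball ((1 - s) *: w + s *: z) h `<=` D & rho / 2 * (s * (dot a z - k)) <= h].
Proof.
move=> h1; have z0 := depth_gt0.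
set A := [set (distance_ratio D w m)%:E | m in [set m | segment w z m /\ 1 < delta D m]].
have : (RD D <= ereal_sup A)%E.
  rewrite /RD ge_min; apply/orP; right; apply: ge_ereal_inf.
  by exists (ereal_sup A) => //; exists w, z.
rewrite hrho => rA; have : ((rho / 2)%:E < ereal_sup A)%E.
  by apply: lt_le_trans rA; rewrite lte_fin ltr_pdivrMr// ltr_pMr// ltr1n.
move/ereal_sup_gt => [_ [m [[s /= /andP[s0 s1] <-] m1] <-]].
have bd u : boundary D u -> ~ (1 < delta D u).
  by move=> /delta_boundary u0 u1; have := lt_le_trans (lt_trans ltr01 u1) u0; rewrite ltxx.
have s0' : 0 < s.
  rewrite lt_neqAle s0 andbT; apply/eqP => s00; move: m1; rewrite -s00 subr0 scale1r scale0r addr0.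
  exact: bd.
have s1' : s < 1.
  rewrite lt_neqAle s1 andbT; apply/eqP => s11; move: m1; rewrite s11 subrr scale0r scale1r add0r.
  exact: bd.
have s01 : 0 < s < 1 by rewrite s0'.
rewrite lte_fin (ratioE s01) ltr_pdivlMr ?mulr_gt0// => /ltW hr.
exists s, (delta D ((1 - s) *: w + s *: z)); split => //; first by rewrite s0'.
exact: eball_delta oD (segment_interior s01).
Qed.

End Stations.

End Geometry.

Section LowerBound.
Context {R : realType} {n : nat}.
Implicit Types (D : set 'rV[R]_n) (x y z w a o m : 'rV[R]_n).

Lemma station_bounds (k0 : R) : 0 < k0 <= 1 -> exists2 K : R, 0 < K &
  forall D y v, open D -> convex D -> D y ->
  (forall t x, 0 < t -> D x -> [/\ 0 <= v t x, jointly_continuous_at v t x & heat_at v t x]) ->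
  (forall e, 0 < e -> exists2 d, 0 < d & forall t x, 0 < t < d ->
    enorm (x - y) < d -> heat_kernel t x y - v t x <= e) ->
  forall t x (a c kap : R), 0 < t -> kap = k0 * Num.sqrt t -> 0 < a -> 0 < c -> D x ->
  eball x a `<=` D -> eball y c `<=` D ->
  (forall k : R, 0 < k <= kap -> exists2 o, eball o k `<=` D & enorm (y - o) <= k - Num.min c k) ->
  (forall k : R, 0 < k <= kap -> exists2 o, eball o k `<=` D & enorm (x - o) <= k - Num.min a k) ->
  K * Num.min 1 (a * c / t) * heat_kernel t x y <= v t x /\
  forall lam mu : R, 0 < lam <= 4^-1 -> 0 < mu <= 4^-1 ->
    eball ((1 - lam) *: y + lam *: x) kap `<=` D ->
    eball ((1 - mu) *: x + mu *: y) kap `<=` D ->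
    K * (Num.min 1 (c * (kap / lam) / t) * Num.min 1 (a * (kap / mu) / t)) *
      heat_kernel t x y <= v t x.
Proof.
(* Chosen so that [t = S * (kap / 8) ^+ 2], the time allowed for the smallest ball in
   [two_stations]. *)
move=> /andP[k00 k01]; pose S := 64 / k0 ^+ 2.
have k02 : 0 < k0 ^+ 2 by rewrite exprn_gt0.
have k02' : k0 ^+ 2 <= 1 by rewrite expr_le1// ltW.
have S8 : 8 <= S by rewrite ler_pdivlMr//; move: k02'; lra.
have S0 : 0 < S by apply: lt_le_trans S8.
have [C C0 hC] := @ball_lower_bound R n S (ltW S0).
pose C1' := C ^+ 3 / (6 * S) * expR (- (n%:R / 2) * ln 3).
have C1'0 : 0 < C1' by rewrite mulr_gt0 ?expR_gt0// divr_gt0 ?exprn_gt0// mulr_gt0.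
pose C2 := C1' * (k0 ^+ 2 * (k0 ^+ 2 / 8)).
have C20 : 0 < C2 by apply: mulr_gt0 => //; apply: mulr_gt0 => //; exact: divr_gt0.
pose K := Num.min (C / 16) (C2 * k0 ^+ 2).
have K0 : 0 < K by rewrite lt_min divr_gt0// mulr_gt0.
exists K => // D y v oD cD Dy hv hi t x a c kap t0 kE a0 c0 Dx xD yD ey ex.
have kp : 0 < kap by rewrite kE mulr_gt0// sqrtr_gt0.
have k2 : kap ^+ 2 = k0 ^+ 2 * t by rewrite kE exprMn sqr_sqrtr// ltW.
have tS : 0 < t <= S * (kap / 8) ^+ 2.
  rewrite t0 expr_div_n k2 /S.
  have -> : 64 / k0 ^+ 2 * (k0 ^+ 2 * t / 8 ^+ 2) = t by field; rewrite gt_eqF.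
  exact: lexx.
have tS' : 0 < t <= S * kap ^+ 2.
  rewrite t0 k2 /S mulrA divfK ?gt_eqF//; rewrite ler_peMl ?(ltW t0)//.
  by rewrite ler1n.
have p0 := heat_kernel_ge0 t x y; set p := heat_kernel t x y in p0 *.
have km : 0 < kap <= kap by rewrite kp lexx.
have k8 : 0 < kap / 8 <= kap by rewrite divr_gt0//= ler_pdivrMr// ler_peMr ?(ltW kp)// ler1n.
have min0 (f g : R) : 0 <= f -> 0 <= g -> 0 <= Num.min 1 (f * g / t).
  by move=> f0 g0; rewrite le_min ler01 divr_ge0 ?mulr_ge0// ltW.
have near_end (z o : 'rV[R]_n) (k d : R) : 0 < d -> 0 < k -> enorm (z - o) <= k - Num.min d k ->
    enorm (z - o) < k /\ Num.min d k <= k - enorm (z - o).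
  move=> d0 k0' h; have m0 : 0 < Num.min d k by rewrite lt_min d0.
  by split; move: m0 h; lra.
have scale (u d k q : R) : 0 <= u <= 1 -> 0 < d -> 0 < k -> 0 < q -> u <= k * kap / (q * t) ->
    forall e : R, Num.min d k <= e ->
    u * Num.min 1 (d * (kap / q) / t) <= Num.min 1 (e * kap / (q * t)).
  move=> /andP[u0 u1] d0 k0' q0 uk e me.
  have E (f : R) : f * (kap / q) / t = f * kap / (q * t) by field; rewrite !gt_eqF.
  apply: (@le_trans _ _ (Num.min 1 (Num.min d k * kap / (q * t)))); last first.
    rewrite le_min ge_min lexx /= ge_min; apply/orP; right.
    by rewrite ler_pM2r ?invr_gt0 ?mulr_gt0// ler_pM2r.
  have [dk|dk] := leP d k.
    apply: min_one_scale; first by rewrite u0.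
    rewrite E ler_piMl// divr_ge0 ?mulr_ge0 ?(ltW d0) ?(ltW kp) ?(ltW q0) ?(ltW t0)//.
  rewrite le_min; apply/andP; split.
    by apply: le_trans u1; rewrite ler_piMr// ge_min lexx.
  by apply: le_trans uk; rewrite ler_piMr// ge_min lexx.
have F1 lam mu : 0 < lam <= 4^-1 -> 0 < mu <= 4^-1 ->
    eball ((1 - lam) *: y + lam *: x) kap `<=` D ->
    eball ((1 - mu) *: x + mu *: y) kap `<=` D ->
    C2 * (Num.min 1 (c * (kap / lam) / t) * Num.min 1 (a * (kap / mu) / t)) * p <= v t x.
  move=> hl hm D1 D2; have [oy oyD /(near_end _ _ _ _ c0 kp)[yo my]] := ey _ km.
  have k80 : 0 < kap / 8 by case/andP: k8.
  have [ox oxD /(near_end _ _ _ _ a0 k80)[xo mx]] := ex _ k8.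
  have := two_stations C0 S8 hC cD hv hi kp tS hl hm D1 D2 oyD yo oxD xo.
  apply: le_trans; rewrite -/p -/C1'; apply: ler_wpM2r => //.
  rewrite /C2 -mulrA ler_pM2l//.
  case/andP: hl => l0 l4; case/andP: hm => m0 m4.
  have l1 : lam <= 1 by move: l4; lra.
  have m1 : mu <= 1 by move: m4; lra.
  have h1 : k0 ^+ 2 * Num.min 1 (c * (kap / lam) / t) <= Num.min 1 ((kap - enorm (y - oy)) * kap / (lam * t)).
    apply: (scale _ c kap) => //; first by rewrite (ltW k02).
    rewrite -expr2 k2; have -> : k0 ^+ 2 * t / (lam * t) = k0 ^+ 2 / lam by field; rewrite !gt_eqF.
    by rewrite ler_peMr ?(ltW k02)// invr_ge1 ?unitf_gt0// l0.
  have h2 : k0 ^+ 2 / 8 * Num.min 1 (a * (kap / mu) / t) <= Num.min 1 ((kap / 8 - enorm (x - ox)) * kap / (mu * t)).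
    apply: (scale _ a (kap / 8)) => //.
      by rewrite divr_ge0 ?(ltW k02)//= ler_pdivrMr// mul1r (le_trans k02')// ler1n.
    have -> : kap / 8 * kap / (mu * t) = k0 ^+ 2 / 8 / mu.
      have -> : kap / 8 * kap / (mu * t) = kap ^+ 2 / (8 * (mu * t)) by field; rewrite !gt_eqF.
      by rewrite k2; field; rewrite !gt_eqF.
    by rewrite ler_peMr ?divr_ge0 ?(ltW k02)// invr_ge1 ?unitf_gt0// m0.
  rewrite mulrACA; apply: ler_pM => //; rewrite mulr_ge0 ?divr_ge0 ?(ltW k02)//.
    by rewrite min0 ?(ltW c0)// divr_ge0// ltW.
  by rewrite min0 ?(ltW a0)// divr_ge0// ltW.
have KC2 : K <= C2 by rewrite ge_min; apply/orP; right; rewrite ler_piMr// ltW.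
split; last first.
  move=> lam mu hl hm D1 D2; apply: le_trans (F1 lam mu hl hm D1 D2).
  case/andP: hl => l0 l4; case/andP: hm => m0 m4.
  apply: ler_wpM2r => //; apply: ler_wpM2r => //.
  by rewrite mulr_ge0// min0 ?(ltW a0) ?(ltW c0)// divr_ge0// ltW.
have Q0 : 0 <= Num.min 1 (a * c / t) by rewrite min0// ltW.
have far (Z : R) : k0 ^+ 2 * Num.min 1 (a * c / t) <= Z -> C2 * Z * p <= v t x ->
    K * Num.min 1 (a * c / t) * p <= v t x.
  move=> h; apply: le_trans; apply: ler_wpM2r => //.
  apply: (@le_trans _ _ (C2 * (k0 ^+ 2 * Num.min 1 (a * c / t)))); last by rewrite ler_pM2l.
  by rewrite mulrA ler_wpM2r// ge_min lexx orbT.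
have q4 : 0 < (4^-1 : R) <= 4^-1 by rewrite invr_gt0 ltr0n lexx.
have q401 : 0 <= (4^-1 : R) <= 1 by rewrite invr_ge0 ler0n invf_le1// ler1n.
have x0D (z : 'rV[R]_n) : eball z 0 `<=` D by move=> q; rewrite /eball /= ltNge enorm_ge0.
have big (d : R) : 4 * kap < d -> 0 < kap / d <= 4^-1 /\ k0 ^+ 2 <= Num.min 1 (d * (kap / 4^-1) / t).
  move=> d4; have d0 : 0 < d by apply: lt_trans d4; rewrite mulr_gt0.
  split; first by rewrite divr_gt0//= ler_pdivrMr//; move: d4; lra.
  rewrite le_min k02' /= ler_pdivlMr// -k2 expr2 invrK.
  have -> : d * (kap * 4) = kap * (4 * d) by ring.
  by rewrite ler_pM2l//; move: d4 d0; lra.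
(* An end deeper than [4 * kap] supplies both stations: the hull of its ball and the other end has
   radius [kap] at fraction [kap / a] from that other end, and radius above [kap] at fraction 1/4
   from the deep end. *)
have [a4|a4] := ltP (4 * kap) a.
  have [hl hb] := big a a4; have la0 : 0 < kap / a by case/andP: hl.
  have kd1 : 0 <= kap / a <= 1 by case/andP: hl => h1 h2; rewrite (ltW h1) (le_trans h2)// invf_le1// ler1n.
  have D1 : eball ((1 - kap / a) *: y + (kap / a) *: x) kap `<=` D.
    have := convex_eball cD Dy Dx (lexx 0) (ltW a0) kd1 (x0D y) xD.
    by rewrite mulr0 add0r divfK// gt_eqF.
  have D2 : eball ((1 - 4^-1) *: x + 4^-1 *: y) kap `<=` D.
    have := convex_eball cD Dx Dy (ltW a0) (lexx 0) q401 xD (x0D y).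
    apply: subset_trans; apply: eball_le; rewrite mulr0 addr0; move: a4; lra.
  apply: (far _ _ (F1 _ _ hl q4 D1 D2)).
  have -> : kap / (kap / a) = a by field; rewrite !gt_eqF.
  by rewrite (mulrC c) [leRHS]mulrC; apply: ler_wpM2r.
have [c4|c4] := ltP (4 * kap) c.
  have [hl hb] := big c c4; have la0 : 0 < kap / c by case/andP: hl.
  have kd1 : 0 <= kap / c <= 1 by case/andP: hl => h1 h2; rewrite (ltW h1) (le_trans h2)// invf_le1// ler1n.
  have D1 : eball ((1 - kap / c) *: x + (kap / c) *: y) kap `<=` D.
    have := convex_eball cD Dx Dy (lexx 0) (ltW c0) kd1 (x0D x) yD.
    by rewrite mulr0 add0r divfK// gt_eqF.
  have D2 : eball ((1 - 4^-1) *: y + 4^-1 *: x) kap `<=` D.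
    have := convex_eball cD Dy Dx (ltW c0) (lexx 0) q401 yD (x0D x).
    apply: subset_trans; apply: eball_le; rewrite mulr0 addr0; move: c4; lra.
  apply: (far _ _ (F1 _ _ q4 hl D2 D1)).
  have -> : kap / (kap / c) = c by field; rewrite !gt_eqF.
  by apply: ler_wpM2r.
(* Both depths are now at most [4 * kap], so each is at most 4 times the depth in a ball of radius
   [kap]. A single sliding ball suffices, at the cost of a factor 16. *)
have [oy oyD /(near_end _ _ _ _ c0 kp)[yo my]] := ey _ km.
have [ox oxD /(near_end _ _ _ _ a0 kp)[xo mx]] := ex _ km.
apply: le_trans (pole_stage hC cD hv hi kp tS' oyD oxD yo xo).
apply: ler_wpM2r => //.
apply: (@le_trans _ _ (C * (16^-1 * Num.min 1 (a * c / t)))).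
  by rewrite mulrA ler_wpM2r// ge_min lexx.
rewrite ler_pM2l//; apply: min_one_scale; first by rewrite invr_ge0 ler0n invf_le1// ler1n.
rewrite mulrA ler_pM2r ?invr_gt0//.
have q (d : R) : 0 < d -> d <= 4 * kap -> d / 4 <= Num.min d kap.
  by move=> d0 dk; rewrite le_min ler_pdivrMr// ler_peMr ?(ltW d0) ?ler1n//= ler_pdivrMr// mulrC.
have -> : 16^-1 * (a * c) = c / 4 * (a / 4) by field.
apply: ler_pM; rewrite ?divr_ge0 ?(ltW a0) ?(ltW c0)//.
  exact: le_trans (q c c0 c4) my.
exact: le_trans (q a a0 a4) mx.
Qed.

End LowerBound.

(** * Choice of the stations *)

Section Assembly.
Context {R : realType} {n : nat}.
Implicit Types (D : set 'rV[R]_n) (x y z w a o m : 'rV[R]_n).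

Lemma pD_lower (r T rho : R) : 0 < r -> 0 < T -> 0 < rho -> exists2 c1 : R, 0 < c1 &
  forall D pD ax ay (kx ky : R) x y t, open D -> strictly_convex D -> C11r r D ->
  RD D = rho%:E -> dirichlet_heat_kernel D pD -> D x -> D y -> 0 < t < T ->
  enorm ax = 1 -> enorm ay = 1 -> D `<=` halfspace ax kx -> D `<=` halfspace ay ky ->
  delta D x = dot ax x - kx -> delta D y = dot ay y - ky ->
  c1 * (Num.min 1 ((dot ax x - kx) * (dot ay y - ky) / t) +
    Num.min 1 ((dot ax x - kx) * (dot ax y - kx) / t) *
    Num.min 1 ((dot ay y - ky) * (dot ay x - ky) / t)) * heat_kernel t x y <= pD t x y.
Proof.
(* [kap <= r] makes the end balls fit in the interior balls; [kap <= 1/8] keeps the fractions below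
   1/4 when the chord carries a ball of radius [h > 1]. *)
move=> r0 T0 rho0; pose r8 := Num.min r 8^-1.
have r80 : 0 < r8 by rewrite lt_min r0 invr_gt0 ltr0n.
have sT : 0 < Num.sqrt T by rewrite sqrtr_gt0.
pose k0 := Num.min 1 (r8 / Num.sqrt T).
have k01 : 0 < k0 <= 1 by rewrite lt_min ltr01 divr_gt0//= ge_min lexx.
have [K K0 KP] := @station_bounds R n k0 k01; pose M := 4 / rho.
have M0 : 0 <= M by rewrite divr_ge0// ltW.
have M20 : 0 < M + 2 by rewrite ltr_wpDl.
pose K1 := K / 16; pose K2 := K1 / (M + 2) ^+ 2.
have K10 : 0 < K1 by rewrite divr_gt0.
have K20 : 0 < K2 by rewrite divr_gt0// exprn_gt0.
have K1K : K1 <= K by rewrite ler_pdivrMr// ler_peMr ?(ltW K0)// ler1n.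
have K21 : K2 <= K1.
  rewrite ler_pdivrMr ?exprn_gt0// ler_peMr ?(ltW K10)// expr2.
  by have := mulr_ge0 M0 M0; move: M0; lra.
exists (K2 / 2); first by rewrite divr_gt0.
move=> D pD ax ay kx ky x y t oD sD cD hrho dk Dx Dy /andP[t0 tT] ax1 ay1 DHx DHy dx dy.
have cvD := strictly_convexW oD sD.
have [[pD0 hpD pphi] _ _] := dk y Dy.
set a := dot ax x - kx in dx *; set c := dot ay y - ky in dy *.
set b := dot ax y - kx; set H := dot ay x - ky.
have pos1 z : D z -> 0 < dot ax z - kx by move/DHx; rewrite subr_gt0.
have pos2 z : D z -> 0 < dot ay z - ky by move/DHy; rewrite subr_gt0.
have a0 : 0 < a := pos1 x Dx; have b0 : 0 < b := pos1 y Dy.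
have c0 : 0 < c := pos2 y Dy; have H0 : 0 < H := pos2 x Dx.
pose kap := k0 * Num.sqrt t.
have st0 : 0 < Num.sqrt t by rewrite sqrtr_gt0.
have kap0 : 0 < kap by case/andP: k01 => k00 _; rewrite mulr_gt0.
have kap8 : kap <= r8.
  apply: (@le_trans _ _ (r8 / Num.sqrt T * Num.sqrt T)); last by rewrite divfK// gt_eqF.
  apply: ler_pM; [by case/andP: k01 => /ltW|exact: ltW|by rewrite ge_min lexx orbT|].
  by rewrite ler_wsqrtr// ltW.
have kapr : kap <= r by rewrite (le_trans kap8)// ge_min lexx.
have kap18 : kap <= 8^-1 by rewrite (le_trans kap8)// ge_min lexx orbT.
have xD : eball x a `<=` D by rewrite -dx; exact: eball_delta.
have yD : eball y c `<=` D by rewrite -dy; exact: eball_delta.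
have ends z u (k d : R) : D z -> enorm u = 1 -> D `<=` halfspace u k -> delta D z = dot u z - k ->
    d = dot u z - k -> forall k' : R, 0 < k' <= kap ->
    exists2 o, eball o k' `<=` D & enorm (z - o) <= k' - Num.min d k'.
  move=> Dz u1 DH dz dE k' /andP[k'0 k'k]; rewrite dE -dz; apply: end_ball oD cD Dz u1 DH dz _.
  by rewrite k'0 (le_trans k'k).
have hv s z : 0 < s -> D z -> [/\ 0 <= pD s z y, jointly_continuous_at (fun t x => pD t x y) s z &
    heat_at (fun t x => pD t x y) s z].
  move=> s0 Dz; split; [exact: pD0|by have [] := hpD s z s0 Dz|exact: heat_solution_at oD hpD s0 Dz].
have hi := initial_trace oD Dy (And3 pD0 hpD pphi) (fun s z s0 Dz => pD_le_kernel oD dk s0 Dz Dy).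
have [Qb F1] := KP D y (fun t x => pD t x y) oD cvD Dy hv hi t x a c kap t0 erefl a0 c0 Dx xD yD
  (ends y ay ky c Dy ay1 DHy dy erefl) (ends x ax kx a Dx ax1 DHx dx erefl).
have p0 := heat_kernel_ge0 t x y; set p := heat_kernel t x y in p0 Qb F1 *.
have [bw wk [sw rsw swD]] := nearest_point oD cD r0 Dy ay1 DHy dy.
have [bz zk [sz rsz szD]] := nearest_point oD cD r0 Dx ax1 DHx dx.
rewrite dy in bw wk swD; rewrite dx in bz zk szD.
set w := y - c *: ay in bw wk swD; set z := x - a *: ax in bz zk szD.
have yw : enorm (y - w) <= c by rewrite /w subKr enormZ ay1 mulr1 ger0_norm// ltW.
have xz : enorm (x - z) <= a by rewrite /z subKr enormZ ax1 mulr1 ger0_norm// ltW.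
have HE : H <= (dot ay z - ky) + a.
  have -> : H = dot ay z - ky + dot ay (x - z) by rewrite /H dotBr; ring.
  by rewrite lerD2l (le_trans (dot_le_unit _ ay1)).
have bE : b <= (dot ax w - kx) + c.
  have -> : b = dot ax w - kx + dot ax (y - w) by rewrite /b dotBr; ring.
  by rewrite lerD2l (le_trans (dot_le_unit _ ax1)).
have Q0 : 0 <= Num.min 1 (a * c / t) by rewrite le_min ler01 divr_ge0 ?mulr_ge0 ?(ltW a0) ?(ltW c0) ?(ltW t0).
have Qb1 : K1 * Num.min 1 (a * c / t) * p <= pD t x y.
  by apply: le_trans Qb; apply: ler_wpM2r => //; apply: ler_wpM2r.
have F1' lam mu hw hz : 0 < hw -> 0 < hz -> lam = kap / hw -> mu = kap / hz ->
    lam <= 4^-1 -> mu <= 4^-1 ->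
    eball ((1 - lam) *: y + lam *: x) kap `<=` D ->
    eball ((1 - mu) *: x + mu *: y) kap `<=` D ->
    K1 * (Num.min 1 (c * hw / t) * Num.min 1 (a * hz / t)) * p <= pD t x y.
  move=> hw0 hz0 lE mE l4 m4 D1 D2.
  have hl : 0 < lam <= 4^-1 by rewrite l4 andbT lE divr_gt0.
  have hm : 0 < mu <= 4^-1 by rewrite m4 andbT mE divr_gt0.
  have := F1 lam mu hl hm D1 D2.
  have -> : kap / lam = hw by rewrite lE; field; rewrite !gt_eqF.
  have -> : kap / mu = hz by rewrite mE; field; rewrite !gt_eqF.
  apply: le_trans; apply: ler_wpM2r => //; apply: ler_wpM2r => //.
  by rewrite mulr_ge0// le_min ler01 divr_ge0 ?mulr_ge0 ?(ltW c0) ?(ltW a0) ?(ltW hw0) ?(ltW hz0) ?(ltW t0).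
(* [hw] and [hz] play the role of [kap / lam] and [kap / mu]. Only the depths of the boundary points
   [z] and [w] have to be bounded: by [HE] and [bE] those of [x] and [y] exceed them by at most [a]
   and [c], which [combine_bounds] charges to the first term. *)
have fin hw hz : 0 <= hw -> 0 <= hz -> dot ay z - ky <= M * hw -> dot ax w - kx <= M * hz ->
    K1 * (Num.min 1 (c * hw / t) * Num.min 1 (a * hz / t)) * p <= pD t x y ->
    K2 / 2 * (Num.min 1 (a * c / t) + Num.min 1 (a * b / t) * Num.min 1 (c * H / t)) * p <= pD t x y.
  move=> hw0 hz0 hwM hzM XY.
  have bM : b <= M * hz + c by apply: le_trans bE _; rewrite lerD2r.
  have HM : H <= M * hw + a by apply: le_trans HE _; rewrite lerD2r.
  have := combine_bounds t0 p0 (ltW K10) M0 (ltW a0) (ltW c0) (ltW b0) (ltW H0) hw0 hz0 Qb1 XY bM HM.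
  rewrite -/K2 => h1; have h2 : K2 * Num.min 1 (a * c / t) * p <= pD t x y.
    by apply: le_trans Qb1; apply: ler_wpM2r => //; apply: ler_wpM2r.
  by move: h1 h2; lrac.
(* A common projection lies on both hyperplanes, so both depths are 0. *)
have [wz|/eqP wz] := eqVneq w z.
  apply: (fin 0 0) => //; rewrite ?mulr0 ?mul0r -?wz ?wk ?subrr// ?wz ?zk ?subrr//.
  have -> : Num.min 1 (0 : R) = 0 by apply/min_idPr.
  by rewrite mulr0 mulr0 mul0r; exact: pD0.
have sw0 : 0 < sw by apply: lt_le_trans rsw.
have sz0 : 0 < sz by apply: lt_le_trans rsz.
have tw := tangent_halfspaceE oD ay1 bw wk DHy sw0 swD.
have tz := tangent_halfspaceE oD ax1 bz zk DHx sz0 szD.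
have zw : z <> w by move=> zw; apply: wz.
have midC : midpoint z w = midpoint w z by rewrite /midpoint addrC.
have etaz : 0 < dot ay z - ky by exact: depth_gt0 oD sD bw bz wz DHy wk.
have xiw : 0 < dot ax w - kx by exact: depth_gt0 oD sD bz bw zw DHx zk.
have trw s sg h := @transfer_ball R n D y x w z c a s h sg cvD Dy Dx (ltW c0) (ltW a0) yD xD yw xz.
have trz s sg h := @transfer_ball R n D x y z w a c s h sg cvD Dx Dy (ltW a0) (ltW c0) xD yD xz yw.
have [h1|h1] := leP (delta D (midpoint w z)) 1.
  set h := delta D (midpoint w z) in h1.
  have hw : rho / 2 * (dot ay z - ky) <= h by exact: (RD_near oD sD hrho bw bz wz ay1 DHy wk tw).
  have hz : rho / 2 * (dot ax w - kx) <= h.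
    by rewrite /h -midC; apply: (RD_near oD sD hrho bz bw zw ax1 DHx zk tz); rewrite midC.
  have h0 : 0 < h by apply: lt_le_trans hw; rewrite mulr_gt0// divr_gt0.
  have toM (u : R) : 0 < u -> rho / 2 * u <= h -> u <= M * h.
    move=> u0 uh; rewrite /M mulrAC ler_pdivlMr//.
    by move: uh h0; lrac.
  apply: (fin h h); [exact: ltW|exact: ltW|exact: toM|exact: toM|].
  (* If [h < 4 * kap], then [h ^+ 2 <= 16 * t] and the product of the two minima is at most 16 times
     [1 /\ a c / t], so [Qb] suffices. This is the 16 in [K1]. *)
  have [hk|hk] := leP (4 * kap) h; last first.
    apply: le_trans Qb; apply: ler_wpM2r => //.
    rewrite /K1 -mulrA; apply: ler_wpM2l; first exact: ltW.
    rewrite ler_pdivrMl//.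
    have m1 (f : R) : Num.min 1 f <= 1 by rewrite ge_min lexx.
    have m2 (f : R) : Num.min 1 f <= f by rewrite ge_min lexx orbT.
    have m3 (f : R) : 0 < f -> 0 <= Num.min 1 (f * h / t).
      by move=> f0; rewrite le_min ler01 divr_ge0 ?mulr_ge0 ?(ltW f0) ?(ltW h0) ?(ltW t0).
    have h16 : h ^+ 2 <= 16 * t.
      have -> : 16 * t = (4 * Num.sqrt t) ^+ 2 by rewrite exprMn sqr_sqrtr ?(ltW t0)// -natrX.
      rewrite lerXn2r ?nnegrE ?(ltW h0) ?mulr_ge0 ?(ltW st0)//.
      rewrite (le_trans (ltW hk))// ler_pM2l// /kap ler_piMl ?(ltW st0)//.
      by case/andP: k01.
    case: (leP 1 (a * c / t)) => ac.
      by rewrite mulr1 (@le_trans _ _ 1) ?ler1n// mulr_ile1 ?m3.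
    apply: (@le_trans _ _ ((c * h / t) * (a * h / t))); first by rewrite ler_pM ?m3.
    have -> : c * h / t * (a * h / t) = a * c / t * (h ^+ 2 / t) by field; rewrite gt_eqF.
    rewrite [leRHS]mulrC ler_wpM2l ?divr_ge0 ?mulr_ge0 ?(ltW a0) ?(ltW c0) ?(ltW t0)//.
    by rewrite ler_pdivrMr.
  have hD : eball ((1 - 2^-1) *: w + 2^-1 *: z) h `<=` D.
    by rewrite -midpointE; apply: eball_delta => //; rewrite midpointE; apply: segment_interior => //; exact: half01.
  have hD' : eball ((1 - 2^-1) *: z + 2^-1 *: w) h `<=` D.
    by rewrite -midpointE midC midpointE.
  have s01 : 0 <= (2^-1 : R) <= 1 by rewrite invr_ge0 ler0n invf_le1// ler1n.
  have l4 : kap / h <= 4^-1 by rewrite ler_pdivrMr//; move: hk; lrac.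
  (* This homothety shrinks the ball of radius [h / 2] from [transfer_ball] to radius [kap], and
     moves the fraction from 1/2 to [kap / h]. *)
  have sg01 : 0 <= 2 * kap / h <= 1.
    rewrite (divr_ge0 (mulr_ge0 _ (ltW kap0)) (ltW h0))//= ler_pdivrMr//.
    by move: hk kap0; lrac.
  have lE : 2^-1 * (2 * kap / h) = kap / h by field; rewrite gt_eqF.
  have kE : 2 * kap / h * (h / 2) = kap by field; rewrite gt_eqF.
  apply: (F1' (kap / h) (kap / h) h h) => //.
    by have := trw _ _ _ s01 sg01 h0 hD; rewrite lE kE.
  by have := trz _ _ _ s01 sg01 h0 hD'; rewrite lE kE.
(* With the homothety [2 * kap / h] the station has fraction [kap / (h / (2 * s))]. From
   [rho / 2 * (s * u) <= h] one gets [u <= M * (h / (2 * s))] with [M = 4 / rho]. *)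
have step (s h u : R) : 0 < s <= 1 -> 1 < h -> rho / 2 * (s * u) <= h ->
    [/\ 0 < h / (2 * s), u <= M * (h / (2 * s)), kap / (h / (2 * s)) <= 4^-1,
      0 <= 2 * kap / h <= 1 & s * (2 * kap / h) = kap / (h / (2 * s)) /\ 2 * kap / h * (h / 2) = kap].
  move=> /andP[s0 s1] h01 hr.
  have h0 : 0 < h by apply: lt_trans h01.
  split.
  - by rewrite divr_gt0// mulr_gt0.
  - have -> : M * (h / (2 * s)) = 2 * h / (rho * s) by rewrite /M; field; rewrite !gt_eqF.
    rewrite ler_pdivlMr ?mulr_gt0//; move: hr; lrac.
  - have -> : kap / (h / (2 * s)) = 2 * kap * s / h by field; rewrite !gt_eqF.
    rewrite ler_pdivrMr//.
    have : kap * s <= 8^-1 by rewrite -[leRHS]mulr1 ler_pM// ltW.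
    by move: h01; lrac.
  - rewrite (divr_ge0 (mulr_ge0 _ (ltW kap0)) (ltW h0))//= ler_pdivrMr//.
    by move: kap18 h01; lrac.
  - by split; field; rewrite !gt_eqF.
have [s [h [s01 h01 hD hr]]] := RD_far oD sD rho0 hrho bw bz wz ay1 DHy wk tw h1.
have h1' : 1 < delta D (midpoint z w) by rewrite midC.
have [s' [h' [s'01 h'01 hD' hr']]] := RD_far oD sD rho0 hrho bz bw zw ax1 DHx zk tz h1'.
have [p1 p2 p3 p4 [p5 p6]] := step s h _ s01 h01 hr.
have [q1 q2 q3 q4 [q5 q6]] := step s' h' _ s'01 h'01 hr'.
apply: (fin _ _ (ltW p1) (ltW q1) p2 q2); apply: (F1' _ _ _ _ p1 q1 erefl erefl p3 q3).
  have s01' : 0 <= s <= 1 by case/andP: s01 => /ltW -> ->.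
  by have := trw _ _ _ s01' p4 (lt_trans ltr01 h01) hD; rewrite p5 p6.
have s01' : 0 <= s' <= 1 by case/andP: s'01 => /ltW -> ->.
by have := trz _ _ _ s01' q4 (lt_trans ltr01 h'01) hD'; rewrite q5 q6.
Qed.

End Assembly.

Theorem theorem5p5 (R : realType) (n : nat) (hn : (0 < n)%N)
    (r T rho : R) (hr : 0 < r) (hT : 0 < T) :
  exists c1 c2 : R, [/\ 0 < c1, 0 < c2 &
    forall (D : set 'rV[R]_n), SR D -> C11r r D -> RD D = rho%:E ->
    forall pD : R -> 'rV[R]_n -> 'rV[R]_n -> R, dirichlet_heat_kernel D pD ->
    forall (x y : 'rV[R]_n) (t : R) (Hx Hy : set 'rV[R]_n),
      D x -> D y -> 0 < t < T ->
      is_halfspace Hx -> is_halfspace Hy ->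
      D `<=` Hx -> D `<=` Hy ->
      delta D x = delta Hx x -> delta D y = delta Hy y ->
      c1 * g_factor D Hx Hy t x y * heat_kernel t x y <= pD t x y
      /\ pD t x y <= c2 * g_factor D Hx Hy t x y * heat_kernel t x y].
Proof.
(* Membership in [SR] contains [0 < RD D], so for [rho <= 0] there is no domain to consider. *)
have [rho0|rho0] := ltP 0 rho; last first.
  exists 1, 1; split => // D [_ _ _ _ rD] _ hrho; exfalso.
  by move: rD; rewrite hrho lte_fin ltNge rho0.
have [c1 c10 low] := @pD_lower R n r T rho hr hT rho0.
exists c1, 22; split => // D [[_ oD _] sD _ _ _] cD hrho pD dk x y t Hx Hy Dx Dy tT.
move=> /is_halfspaceP[ax [kx [ax1 ->]]] /is_halfspaceP[ay [ky [ay1 ->]]] DHx DHy.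
have pos1 z : D z -> kx < dot ax z by exact: DHx.
have pos2 z : D z -> ky < dot ay z by exact: DHy.
rewrite /g_factor !delta_halfspace//; try by [exact: pos1|exact: pos2].
move=> dx dy; rewrite dx dy; split.
  exact: low oD sD cD hrho dk Dx Dy tT ax1 ay1 DHx DHy dx dy.
case/andP: tT => t0 _.
apply: (pD_upper oD dk t0 Dx Dy ax1 ay1 DHx DHy).
(* If the hyperplane of [Hx] were closer to [y] than [delta D y], its foot from [y] would lie in
   [D], hence in [Hx], although it is on the boundary of [Hx]. *)
rewrite -dy leNgt; apply/negP => lt.
have /DHx : D (y - (dot ax y - kx) *: ax).
  apply: (eball_delta oD Dy); rewrite /eball /= addrC addKr enormN enormZ ax1 mulr1.
  by rewrite ger0_norm// subr_ge0 ltW// pos1.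
by rewrite /halfspace /= dotBr dotZr (dotaa ax1) mulr1 subKr ltxx.
Qed.
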